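(* Let $d\ge2$ and let $\underline S=(S_1,\dots,S_{d-1},V)$ be a $\Gamma_d$-isometry on a Hilbert space $\mathcal H$. Then: (1) (Extension) There exists a $\Gamma_d$-unitary $\underline R=(R_1,\dots,R_{d-1},U)$ acting on a Hilbert space $\mathcal K$ containing $\mathcal H$ such that $\underline R$ is the minimal extension of $\underline S$. In fact, $$\mathcal K=\overline{\mathrm{span}}\{U^mh:\ h\in\mathcal H,\ m\in\mathbb Z\}.$$ Moreover, any operator $X$ acting on $\mathcal H$ commutes with $\underline S$ if and only if $X$ has a unique norm-preserving extension $Y$ acting on $\mathcal K$ commuting with $\underline R$. (2) (Halmos dilation) An operator $X$ on $\mathcal H$ is an $\underline S$-Toeplitz operator if and only if there exists a unique operator $Y$ in the commutant $\{R_1,\dots,R_{d-1},U\}'$ such that $$\|X\|=\|Y\|\quad\text{and}\quad X=P_{\mathcal H}Y|_{\mathcal H}.$$ (3) (Extension of $C^*(\underline R)$) Let $\mathcal C^*(\underline S)$ and $\mathcal C^*(\underline R)$ denote the unital $C^*$-algebras generated by $\{S_1,\dots,S_{d-1},V\}$ and $\{R_1,\dots,R_{d-1},U\}$, respectively, and let $\mathcal I(\underline S)$ denote the closed ideal of $\mathcal C^*(\underline S)$ generated by all the commutators $XY-YX$ for $X,Y\in\mathcal C^*(\underline S)\cap\mathcal T(\underline S)$. Then there exists a short exact sequence $$0\rightarrow\mathcal I(\underline S)\hookrightarrow\mathcal C^*(\underline S)\xrightarrow{\ \pi_0\ }\mathcal C^*(\underline R)\rightarrow0$$ with a completely isometric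 cross section, where $\pi_0:\mathcal C^*(\underline S)\to\mathcal C^*(\underline R)$ is the canonical unital $*$-homomorphism which sends the generating set $\underline S$ to the corresponding generating set $\underline R$, i.e. $\pi_0(V)=U$ and $\pi_0(S_i)=R_i$ for all $1\le i\le d-1$.
   Context: For $1\le i\le d$, $s_i(\bm z)=\sum_{1\le k_1<\cdots<k_i\le d}z_{k_1}\cdots z_{k_i}$ on $\mathbb C^d$, $\bm s=(s_1,\dots,s_d)$, $\Gamma_d=\bm s(\overline{\mathbb D}^d)$ (with $\mathbb D$ the open unit disk), and the distinguished boundary of $\Gamma_d$ is $b\Gamma_d=\bm s(\mathbb T^d)$ ($\mathbb T$ the unit circle). All operators are bounded. A $\Gamma_d$-unitary is a $d$-tuple $\underline R=(R_1,\dots,R_{d-1},U)$ of commuting normal operators on a Hilbert space whose Taylor joint spectrum is contained in $b\Gamma_d$. A $\Gamma_d$-isometry is a $d$-tuple $\underline S=(S_1,\dots,S_{d-1},V)$ of commuting operators on a Hilbert space $\mathcal H$ that has a $\Gamma_d$-unitary extension, i.e. there are a Hilbert space $\mathcal K\supseteq\mathcal H$ and a $\Gamma_d$-unitary $(R_1,\dots,R_{d-1},U)$ on $\mathcal K$ leaving $\mathcal H$ invariant with $R_i|_{\mathcal H}=S_i$ and $U|_{\mathcal H}=V$; the extension is minimal if no proper closed subspace of $\mathcal K$ containing $\mathcal H$ reduces all of $R_1,\dots,R_{d-1},U$. An operator $X$ on $\mathcal H$ is an $\underline S$-Toeplitz operator if it satisfies the Brown--Halmos relations with respect to $\underline S$: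 $S_i^*XV=XS_{d-i}$ for each $i=1,\dots,d-1$, and $V^*XV=X$. $\mathcal T(\underline S)$ denotes the set of all $\underline S$-Toeplitz operators. ''Commutes with $\underline S$'' (resp. $\underline R$) means commutes with each entry. $\{\cdot\}'$ is the commutant, and $P_{\mathcal H}$ is the orthogonal projection of $\mathcal K$ onto $\mathcal H$. A completely isometric cross section is a completely isometric linear map $\rho_0:\mathcal C^*(\underline R)\to\mathcal C^*(\underline S)$ with $\pi_0\circ\rho_0=\mathrm{id}$. *)

(* Defs.v *)
From HB Require Import structures.
From mathcomp Require Import all_boot all_order all_algebra.
From mathcomp Require Import all_classical all_reals all_analysis.
From mathcomp Require Import complex.

Set Implicit Arguments.
Unset Strict Implicit.
Unset Printing Implicit Defensive.

Import Order.TTheory GRing.Theory Num.Theory.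
Import numFieldNormedType.Exports.

Local Open Scope classical_set_scope.
Local Open Scope ring_scope.
Local Open Scope complex_scope.

(* The inner product is linear in its first argument.  Norms of a
   [normedModType R[i]] take their values in R[i]. *)
HB.mixin Record CompleteNormedModule_isHilbert (R : realType) H
    & CompleteNormedModule R[i] H := {
  dotp : H -> H -> R[i];
  dotpDl : forall x y z : H, dotp (x + y) z = dotp x z + dotp y z;
  dotpZl : forall (a : R[i]) (x y : H), dotp (a *: x) y = a * dotp x y;
  dotpC : forall x y : H, dotp x y = Num.conj (dotp y x);
  dotpxx : forall x : H, dotp x x = `|x| ^+ 2
}.

#[short(type="hilbertType")]
HB.structure Definition Hilbert (R : realType) :=
  {H of CompleteNormedModule R[i] H & CompleteNormedModule_isHilbert R H}.

Section Operators.
Variables (R : realType) (H K : hilbertType R).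

Definition bounded_op : set (H -> K) := [set T | linear T /\ continuous T].

Definition hnorm (x : H) : R := complex.Re `|x|.

Definition adj (T : H -> K) : K -> H :=
  xget 0 [set B : K -> H | forall x y, dotp (T x) y = dotp x (B y)].

(* Isometric embeddings encode the inclusion of H in a larger Hilbert space. *)
Definition isometric_embedding (iota : H -> K) :=
  linear iota /\ forall x y, dotp (iota x) (iota y) = dotp x y.

End Operators.

Section OperatorNorm.
Variables (R : realType) (H K : hilbertType R).

Definition opnorm (T : H -> K) : R :=
  sup [set hnorm (T x) | x in [set x : H | hnorm x <= 1]].

Definition l2norm n (x : 'I_n -> H) : R := Num.sqrt (\sum_i hnorm (x i) ^+ 2).

End OperatorNorm.

(* Norm of a matrix of operators, acting on the direct sum of n copies of H. *)
Definition mxopnorm (R : realType) (H : hilbertType R) n (A : 'M[H -> H]_n) : R :=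
  sup [set l2norm (fun i => \sum_j A i j (x j)) |
         x in [set x : 'I_n -> H | l2norm x <= 1]].

Section Subspaces.
Variables (R : realType) (H : hilbertType R).

Definition subspace (M : set H) :=
  M 0 /\ forall (a : R[i]) x y, M x -> M y -> M (a *: x + y).

Definition lspan (A : set H) : set H := smallest subspace A.

Definition reduces (M : set H) (T : H -> H) :=
  (forall x, M x -> M (T x)) /\ (forall x, M x -> M (adj T x)).

Definition orthoproj (M : set H) (x : H) : H :=
  xget 0 [set y | M y /\ forall z, M z -> dotp (x - y) z = 0].

End Subspaces.

Section SingleOperator.
Variables (R : realType) (H : hilbertType R).

Definition normal_op (T : H -> H) := T \o adj T = adj T \o T.

Definition opinv (T : H -> H) : H -> H :=
  xget 0 [set W : H -> H | W \o T = idfun /\ T \o W = idfun].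

Definition zpow (T : H -> H) (m : int) : H -> H :=
  match m with
  | Posz n => iter n T
  | Negz n => iter n.+1 (opinv T)
  end.

End SingleOperator.

Section OperatorTuples.
Variables (R : realType) (H : hilbertType R) (d : nat).

(* The d-tuple (S_1, ..., S_{d-1}, V).  The index i : 'I_d.-1 stands for i + 1,
   so that [S (rev_ord i)] is S_{d-(i+1)}. *)
Definition optuple (S : 'I_d.-1 -> H -> H) (V : H -> H) : 'I_d -> H -> H :=
  fun j => oapp S V (insub (j : nat)).

Implicit Types (T : 'I_d -> H -> H).

Definition commuting T := forall i j, T i \o T j = T j \o T i.

Definition commutes_with T (X : H -> H) := forall j, X \o T j = T j \o X.

(* The Koszul differential D_T = sum_i T_i (x) e_i on H (x) Lambda(C^d): the
   coefficient of x on the exterior monomial e_A is x A, and the sign comes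
   from moving e_i to its place in e_A. *)
Definition koszul T (x : {ffun {set 'I_d} -> H}) : {ffun {set 'I_d} -> H} :=
  [ffun A : {set 'I_d} => \sum_(i in A)
     (-1) ^+ #|[set j in A | (j < i)%N]| *: T i (x (A :\ i))].

Definition koszul_exact T :=
  forall x, koszul T x = 0 -> exists y, x = koszul T y.

Definition taylor_spectrum T : set 'rV[R[i]]_d :=
  [set l | ~ koszul_exact (fun j => T j - l 0 j *: idfun)].

End OperatorTuples.

Section SymmetrizedPolydisc.
Variables (R : realType) (d : nat).

(* The coordinate of index i is s_{i+1}. *)
Definition symmetrization (z : 'rV[R[i]]_d) : 'rV[R[i]]_d :=
  \row_(i < d) \sum_(A : {set 'I_d} | #|A| == i.+1) \prod_(k in A) z 0 k.

Definition bGamma : set 'rV[R[i]]_d :=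
  symmetrization @` [set z : 'rV[R[i]]_d | forall k, `|z 0 k| = 1].

End SymmetrizedPolydisc.

Section GammaTuples.
Variables (R : realType) (d : nat).

Definition gamma_unitary (K : hilbertType R)
    (N : 'I_d.-1 -> K -> K) (U : K -> K) :=
  [/\ forall j, bounded_op (optuple N U j),
      commuting (optuple N U),
      forall j, normal_op (optuple N U j) &
      taylor_spectrum (optuple N U) `<=` @bGamma R d].

Definition gamma_unitary_extension (H : hilbertType R)
    (S : 'I_d.-1 -> H -> H) (V : H -> H) (K : hilbertType R)
    (iota : H -> K) (N : 'I_d.-1 -> K -> K) (U : K -> K) :=
  [/\ isometric_embedding iota,
      gamma_unitary N U &
      forall j h, optuple N U j (iota h) = iota (optuple S V j h)].

Definition gamma_isometry (H : hilbertType R)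
    (S : 'I_d.-1 -> H -> H) (V : H -> H) :=
  [/\ forall j, bounded_op (optuple S V j),
      commuting (optuple S V) &
      exists (K : hilbertType R) (iota : H -> K)
             (N : 'I_d.-1 -> K -> K) (U : K -> K),
        gamma_unitary_extension S V iota N U].

Definition minimal_extension (H : hilbertType R)
    (S : 'I_d.-1 -> H -> H) (V : H -> H) (K : hilbertType R)
    (iota : H -> K) (N : 'I_d.-1 -> K -> K) (U : K -> K) :=
  gamma_unitary_extension S V iota N U /\
  forall M : set K, closed M -> subspace M -> range iota `<=` M ->
    (forall j, reduces M (optuple N U j)) -> M = setT.

Definition equivalent_extensions (H K K' : hilbertType R)
    (iota : H -> K) (N : 'I_d.-1 -> K -> K) (U : K -> K)
    (iota' : H -> K') (N' : 'I_d.-1 -> K' -> K') (U' : K' -> K') :=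
  exists W : K -> K', [/\ isometric_embedding W, range W = setT,
    W \o iota = iota' &
    forall j, W \o optuple N U j = optuple N' U' j \o W].

Definition toeplitz (H : hilbertType R)
    (S : 'I_d.-1 -> H -> H) (V : H -> H) : set (H -> H) :=
  [set X | [/\ bounded_op X,
     forall i, adj (S i) \o X \o V = X \o S (rev_ord i) &
     adj V \o X \o V = X]].

End GammaTuples.

Section CstarAlgebras.
Variables (R : realType) (H : hilbertType R).
Implicit Types (M J G : set (H -> H)).

Definition norm_closed M := forall T : H -> H, bounded_op T ->
  (forall e : R, 0 < e -> exists2 A, M A & opnorm (T - A) < e) -> M T.

Definition unital_Cstar_subalgebra M :=
  [/\ M `<=` @bounded_op R H H /\ M idfun,
      forall A B, M A -> M B -> M (A + B) /\ M (A \o B),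
      forall (a : R[i]) A, M A -> M (a *: A),
      forall A, M A -> M (adj A) &
      norm_closed M].

Definition Cstar G : set (H -> H) := smallest unital_Cstar_subalgebra G.

(* Two-sided; J is then stable by scaling since M contains the scalars when it
   is a unital algebra. *)
Definition closed_ideal M J :=
  [/\ J `<=` M /\ J 0,
      forall A B, J A -> J B -> J (A + B),
      forall A B, M A -> J B -> J (A \o B) /\ J (B \o A) &
      norm_closed J].

Definition generated_ideal M G : set (H -> H) := smallest (closed_ideal M) G.

End CstarAlgebras.

Definition commutator_ideal (R : realType) (H : hilbertType R) d
    (S : 'I_d.-1 -> H -> H) (V : H -> H) : set (H -> H) :=
  let A := Cstar (range (optuple S V)) in
  generated_ideal A [set (X \o Y) - (Y \o X) |
    X in A `&` toeplitz S V & Y in A `&` toeplitz S V].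

(* A map between the subalgebras M and N is represented by a map between the
   ambient operator algebras, of which only the values on M matter. *)
Section AlgebraMaps.
Variables (R : realType) (H K : hilbertType R).
Variables (M : set (H -> H)) (N : set (K -> K)).
Implicit Types (f : (H -> H) -> (K -> K)).

Definition linear_on f :=
  (forall A, M A -> N (f A)) /\
  (forall (a : R[i]) A B, M A -> M B -> f (a *: A + B) = a *: f A + f B).

Definition unital_star_morphism f :=
  [/\ linear_on f,
      f idfun = idfun,
      forall A B, M A -> M B -> f (A \o B) = f A \o f B &
      forall A, M A -> f (adj A) = adj (f A)].

Definition completely_isometric f := forall n (A : 'M[H -> H]_n),
  (forall i j, M (A i j)) -> mxopnorm (map_mx f A) = mxopnorm A.

End AlgebraMaps.

(* Main.v *)
Require Import Defs.
From mathcomp Require Import all_boot all_order all_algebra.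
From mathcomp Require Import all_classical all_reals all_analysis.
From mathcomp Require Import complex.
From HB Require Import structures.
From mathcomp Require Import ring lra zify.

Set Implicit Arguments.
Unset Strict Implicit.
Unset Printing Implicit Defensive.

Import Order.TTheory GRing.Theory Num.Theory.
Import numFieldNormedType.Exports.

Local Open Scope classical_set_scope.
Local Open Scope ring_scope.

(** Every [Gamma_d]-unitary [(N_1, ..., N_(d-1), U)] satisfies two algebraic relations:
[U] is unitary and [N_i^* U = N_(d-i)]. They hold for the coordinates of the points of
the distinguished boundary, where [|l_d| = 1] and [conj l_i l_d = l_(d-i)], and they
lift to the operators because commuting normal operators are controlled by their joint
spectrum. All the rest of the proof uses only these relations.

The lifting ([gamma_unitary_relations]) is the place where the Taylor spectrum matters.
By Fuglede's theorem ([fuglede]) the [N_i], [U] and their adjoints commute. If the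
difference [E] of the two sides of a relation were not zero, there would be unit vectors
that are approximate eigenvectors of all the operators at once, for some eigenvalues
[l], and on which [E] stays away from zero ([joint_approx_eigen]). They are found by
adjoining one self-adjoint operator at a time, maximizing its quadratic form with a
penalty for the earlier ones ([joint_step]). The point [l] cannot lie in the boundary,
where [E] would tend to zero; outside, the Koszul complex is exact, and exactness at the
top exterior power contradicts the existence of approximate eigenvectors, by the uniform
boundedness principle ([spectral_vanishing]).

Given any [Gamma_d]-unitary extension, the closure of the union of the subspaces
[U^{-n} H] reduces all its entries, as [N_i^* = N_(d-i) U^*], and the restriction to it
is minimal ([minimal_extension_exists]). In a minimal extension this union is dense, and
the entries act on it through [V] and the [S_i], whence uniqueness
([minimal_extensions_equivalent]).

From then on everything is governed by the strong limits of [U^{-n} iota X iota^* U^n],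
where [iota] is the inclusion of [H] in [K]. For a Toeplitz operator [X] the
Brown-Halmos relation [V^* X V = X] makes these operators compressions of one another, so
they converge ([slim_toeplitz]); the limit is the Halmos dilation of [X], with the same
norm, and it extends [X] when [X] commutes with the isometry ([toeplitz_lift],
[toeplitz_dilation], [commutant_extension]). Compression to [H] is inverse to this symbol
map on the operators commuting with [U] ([slim_rho]).

The operators [X] for which the limit exists, together with their adjoints, form a C-star
algebra containing the [S_i] and [V], on which the limit is a star homomorphism: this is
[pi_0]. Compression is a completely isometric section of it. It maps [C^*(R)] into
[C^*(S)] because [C^*(R)] is the closure of operators of the form [U^{-m} B] with [B]
extending an element of [C^*(S)] ([Cstar_star_analytic]). Finally compression is
multiplicative modulo the commutators of Toeplitz operators ([rho_mul]), so that an
element of [C^*(S)] differs from the compression of its symbol by an element of the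
commutator ideal ([defect_ideal]); this identifies the kernel ([slimit_kernel]). *)

Local Notation Re := complex.Re.
Local Notation Im := complex.Im.
Local Notation "x %:C" := (real_complex _ x) : ring_scope.
Local Notation subspace := Defs.subspace.

(** * Real-valued modulus, norm and the Cauchy-Schwarz inequality *)

Section Modulus.
Variable R : realType.
Implicit Types a b : R[i].

(** Norms with values in [R[i]] are real numbers in disguise. Bringing them
down to [R] makes them amenable to linear arithmetic; the same is done for
vectors by [hnorm]. *)
Definition modc a : R := Re `|a|.

Lemma modcE a : `|a| = (modc a)%:C.
Proof. by rewrite /modc RRe_real // ger0_real. Qed.

Lemma modc_ge0 a : 0 <= modc a.
Proof. by rewrite -lecR -modcE /= normr_ge0. Qed.

Lemma modcM a b : modc (a * b) = modc a * modc b.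
Proof. by apply: complexI; rewrite -modcE normrM rmorphM !modcE. Qed.

Lemma modcD a b : modc (a + b) <= modc a + modc b.
Proof. by rewrite -lecR -modcE rmorphD /= -!modcE ler_normD. Qed.

Lemma modcN a : modc (- a) = modc a.
Proof. by rewrite /modc normrN. Qed.

Lemma modc_real (x : R) : modc x%:C = `|x|.
Proof.
rewrite /modc normc_def /= expr0n /= addr0.
by rewrite sqrtr_sqr.
Qed.

Lemma modc0 : modc 0 = 0.
Proof. by rewrite -[0]/(0%:C) modc_real normr0. Qed.

Lemma modc1 : modc 1 = 1.
Proof. by rewrite /modc normr1. Qed.

Lemma modc_eq0 a : modc a = 0 -> a = 0.
Proof. by move=> a0; apply/normr0_eq0; rewrite modcE a0. Qed.

Lemma modc_sq a : (modc a ^+ 2)%:C = a * Num.conj a.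
Proof. by rewrite rmorphXn /= -modcE normCK. Qed.

Lemma Re_le_modc a : Re a <= modc a.
Proof.
by rewrite (le_trans (ler_norm _)) // -lecR -modcE normc_ge_Re.
Qed.

Lemma ReD a b : Re (a + b) = Re a + Re b.
Proof. by case: a b => [? ?] [? ?]. Qed.

Lemma ReN a : Re (- a) = - Re a.
Proof. by case: a. Qed.

Lemma Re_mulr (x : R) a : Re (x%:C * a) = x * Re a.
Proof. by case: a => u v; rewrite /= mul0r subr0. Qed.

Lemma conj_realC (x : R) : Num.conj (x%:C) = x%:C.
Proof. exact: conjc_real. Qed.

Lemma conjM a b : Num.conj (a * b) = Num.conj a * Num.conj b.
Proof. exact: (rmorphM Num.conj). Qed.

Lemma conjV a : Num.conj a^-1 = (Num.conj a)^-1.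
Proof. exact: (fmorphV Num.conj). Qed.

Lemma conj_nat n : Num.conj n%:R = n%:R :> R[i].
Proof. exact: (rmorph_nat Num.conj). Qed.

Lemma realCM (x y : R) : (x * y)%:C = x%:C * y%:C.
Proof. exact: (rmorphM (real_complex R)). Qed.

Lemma realCB (x y : R) : (x - y)%:C = x%:C - y%:C.
Proof. exact: (rmorphB (real_complex R)). Qed.

Lemma realC_nat n : (n%:R : R)%:C = n%:R.
Proof. exact: (rmorph_nat (real_complex R)). Qed.

Lemma modc_add_conj a : a + Num.conj a = (2 * Re a)%:C.
Proof. by rewrite [LHS]addcJ rmorphM /= rmorph_nat. Qed.
End Modulus.

Section NormDot.
Variables (R : realType) (H : hilbertType R).
Implicit Types (x y z : H) (a b : R[i]).

Lemma normhE x : `|x| = (hnorm x)%:C.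
Proof. by rewrite /hnorm RRe_real // ger0_real. Qed.

Lemma hnorm_ge0 x : 0 <= hnorm x.
Proof. by rewrite -lecR -normhE /= normr_ge0. Qed.

Lemma hnorm0 : hnorm (0 : H) = 0.
Proof. by rewrite /hnorm normr0. Qed.

Lemma hnorm_eq0 x : hnorm x = 0 -> x = 0.
Proof. by move=> x0; apply/normr0_eq0; rewrite normhE x0. Qed.

Lemma hnormD x y : hnorm (x + y) <= hnorm x + hnorm y.
Proof. by rewrite -lecR -normhE rmorphD /= -!normhE ler_normD. Qed.

Lemma hnormZ a x : hnorm (a *: x) = modc a * hnorm x.
Proof. by apply: complexI; rewrite -normhE normrZ rmorphM modcE normhE. Qed.

Lemma hnormN x : hnorm (- x) = hnorm x.
Proof. by rewrite /hnorm normrN. Qed.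

Lemma hnormBC x y : hnorm (x - y) = hnorm (y - x).
Proof. by rewrite -hnormN opprB. Qed.

Lemma hnormB x y : hnorm (x - y) <= hnorm x + hnorm y.
Proof. by rewrite -(hnormN y) hnormD. Qed.

Lemma hnorm_dist y x z : hnorm (x - z) <= hnorm (x - y) + hnorm (y - z).
Proof. by rewrite (_ : x - z = (x - y) + (y - z)) ?hnormD // addrA subrK. Qed.

Lemma hnorm_sum (I : Type) (r : seq I) (P : pred I) (F : I -> H) :
  hnorm (\sum_(i <- r | P i) F i) <= \sum_(i <- r | P i) hnorm (F i).
Proof.
elim/big_ind2 : _ => [|x s y t xs yt|//]; first by rewrite hnorm0.
exact: le_trans (hnormD _ _) (lerD xs yt).
Qed.

Lemma dotp0l y : dotp (0 : H) y = 0.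
Proof. by rewrite -(scale0r (0 : H)) dotpZl mul0r. Qed.

Lemma dotpNl x y : dotp (- x) y = - dotp x y.
Proof. by rewrite -scaleN1r dotpZl mulN1r. Qed.

Lemma dotpBl x y z : dotp (x - y) z = dotp x z - dotp y z.
Proof. by rewrite dotpDl dotpNl. Qed.

Lemma dotpDr x y z : dotp x (y + z) = dotp x y + dotp x z.
Proof. by rewrite dotpC dotpDl rmorphD /= -!dotpC. Qed.

Lemma dotpZr a x y : dotp x (a *: y) = Num.conj a * dotp x y.
Proof. by rewrite dotpC dotpZl rmorphM /= -dotpC. Qed.

Lemma dotp0r x : dotp x (0 : H) = 0.
Proof. by rewrite dotpC dotp0l rmorph0. Qed.

Lemma dotpNr x y : dotp x (- y) = - dotp x y.
Proof. by rewrite dotpC dotpNl rmorphN /= -dotpC. Qed.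

Lemma dotpBr x y z : dotp x (y - z) = dotp x y - dotp x z.
Proof. by rewrite dotpDr dotpNr. Qed.

Lemma dotp_suml (I : Type) (r : seq I) (P : pred I) (F : I -> H) y :
  dotp (\sum_(i <- r | P i) F i) y = \sum_(i <- r | P i) dotp (F i) y.
Proof.
elim/big_rec2 : _ => [|i s t _ <-]; first by rewrite dotp0l.
by rewrite dotpDl.
Qed.

Lemma dotp_hnorm x : dotp x x = (hnorm x ^+ 2)%:C.
Proof. by rewrite dotpxx normhE rmorphXn. Qed.

Lemma dotp_eq0 x : dotp x x = 0 -> x = 0.
Proof.
by rewrite dotp_hnorm => /complexI/eqP; rewrite expf_eq0 /= => /eqP/hnorm_eq0.
Qed.

Lemma dotp_ext x y : (forall z, dotp x z = dotp y z) -> x = y.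
Proof.
by move=> e; apply/subr0_eq/dotp_eq0; rewrite dotpBl e subrr.
Qed.

Lemma dotp_extr x y : (forall z, dotp z x = dotp z y) -> x = y.
Proof. by move=> e; apply: dotp_ext => z; rewrite dotpC e -dotpC. Qed.

Lemma hnormD_sq x y :
  hnorm (x + y) ^+ 2 = hnorm x ^+ 2 + hnorm y ^+ 2 + 2 * Re (dotp x y).
Proof.
apply: complexI; rewrite -dotp_hnorm dotpDl !dotpDr !dotp_hnorm.
rewrite (dotpC y x) !rmorphD /= -modc_add_conj; ring.
Qed.

Lemma hnormB_sq x y :
  hnorm (x - y) ^+ 2 = hnorm x ^+ 2 + hnorm y ^+ 2 - 2 * Re (dotp x y).
Proof. by rewrite hnormD_sq hnormN dotpNr ReN; ring. Qed.

Lemma parallelogram x y :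
  hnorm (x + y) ^+ 2 + hnorm (x - y) ^+ 2 = 2 * hnorm x ^+ 2 + 2 * hnorm y ^+ 2.
Proof. by rewrite hnormD_sq hnormB_sq; ring. Qed.

Lemma modc_dotpxx x : modc (dotp x x) = hnorm x ^+ 2.
Proof. by rewrite dotp_hnorm modc_real ger0_norm // sqr_ge0. Qed.

(** Expand the square of the norm of [|y|^2 x - <x, y> y]. *)
Lemma cauchy_schwarz x y : modc (dotp x y) <= hnorm x * hnorm y.
Proof.
have [y0|yn0] := eqVneq y 0.
  by rewrite y0 dotp0r modc0 hnorm0 mulr0.
have hy : 0 < hnorm y.
  rewrite lt_neqAle hnorm_ge0 andbT eq_sym; apply/eqP => /hnorm_eq0 e.
  by rewrite e eqxx in yn0.
set a := dotp x y.
have := sqr_ge0 (hnorm ((hnorm y ^+ 2)%:C *: x - a *: y)).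
rewrite hnormB_sq !hnormZ modc_real (ger0_norm (sqr_ge0 _)) dotpZl dotpZr -/a.
rewrite (mulrC (Num.conj a)) -modc_sq -rmorphM /= => h.
have {}h : 0 <= hnorm y ^+ 2 * ((hnorm x * hnorm y) ^+ 2 - modc a ^+ 2).
  by apply: le_trans h _; rewrite le_eqVlt; apply/orP; left; apply/eqP; ring.
rewrite pmulr_rge0 ?exprn_gt0 // subr_ge0 in h.
by rewrite -(ler_pXn2r (n := 2)) // nnegrE ?modc_ge0 // mulr_ge0 ?hnorm_ge0.
Qed.

Lemma Re_dotp_le x y : Re (dotp x y) <= hnorm x * hnorm y.
Proof. exact: le_trans (Re_le_modc _) (cauchy_schwarz x y). Qed.

End NormDot.

(** * Convergence of sequences and bounded operators *)

Section Convergence.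
Variables (R : realType) (H : hilbertType R).
Implicit Types (u v : nat -> H) (x y z l : H).

(** Convergence in the norm [hnorm], so that estimates are carried out in [R]
rather than in [R[i]]. *)
Definition hcvg u l :=
  forall e : R, 0 < e -> exists N, forall n, (N <= n)%N -> hnorm (u n - l) < e.

Lemma hcvg_cst x : hcvg (fun=> x) x.
Proof. by move=> e e0; exists 0%N => n _; rewrite subrr hnorm0. Qed.

Lemma hcvg_unique u l l' : hcvg u l -> hcvg u l' -> l = l'.
Proof.
move=> h h'; apply/subr0_eq/hnorm_eq0/eqP; rewrite eq_le hnorm_ge0 andbT.
apply/ler_addgt0Pl => e e0; rewrite addr0.
have e2 : 0 < e / 2 by lra.
have [N hN] := h _ e2; have [N' hN'] := h' _ e2.
have := hN (maxn N N') (leq_maxl _ _); have := hN' (maxn N N') (leq_maxr _ _).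
have := hnorm_dist (u (maxn N N')) l l'; rewrite (hnormBC l (u _)); lra.
Qed.

Lemma hcvg_near u v l :
  (exists N, forall n, (N <= n)%N -> u n = v n) -> hcvg u l -> hcvg v l.
Proof.
move=> [N uv] ul e e0; have [M hM] := ul _ e0.
exists (maxn N M) => n; rewrite geq_max => /andP[Nn Mn].
by rewrite -uv // hM.
Qed.

Lemma hcvg_ext u v l : (forall n, u n = v n) -> hcvg u l -> hcvg v l.
Proof. by move=> uv; apply: hcvg_near; exists 0%N. Qed.

Lemma hcvgD u v x y : hcvg u x -> hcvg v y -> hcvg (fun n => u n + v n) (x + y).
Proof.
move=> ux vy e e0; have e2 : 0 < e / 2 by lra.
have [N hN] := ux _ e2; have [M hM] := vy _ e2.
exists (maxn N M) => n; rewrite geq_max => /andP[/hN Nn /hM Mn].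
rewrite opprD addrACA.
by have := hnormD (u n - x) (v n - y); lra.
Qed.

Lemma hcvgS u l k : hcvg u l -> hcvg (fun n => u (n + k)%N) l.
Proof.
by move=> ul e /ul[N hN]; exists N => n Nn; apply: hN; rewrite (leq_trans Nn) ?leq_addr.
Qed.

Lemma hcvg_hnorm_le u l (C : R) :
  hcvg u l -> (forall n, hnorm (u n) <= C) -> hnorm l <= C.
Proof.
move=> ul uC; apply/ler_addgt0Pl => e /ul[N /(_ N (leqnn _)) hN].
have := hnormB (u N) (u N - l); rewrite opprB addrC subrK.
have := uC N; lra.
Qed.

(** Comparison with a single term is enough and spares one quantifier in each
use. *)
Definition hcauchy u :=
  forall e : R, 0 < e -> exists N, forall n, (N <= n)%N -> hnorm (u n - u N) < e.

Lemma hcomplete u : hcauchy u -> exists l, hcvg u l.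
Proof.
move=> cu.
have : cvg (u @ \oo).
  apply/cauchy_cvgP; apply: cauchy_exP => e e0.
  have eE : e = (Re e)%:C by rewrite RRe_real // gtr0_real.
  have e0' : 0 < Re e by rewrite -ltcR -eE.
  have [N hN] := cu _ e0'.
  exists (u N); exists N => // n /= Nn.
  rewrite -ball_normE /= normhE hnormBC eE ltcR; exact: hN.
move=> /cvg_ex[l /cvgrPdistC_lt ul]; exists l => e e0.
have e0' : 0 < e%:C by rewrite ltcR.
have [N _ hN] := ul _ e0'.
by exists N => n Nn; rewrite -ltcR -normhE; exact: hN.
Qed.

Lemma hcvg_cauchy u l : hcvg u l -> hcauchy u.
Proof.
move=> ul e e0; have e2 : 0 < e / 2 by lra.
have [N hN] := ul _ e2; exists N => n Nn.
have := hN n Nn; have := hN N (leqnn _).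
have := hnorm_dist l (u n) (u N); rewrite (hnormBC l); lra.
Qed.

Lemma closure_hnormP (A : set H) x :
  closure A x <-> forall e : R, 0 < e -> exists2 y, A y & hnorm (x - y) < e.
Proof.
split=> [cA e e0|hA B /nbhs_ballP[e /= e0 eB]].
  have e0' : 0 < e%:C by rewrite ltcR.
  have [y [Ay]] := cA _ (nbhsx_ballx x e%:C e0').
  by rewrite -ball_normE /= normhE ltcR; exists y.
have eE : e = (Re e)%:C by rewrite RRe_real // gtr0_real.
have e0' : 0 < Re e by rewrite -ltcR -eE.
have [y Ay xy] := hA _ e0'.
by exists y; split => //; apply: eB; rewrite -ball_normE /= normhE eE ltcR.
Qed.

Lemma closed_hnormP (A : set H) : closed A <->
  forall x, (forall e : R, 0 < e -> exists2 y, A y & hnorm (x - y) < e) -> A x.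
Proof.
split=> [cA x hx|hA x /closure_hnormP/hA//].
by apply: cA; exact/closure_hnormP.
Qed.

Lemma closed_hcvg (A : set H) u l : closed A -> (forall n, A (u n)) ->
  hcvg u l -> A l.
Proof.
move=> /closed_hnormP cA uA ul; apply: cA => e /ul[N /(_ N (leqnn _)) h].
by exists (u N) => //; rewrite hnormBC.
Qed.

End Convergence.

Lemma hcvg_lip (R : realType) (H K : hilbertType R) (f : H -> K) u l (C : R) :
  0 <= C -> (forall x y, hnorm (f x - f y) <= C * hnorm (x - y)) ->
  hcvg u l -> hcvg (fun n => f (u n)) (f l).
Proof.
move=> C0 fC ul e e0.
have [N hN] := ul (e / (C + 1)) ltac:(by rewrite divr_gt0 //; lra).
exists N => n /hN; rewrite ltr_pdivlMr ?ltr_wpDl // => h.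
apply: le_lt_trans (fC _ _) _; have := hnorm_ge0 (u n - l); nra.
Qed.

(** A null sequence under a name of its own, so that linear arithmetic treats
its terms as atoms. *)
Definition invS (R : realType) n : R := n.+1%:R^-1.

Lemma invS_gt0 (R : realType) n : 0 < invS R n.
Proof. by rewrite /invS invr_gt0. Qed.

Lemma invS_small (R : realType) (e : R) : 0 < e ->
  exists N, forall n, (N <= n)%N -> invS R n < e.
Proof.
move=> e0; exists (Num.truncn e^-1) => n Nn.
rewrite /invS invf_plt ?posrE //.
apply: lt_le_trans (truncnS_gt _) _; by rewrite ler_nat ltnS.
Qed.

Section BoundedOperators.
Variable R : realType.
Implicit Types (H K L : hilbertType R).

Section Linear.
Variables (H K : hilbertType R) (T : H -> K).
Hypothesis bT : bounded_op T.

Lemma bopZD (a : R[i]) x y : T (a *: x + y) = a *: T x + T y.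
Proof. exact: bT.1. Qed.

Lemma bopD x y : T (x + y) = T x + T y.
Proof. by rewrite -[x in LHS]scale1r bopZD scale1r. Qed.

Lemma bop0 : T 0 = 0.
Proof. by apply: (addrI (T 0)); rewrite -bopD !addr0. Qed.

Lemma bopZ (a : R[i]) x : T (a *: x) = a *: T x.
Proof. by rewrite -[a *: x]addr0 bopZD bop0 addr0. Qed.

Lemma bopN x : T (- x) = - T x.
Proof. by rewrite -scaleN1r bopZ scaleN1r. Qed.

Lemma bopB x y : T (x - y) = T x - T y.
Proof. by rewrite bopD bopN. Qed.

Lemma bop_sum (I : Type) (r : seq I) (P : pred I) (F : I -> H) :
  T (\sum_(i <- r | P i) F i) = \sum_(i <- r | P i) T (F i).
Proof. by elim/big_rec2 : _ => [|i s t _ <-]; rewrite ?bop0 ?bopD. Qed.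
End Linear.

(** Continuity at the origin of a linear map is a bound on a ball, hence
everywhere by homogeneity. *)
Lemma bopP H K (T : H -> K) : bounded_op T <->
  linear T /\ exists2 C : R, 0 <= C & forall x, hnorm (T x) <= C * hnorm x.
Proof.
split=> [[lT cT]|[lT [C C0 hC]]]; split => //.
  pose f : {linear H -> K} := HB.pack T (GRing.isLinear.Build _ _ _ _ _ lT).
  have /linear_boundedP[M [Mr hM]] := (linear_bounded_continuous f).2 cT.
  have ME : M = (Re M)%:C by rewrite RRe_real.
  exists (`|Re M| + 1) => [|x]; first by rewrite addr_ge0.
  have MC : M < (`|Re M| + 1)%:C.
    by rewrite ME ltcR (le_lt_trans (ler_norm _)) // ltrDl.
  have := hM _ MC x.
  by rewrite !normhE -rmorphM lecR.
pose f : {linear H -> K} := HB.pack T (GRing.isLinear.Build _ _ _ _ _ lT).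
apply/(linear_bounded_continuous f)/linear_boundedP.
exists C%:C; split; first by rewrite complex_real.
move=> M CM x; have Mr : M \is Num.real.
  rewrite realE; apply/orP; left; apply: le_trans (ltW CM); by rewrite lecR.
have ME : M = (Re M)%:C by rewrite RRe_real.
rewrite !normhE ME -rmorphM lecR (le_trans (hC x)) // ler_wpM2r ?hnorm_ge0 //.
by move: CM; rewrite ME ltcR => /ltW.
Qed.

Lemma bopI H K (T : H -> K) (C : R) : linear T -> 0 <= C ->
  (forall x, hnorm (T x) <= C * hnorm x) -> bounded_op T.
Proof. by move=> lT C0 hC; apply/bopP; split => //; exists C. Qed.

Lemma bounded_op_comp H K L (T : K -> L) (B : H -> K) :
  bounded_op T -> bounded_op B -> bounded_op (T \o B).
Proof.
move=> /bopP[lT [C C0 hC]] /bopP[lB [D D0 hD]].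
apply: (@bopI _ _ _ (C * D)); rewrite ?mulr_ge0 //.
  by move=> a x y /=; rewrite lB lT.
move=> x /=; apply: le_trans (hC _) _.
by rewrite -mulrA ler_wpM2l.
Qed.

Lemma bounded_op_id H : bounded_op (idfun : H -> H).
Proof. by apply: (@bopI _ _ _ 1) => // x; rewrite mul1r. Qed.

Lemma bounded_op0 H K : bounded_op (0 : H -> K).
Proof.
apply: (@bopI _ _ _ 0) => //.
  by move=> a x y; rewrite -[RHS]/(a *: 0 + 0) scaler0 addr0.
by move=> x; rewrite -[X in hnorm X]/(0 : K) hnorm0 mul0r.
Qed.

Lemma bounded_opD H K (T B : H -> K) :
  bounded_op T -> bounded_op B -> bounded_op (T + B).
Proof.
move=> /bopP[lT [C C0 hC]] /bopP[lB [D D0 hD]].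
apply: (@bopI _ _ _ (C + D)); rewrite ?addr_ge0 //.
  by move=> a x y; rewrite !fctE lT lB scalerDr addrACA.
move=> x; rewrite fctE (le_trans (hnormD _ _)) // mulrDl.
exact: lerD.
Qed.

Lemma bounded_opZ H K (a : R[i]) (T : H -> K) :
  bounded_op T -> bounded_op (a *: T).
Proof.
move=> /bopP[lT [C C0 hC]].
apply: (@bopI _ _ _ (modc a * C)); rewrite ?mulr_ge0 ?modc_ge0 //.
  by move=> b x y; rewrite !fctE lT scalerDr !scalerA (mulrC a).
by move=> x; rewrite fctE hnormZ -mulrA ler_wpM2l ?modc_ge0.
Qed.

Lemma bounded_opN H K (T : H -> K) : bounded_op T -> bounded_op (- T).
Proof.
move=> bT; rewrite (_ : - T = (-1 : R[i]) *: T); first exact: bounded_opZ.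
by apply/funext => x; rewrite !fctE scaleN1r.
Qed.

Lemma bounded_opB H K (T B : H -> K) :
  bounded_op T -> bounded_op B -> bounded_op (T - B).
Proof. by move=> bT bB; apply: bounded_opD => //; exact: bounded_opN. Qed.

Lemma bounded_op_iter H (T : H -> H) n : bounded_op T -> bounded_op (iter n T).
Proof.
move=> bT; elim: n => [|n IH]; first exact: bounded_op_id.
rewrite (_ : iter n.+1 T = T \o iter n T) //; exact: bounded_op_comp.
Qed.

Lemma opnorm_has_sup H K (T : H -> K) : bounded_op T ->
  has_sup [set hnorm (T x) | x in [set x : H | hnorm x <= 1]].
Proof.
move=> bT; split.
  by exists (hnorm (T 0)); exists 0 => //=; rewrite hnorm0.
have /bopP[_ [C C0 hC]] := bT.
exists C => _ [x /= x1 <-]; apply: le_trans (hC x) _.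
by rewrite -[leRHS]mulr1 ler_wpM2l.
Qed.

Lemma opnorm_ge0 H K (T : H -> K) : bounded_op T -> 0 <= opnorm T.
Proof.
move=> bT; rewrite -[leLHS](@hnorm0 _ K) -(bop0 bT).
apply: ub_le_sup; first exact: (opnorm_has_sup bT).2.
by exists 0 => //=; rewrite hnorm0.
Qed.

Lemma le_opnorm H K (T : H -> K) x : bounded_op T ->
  hnorm (T x) <= opnorm T * hnorm x.
Proof.
move=> bT; have [->|xn0] := eqVneq x 0.
  by rewrite (bop0 bT) !hnorm0 mulr0.
have hx : 0 < hnorm x.
  rewrite lt_neqAle hnorm_ge0 andbT eq_sym; apply/eqP => /hnorm_eq0 e.
  by rewrite e eqxx in xn0.
rewrite -ler_pdivrMr // mulrC.
have -> : (hnorm x)^-1 * hnorm (T x) = hnorm (T ((hnorm x)^-1%:C *: x)).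
  by rewrite (bopZ bT) hnormZ modc_real ger0_norm // invr_ge0 ltW.
apply: ub_le_sup; first exact: (opnorm_has_sup bT).2.
exists ((hnorm x)^-1%:C *: x) => //=.
rewrite hnormZ modc_real ger0_norm ?invr_ge0; last exact: ltW.
by rewrite mulVf; [exact: lexx|rewrite gt_eqF].
Qed.

Lemma opnorm_le H K (T : H -> K) (C : R) : 0 <= C ->
  (forall x, hnorm (T x) <= C * hnorm x) -> opnorm T <= C.
Proof.
move=> C0 hC; apply: sup_le_ub.
  by exists (hnorm (T 0)); exists 0 => //=; rewrite hnorm0.
move=> _ [x /= x1 <-]; apply: le_trans (hC x) _.
by rewrite -[leRHS]mulr1 ler_wpM2l.
Qed.

Lemma hcvg_bop H K (T : H -> K) u l : bounded_op T -> hcvg u l ->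
  hcvg (fun n => T (u n)) (T l).
Proof.
move=> bT; apply: (@hcvg_lip _ _ _ _ _ _ (opnorm T)); first exact: opnorm_ge0.
by move=> x y; rewrite -(bopB bT) le_opnorm.
Qed.

Lemma hcvgZ H (a : R[i]) (u : nat -> H) l :
  hcvg u l -> hcvg (fun n => a *: u n) (a *: l).
Proof.
apply: (@hcvg_lip _ _ _ ( *:%R a) _ _ (modc a)); first exact: modc_ge0.
by move=> x y; rewrite -scalerBr hnormZ.
Qed.

End BoundedOperators.

(** * Projection theorem, Riesz representation and adjoints *)

Section Projection.
Variables (R : realType) (H : hilbertType R).
Implicit Types (x y z : H) (M : set H).

Lemma subspaceD M x y : subspace M -> M x -> M y -> M (x + y).
Proof. by move=> [_ h] Mx My; rewrite -[x]scale1r; apply: h. Qed.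

Lemma subspaceZ M (a : R[i]) x : subspace M -> M x -> M (a *: x).
Proof. by move=> [M0 h] Mx; rewrite -[_ *: _]addr0; apply: h. Qed.

(** Moving from [y] by [t z] with [t = <x - y, z> / |z|^2] would lower the
squared distance by [|<x - y, z>|^2 / |z|^2]. *)
Lemma hnorm_min_orthogonal M x y : subspace M -> M y ->
  (forall z, M z -> hnorm (x - y) ^+ 2 <= hnorm (x - z) ^+ 2) ->
  forall z, M z -> dotp (x - y) z = 0.
Proof.
move=> sM My hmin z Mz.
have [->|zn0] := eqVneq z 0; first by rewrite dotp0r.
set a := dotp (x - y) z.
have hz : 0 < hnorm z.
  rewrite lt_neqAle hnorm_ge0 andbT eq_sym; apply/eqP => /hnorm_eq0 e.
  by rewrite e eqxx in zn0.
set t := (hnorm z ^- 2)%:C * a.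
have := hmin (y + t *: z) (subspaceD sM My (subspaceZ t sM Mz)).
rewrite opprD addrA (hnormB_sq (x - y)) dotpZr -/a hnormZ /t modcM modc_real.
rewrite conjM conj_realC -(mulrA (_%:C)) (mulrC (Num.conj a)) -modc_sq -realCM.
rewrite [Re _%:C]/=.
rewrite ger0_norm ?invr_ge0 ?sqr_ge0 // => h.
apply: modc_eq0; apply/eqP; rewrite -sqrf_eq0 eq_le sqr_ge0 andbT.
have e : (hnorm z ^- 2 * modc a * hnorm z) ^+ 2 = hnorm z ^- 2 * modc a ^+ 2.
  by field; rewrite gt_eqF.
rewrite e in h.
have h2 : hnorm z ^- 2 * modc a ^+ 2 <= 0 by move: h; lra.
by rewrite pmulr_rle0 ?invr_gt0 ?exprn_gt0 in h2.
Qed.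

(** By the parallelogram identity a minimizing sequence is Cauchy, because
midpoints stay in the subspace; its limit realizes the distance. *)
Lemma projection_exists M x : closed M -> subspace M ->
  exists2 y, M y & forall z, M z -> dotp (x - y) z = 0.
Proof.
move=> cM sM.
pose E := [set hnorm (x - z) ^+ 2 | z in M].
have E_inf : has_inf E.
  split; first by exists (hnorm (x - 0) ^+ 2); exists 0 => //; exact: sM.1.
  by exists 0 => _ [z _ <-]; exact: sqr_ge0.
pose s := inf E.
have sE z : M z -> s <= hnorm (x - z) ^+ 2.
  by move=> Mz; apply: ge_inf; [exact: E_inf.2|exists z].
have approx (n : nat) : exists m, M m /\ hnorm (x - m) ^+ 2 < s + invS R n.
  have n0 := invS_gt0 R n.
  have [_ [m Mm <-] hm] := inf_adherent n0 E_inf.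
  by exists m.
have [m hm] := choice approx.
have mid k n : hnorm (m k - m n) ^+ 2 <= 2 * (invS R k + invS R n).
  have := parallelogram (x - m k) (x - m n).
  have -> : x - m k - (x - m n) = m n - m k.
    by rewrite opprB addrC addrA subrK.
  have -> : x - m k + (x - m n) = (2%:C : R[i]) *: (x - (2^-1%:C : R[i]) *: (m k + m n)).
    rewrite scalerBr scalerA -rmorphM /= divff // scale1r opprD addrACA.
    by rewrite -mulr2n -scaler_nat rmorph_nat -opprD.
  rewrite hnormZ modc_real exprMn ger0_norm // (hnormBC (m n)).
  have := sE _ (subspaceZ (2^-1%:C) sM (subspaceD sM (hm k).1 (hm n).1)).
  have := (hm k).2; have := (hm n).2; lra.
have cm : hcauchy m.
  move=> e e0; have e4 : 0 < e ^+ 2 / 4 by rewrite divr_gt0 // exprn_gt0.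
  have [N hN] := invS_small e4; exists N => n Nn.
  rewrite -(ltr_pXn2r (n := 2)) ?nnegrE ?hnorm_ge0 ?ltW //.
  have := mid n N; have := hN n Nn; have := hN N (leqnn _); lra.
have [y my] := hcomplete cm.
have My : M y by apply: closed_hcvg my => // n; exact: (hm n).1.
exists y => //; apply: hnorm_min_orthogonal => // z Mz.
apply: le_trans _ (sE _ Mz).
apply/ler_addgt0Pl => e e0.
pose C := hnorm (x - y).
have C0 : 0 <= C := hnorm_ge0 _.
have d0 : 0 < Order.min 1 (e / (2 * (2 * C + 1) + 2)).
  by rewrite lt_min ltr01 divr_gt0 //; lra.
have [N1 h1] := my _ d0.
have e2 : 0 < e / 2 by lra.
have [N2 h2] := invS_small e2.
pose N := maxn N1 N2.
have := h1 N (leq_maxl _ _); rewrite lt_min => /andP[t1 t2].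
have := h2 N (leq_maxr _ _).
have := (hm N).2.
have := hnorm_dist (m N) x y; rewrite -/C.
move: t2; rewrite ltr_pdivlMr; last by lra.
set t := hnorm (m N - y); set q := hnorm (x - m N).
have t0 : 0 <= t := hnorm_ge0 _; have q0 : 0 <= q := hnorm_ge0 _.
move: t1; rewrite -/t => t1 t2 cq q1 n1.
have : C ^+ 2 <= (q + t) ^+ 2 by rewrite ler_pXn2r ?nnegrE ?addr_ge0.
have q1' : q <= C + t.
  have := hnorm_dist y x (m N); rewrite -/C -/q (hnormBC y) -/t; lra.
nra.
Qed.

(** A functional is a multiple of the coordinate along any vector [u]
orthogonal to its kernel, as [f u x - f x u] lies in the kernel. *)
Lemma riesz (f : H -> R[i]) (C : R) :
  (forall (a : R[i]) x y, f (a *: x + y) = a * f x + f y) ->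
  (forall x, modc (f x) <= C * hnorm x) ->
  exists w, forall x, f x = dotp x w.
Proof.
move=> fL fC.
have f0 : f 0 = 0.
  by apply: (addrI (f 0)); rewrite -{1}[f 0]mul1r -fL scale1r !addr0.
have fB x y : f (x - y) = f x - f y by rewrite addrC -scaleN1r fL mulN1r addrC.
have [|/existsNP[x0 fx0]] := pselect (forall x, f x = 0).
  by move=> h; exists 0 => x; rewrite dotp0r h.
pose M := [set x | f x = 0].
have sM : subspace M.
  by split => // a x y Mx My; rewrite /M /= fL Mx My mulr0 addr0.
have cM : closed M.
  apply/closed_hnormP => x hx; apply: modc_eq0; apply/eqP.
  rewrite eq_le modc_ge0 andbT; apply/ler_addgt0Pl => e e0; rewrite addr0.
  have [|y My xy] := hx (e / (`|C| + 1)); first by rewrite divr_gt0.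
  rewrite -[f x]subr0 -My -fB; apply: le_trans (fC _) _.
  move: xy; rewrite ltr_pdivlMr; last by rewrite ltr_pwDr.
  have := ler_norm C; have := hnorm_ge0 (x - y); nra.
have [p Mp hp] := projection_exists x0 cM sM.
pose u := x0 - p.
have fu : f u != 0 by rewrite fB Mp subr0; apply/eqP.
have uu : dotp u u != 0.
  by apply/eqP => /dotp_eq0 u0; rewrite u0 f0 eqxx in fu.
exists (Num.conj (f u / dotp u u) *: u) => x.
rewrite dotpZr conjCK.
have : dotp u (f u *: x - f x *: u) = 0.
  apply: hp; rewrite /M /= fB -[_ *: x]addr0 -[_ *: u]addr0 !fL f0 !addr0.
  by rewrite mulrC subrr.
rewrite dotpC => /(congr1 Num.conj); rewrite conjCK rmorph0 dotpBl !dotpZl => /subr0_eq e.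
by rewrite mulrAC e mulfK.
Qed.

(** Gliding hump: if the norms were unbounded, corrections of size [q k],
decreasing geometrically, would build a vector on which the [k]-th selected
functional exceeds [k / 2]. *)
Lemma uniform_boundedness (w : nat -> H) :
  (forall z, exists C, forall n, modc (dotp z (w n)) <= C) ->
  exists C, forall n, hnorm (w n) <= C.
Proof.
move=> pb; apply: contrapT => /forallNP nb.
have [q [q0 qS qN]] : exists q : nat -> R, [/\ forall k, 0 < q k,
    forall k, q k.+1 = q k / 3 & forall k, q k <= invS R k].
  exists (fun k => 3 ^- k); split => k; rewrite ?invr_gt0 ?exprn_gt0 //.
    by rewrite exprS invfM mulrC.
  rewrite /invS lef_pV2 ?posrE ?exprn_gt0 // -natrX ler_nat.
  by rewrite (leq_trans (ltn_expl k (isT : (1 < 3)%N))).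
have big (k : nat) : exists n, k%:R / q k < hnorm (w n).
  have /existsNP[n /negP] := nb (k%:R / q k); rewrite -ltNge; by exists n.
have [s hs] := choice big; pose v k := w (s k).
have v0 k : 0 < hnorm (v k) by apply: le_lt_trans (hs k); rewrite divr_ge0 // ltW.
pose h k : H := (q k / hnorm (v k))%:C *: v k.
have h_norm k : hnorm (h k) = q k.
  rewrite /h hnormZ modc_real ger0_norm; last first.
    by rewrite divr_ge0 ?hnorm_ge0 ?ltW.
  by rewrite divfK ?gt_eqF.
have step k z : exists z', hnorm (z' - z) <= q k /\
    q k * hnorm (v k) <= modc (dotp z' (v k)).
  have dh : modc (dotp (h k) (v k)) = q k * hnorm (v k).
    rewrite /h dotpZl modcM modc_dotpxx modc_real ger0_norm; last first.
      by rewrite divr_ge0 ?hnorm_ge0 ?ltW.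
    by rewrite expr2 mulrA divfK ?gt_eqF.
  have := modcD (dotp (z + h k) (v k)) (- dotp (z - h k) (v k)).
  rewrite -dotpBl opprB addrCA [z + _]addrC addrK modcN [h k + z]addrC.
  rewrite -mulr2n -scaler_nat -realC_nat dotpZl modcM modc_real dh ger0_norm // => dd.
  (* One of [z + h] and [z - h] sees at least half of the variation [2 <h,
  v>]. *)
  have [le1|lt1] := leP (q k * hnorm (v k)) (modc (dotp (z + h k) (v k))).
    by exists (z + h k); rewrite addrC addKr h_norm.
  exists (z - h k); rewrite addrC addKr hnormN h_norm; split => //; lra.
have [f hf] := choice (fun kz : nat * H => step kz.1 kz.2).
pose z := fix z k := if k is j.+1 then f (j, z j) else 0.
have zS k : hnorm (z k.+1 - z k) <= q k := (hf (k, z k)).1.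
have zv k : q k * hnorm (v k) <= modc (dotp (z k.+1) (v k)) := (hf (k, z k)).2.
have tail k j : hnorm (z (k + j)%N - z k) <= 3 / 2 * (q k - q (k + j)%N).
  elim: j => [|j IH]; first by rewrite addn0 !subrr hnorm0 mulr0.
  have := hnorm_dist (z (k + j)%N) (z (k + j).+1) (z k); rewrite addnS.
  have := zS (k + j)%N.
  have := qS (k + j)%N; lra.
have cz : hcauchy z.
  move=> e e0.
  have [N hN] := invS_small (e := e / 2) ltac:(lra).
  exists N => n Nn; rewrite -(subnKC Nn).
  apply: le_lt_trans (tail _ _) _.
  have := hN N (leqnn N); have := q0 (N + (n - N))%N.
  have := qN N; lra.
have [l zl] := hcomplete cz.
have zl_near k : hnorm (z k - l) <= 3 / 2 * q k.
  apply/ler_addgt0Pl => e e0; have [N hN] := zl _ e0.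
  have := hN (k + N)%N (leq_addl _ _); have := tail k N.
  have := q0 (k + N)%N.
  have := hnorm_dist (z (k + N)%N) (z k) l; rewrite (hnormBC (z k) (z _)); lra.
have [C hC] := pb l.
have := hC (s (Num.truncn (2 * C)).+1); set k := (Num.truncn _).+1; rewrite -/(v k) => hk.
have k2 : 2 * C < k%:R := truncnS_gt _.
have := zv k; have := hs k; rewrite -/(v k) => h1 h2.
have h3 : k%:R < q k * hnorm (v k).
  by rewrite mulrC -ltr_pdivrMr.
have := modcD (dotp l (v k)) (dotp (z k.+1 - l) (v k)).
rewrite -dotpDl [l + _]addrC subrK.
have := cauchy_schwarz (z k.+1 - l) (v k).
have : hnorm (z k.+1 - l) * hnorm (v k) <= 2^-1 * q k * hnorm (v k).
  apply: ler_wpM2r; first exact: hnorm_ge0.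
  have := zl_near k.+1.
  have := qS k; lra.
lra.
Qed.

End Projection.

Section Adjoint.
Variable R : realType.
Implicit Types (H K L : hilbertType R).

(** Riesz representation of [x |-> <T x, y>] shows that the choice in [adj] is
not vacuous. *)
Lemma adjP H K (T : H -> K) x y : bounded_op T ->
  dotp (T x) y = dotp x (adj T y).
Proof.
move=> bT.
have /choice[B hB] : forall z, exists w, forall u, dotp (T u) z = dotp u w.
  move=> z.
  apply: (@riesz _ _ (fun u => dotp (T u) z) (opnorm T * hnorm z)).
    by move=> a u v; rewrite (bopZD bT) dotpDl dotpZl.
  move=> u; apply: le_trans (cauchy_schwarz _ _) _.
  by rewrite mulrAC ler_wpM2r ?hnorm_ge0 ?le_opnorm.
rewrite /adj; case: xgetP => [D _ /= -> //|/(_ B)/=]; by case.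
Qed.

Lemma adj_eq H K (T : H -> K) (B : K -> H) :
  (forall x y, dotp (T x) y = dotp x (B y)) -> adj T = B.
Proof.
move=> hB; rewrite /adj; case: xgetP => [D _ /= hD|/(_ B)/=]; last by case.
by apply/funext => y; apply: dotp_extr => x; rewrite -hD hB.
Qed.

Lemma adjPr H K (T : H -> K) x y : bounded_op T ->
  dotp x (T y) = dotp (adj T x) y.
Proof. by move=> bT; rewrite dotpC adjP // -dotpC. Qed.

Lemma adj_le H K (T : H -> K) y : bounded_op T ->
  hnorm (adj T y) <= opnorm T * hnorm y.
Proof.
move=> bT; have [e|n0] := eqVneq (hnorm (adj T y)) 0.
  by rewrite e mulr_ge0 ?opnorm_ge0 ?hnorm_ge0.
have p : 0 < hnorm (adj T y) by rewrite lt_neqAle eq_sym n0 hnorm_ge0.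
rewrite -(ler_pM2r p) -expr2 -modc_dotpxx -adjP //.
apply: le_trans (cauchy_schwarz _ _) _.
rewrite -mulrA [hnorm y * _]mulrC mulrA ler_wpM2r ?hnorm_ge0 //.
exact: le_opnorm.
Qed.

Lemma bounded_op_adj H K (T : H -> K) : bounded_op T -> bounded_op (adj T).
Proof.
move=> bT; apply: (@bopI _ _ _ _ (opnorm T)); last by move=> y; exact: adj_le.
  move=> a x y; apply: dotp_extr => z.
  by rewrite -adjP // !dotpDr !dotpZr -!adjP.
exact: opnorm_ge0.
Qed.

Lemma adjK H K (T : H -> K) : bounded_op T -> adj (adj T) = T.
Proof. by move=> bT; apply: adj_eq => x y; rewrite -adjPr. Qed.

Lemma adj_comp H K L (T : K -> L) (B : H -> K) :
  bounded_op T -> bounded_op B -> adj (T \o B) = adj B \o adj T.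
Proof. by move=> bT bB; apply: adj_eq => x y /=; rewrite !adjP. Qed.

Lemma adj_id H : adj (idfun : H -> H) = idfun.
Proof. exact: adj_eq. Qed.

Lemma adjD H K (T B : H -> K) : bounded_op T -> bounded_op B ->
  adj (T + B) = adj T + adj B.
Proof.
by move=> bT bB; apply: adj_eq => x y; rewrite !fctE dotpDl dotpDr !adjP.
Qed.

Lemma adjZ H K (a : R[i]) (T : H -> K) : bounded_op T ->
  adj (a *: T) = Num.conj a *: adj T.
Proof.
by move=> bT; apply: adj_eq => x y; rewrite !fctE dotpZl dotpZr conjCK adjP.
Qed.

Lemma adjB H K (T B : H -> K) : bounded_op T -> bounded_op B ->
  adj (T - B) = adj T - adj B.
Proof.
by move=> bT bB; apply: adj_eq => x y; rewrite !fctE dotpBl dotpBr !adjP.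
Qed.

Lemma adj0 H K : adj (0 : H -> K) = 0.
Proof.
by apply: adj_eq => x y; rewrite [LHS]dotp0l [RHS]dotp0r.
Qed.

Lemma opnorm_adj H K (T : H -> K) : bounded_op T -> opnorm (adj T) = opnorm T.
Proof.
move=> bT; have bA := bounded_op_adj bT.
apply/eqP; rewrite eq_le opnorm_le ?opnorm_ge0 //=; last by move=> y; exact: adj_le.
rewrite -{1}(adjK bT); apply: opnorm_le; first exact: opnorm_ge0.
by move=> y; exact: adj_le.
Qed.

Lemma hnorm_adj_sq H K (T : H -> K) x : bounded_op T ->
  hnorm (T x) ^+ 2 = Re (dotp (adj T (T x)) x).
Proof. by move=> bT; rewrite -adjPr // dotp_hnorm. Qed.

Lemma normal_hnorm H (T : H -> H) x : bounded_op T -> normal_op T ->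
  hnorm (adj T x) = hnorm (T x).
Proof.
move=> bT nT; have bA := bounded_op_adj bT.
apply/eqP; rewrite -(eqrXn2 (n := 2)) ?hnorm_ge0 // !hnorm_adj_sq // adjK //.
by have := congr1 (fun f => f x) nT => /= ->.
Qed.

Lemma isometry_bounded H K (f : H -> K) : isometric_embedding f -> bounded_op f.
Proof.
move=> [lf hf]; apply: (@bopI _ _ _ _ 1) => // x.
rewrite mul1r -(ler_pXn2r (n := 2)) ?nnegrE ?hnorm_ge0 //.
by rewrite -!modc_dotpxx hf.
Qed.

Lemma isometry_hnorm H K (f : H -> K) x : isometric_embedding f ->
  hnorm (f x) = hnorm x.
Proof.
move=> [lf hf]; apply/eqP; rewrite -(eqrXn2 (n := 2)) ?hnorm_ge0 //.
by rewrite -!modc_dotpxx hf.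
Qed.

Lemma isometry_adjK H K (f : H -> K) x : isometric_embedding f -> adj f (f x) = x.
Proof.
move=> If; apply: dotp_extr => z; rewrite -adjP; first exact: If.2.
exact: isometry_bounded.
Qed.

Lemma adj_isometry_le H K (f : H -> K) y : isometric_embedding f ->
  hnorm (adj f y) <= hnorm y.
Proof.
move=> If; have bf := isometry_bounded If.
apply: le_trans (adj_le y bf) _; rewrite -[leRHS]mul1r ler_wpM2r ?hnorm_ge0 //.
by apply: opnorm_le => // x; rewrite isometry_hnorm // mul1r.
Qed.

Lemma orthoproj_isometry H K (f : H -> K) y : isometric_embedding f ->
  orthoproj (range f) y = f (adj f y).
Proof.
move=> If; have bf := isometry_bounded If.
have P : forall z, range f z -> dotp (y - f (adj f y)) z = 0.
  move=> _ [x _ <-]; rewrite adjPr // (bopB (bounded_op_adj bf)) isometry_adjK //.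
  by rewrite subrr dotp0l.
rewrite /orthoproj; case: xgetP => [w _ /= [[x _ <-] hw]|/(_ (f (adj f y)))[]]; last first.
  by split => //; exists (adj f y).
congr f; apply/esym/subr0_eq/dotp_eq0.
rewrite dotpBl -!(If.2) -dotpBl.
have -> : f (adj f y) - f x = (y - f x) - (y - f (adj f y)).
  by rewrite opprB [RHS]addrC addrA subrK.
by rewrite dotpBl hw ?P ?subrr //; exists (adj f y - x).
Qed.

End Adjoint.

(** * Fuglede's theorem *)

Section VectorPolynomials.
Variables (R : realType) (H : hilbertType R).
Implicit Types (c : nat -> H) (z w : R[i]).

Lemma sum_even_odd (V : zmodType) (F : nat -> V) n :
  \sum_(k < n.*2) F k = \sum_(k < n) F k.*2 + \sum_(k < n) F k.*2.+1.
Proof.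
elim: n => [|n IH]; first by rewrite !big_ord0 addr0.
by rewrite doubleS !big_ord_recr /= IH -!addrA; congr (_ + _); rewrite addrCA.
Qed.

Lemma sqr_modc1 z : modc (z ^+ 2) = 1 -> modc z = 1.
Proof.
rewrite expr2 modcM -expr2 => /eqP; rewrite sqrp_eq1 ?modc_ge0 //.
by move=> /eqP.
Qed.

(** The average of a polynomial over [z] and [- z] is a polynomial of half the
degree in [z ^+ 2]. *)
Lemma even_part c n z : \sum_(k < n) (z ^+ 2) ^+ k *: c k.*2 =
  2^-1 *: (\sum_(k < n.*2) z ^+ k *: c k + \sum_(k < n.*2) (- z) ^+ k *: c k).
Proof.
rewrite (sum_even_odd (fun k => z ^+ k *: c k)) (sum_even_odd (fun k => (- z) ^+ k *: c k)).
apply: (@scalerI _ _ (2 : R[i])); first by rewrite pnatr_eq0.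
rewrite [RHS]scalerA divff ?pnatr_eq0 // scale1r.
rewrite addrACA -[X in _ = _ + X]big_split /= [X in _ = _ + X]big1 ?addr0; last first.
  by move=> k _; rewrite !exprS -muln2 mulnC !exprM sqrrN mulNr scaleNr subrr.
rewrite -big_split /= scaler_sumr; apply: eq_bigr => k _.
by rewrite -muln2 mulnC !exprM sqrrN scaler_nat mulr2n.
Qed.

Lemma odd_part c n z : z *: (\sum_(k < n) (z ^+ 2) ^+ k *: c k.*2.+1) =
  2^-1 *: (\sum_(k < n.*2) z ^+ k *: c k - \sum_(k < n.*2) (- z) ^+ k *: c k).
Proof.
rewrite (sum_even_odd (fun k => z ^+ k *: c k)) (sum_even_odd (fun k => (- z) ^+ k *: c k)).
apply: (@scalerI _ _ (2 : R[i])); first by rewrite pnatr_eq0.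
rewrite [RHS]scalerA divff ?pnatr_eq0 // scale1r.
rewrite opprD addrACA -!sumrB [X in _ = X + _]big1 ?add0r; last first.
  by move=> k _; rewrite -muln2 mulnC !exprM sqrrN subrr.
rewrite !scaler_sumr; apply: eq_bigr => k _.
rewrite -muln2 mulnC (exprS z (2 * k)) (exprS (- z) (2 * k)) !exprM sqrrN mulNr scaleNr opprK.
by rewrite scaler_nat mulr2n scalerA.
Qed.

Lemma modc_half : modc (2^-1 : R[i]) = 2^-1.
Proof.
rewrite -realC_nat -(fmorphV (real_complex R)) modc_real ger0_norm //.
Qed.

Lemma hnorm_half_sum (x y : H) B : hnorm x <= B -> hnorm y <= B ->
  hnorm (2^-1 *: (x + y)) <= B.
Proof.
move=> hx hy; rewrite hnormZ modc_half.
have := hnormD x y; lra.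
Qed.

(** A Cauchy estimate on the unit circle without integrals: averaging over the
two square roots of a point halves the degree, keeps the constant term and
does not increase the bound. *)
Lemma coef0_bound s c B :
  (forall z, modc z = 1 -> hnorm (\sum_(k < 2 ^ s) z ^+ k *: c k) <= B) ->
  hnorm (c 0%N) <= B.
Proof.
elim: s c => [|s IH] c hB.
  by have := hB 1 (modc1 R); rewrite expn0 big_ord1 expr0 scale1r.
rewrite -[0%N]/(0.*2); apply: (IH (fun k => c k.*2)) => w w1.
have wE := sqrtCK w; rewrite -{}wE in w1 *; have z1 := sqr_modc1 w1.
rewrite even_part; apply: hnorm_half_sum; rewrite -mul2n -expnS; apply: hB => //.
by rewrite modcN.
Qed.

(** Apply the previous estimate to the odd part divided by [z], which has the
same norm on the circle. *)
Lemma coef1_bound s c B : (0 < s)%N ->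
  (forall z, modc z = 1 -> hnorm (\sum_(k < 2 ^ s) z ^+ k *: c k) <= B) ->
  hnorm (c 1%N) <= B.
Proof.
case: s => // s _ hB.
rewrite -[1%N]/(0.*2.+1); apply: (@coef0_bound s (fun k => c k.*2.+1)) => w w1.
have wE := sqrtCK w; rewrite -{}wE in w1 *; have z1 := sqr_modc1 w1.
rewrite -[leLHS]mul1r -[X in X * _]z1 -hnormZ odd_part.
apply: hnorm_half_sum; rewrite ?hnormN -mul2n -expnS; apply: hB => //.
by rewrite modcN.
Qed.

(** A polynomial function with values in [H], remembered only through its
first two coefficients: the Cauchy estimate for the coefficient of [z] needs
nothing else. *)
Definition vpoly (f : R[i] -> H) (v0 v1 : H) := exists c d,
  [/\ c 0%N = v0, c 1%N = v1, forall k, (d <= k)%N -> c k = 0 &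
      forall z, f z = \sum_(k < d) z ^+ k *: c k].

Lemma vpoly_widen c d d' z : (forall k, (d <= k)%N -> c k = 0) -> (d <= d')%N ->
  \sum_(k < d) z ^+ k *: c k = \sum_(k < d') z ^+ k *: c k.
Proof.
move=> c0 /subnKC <-; rewrite big_split_ord /= [X in _ = _ + X]big1 ?addr0 //.
by move=> k _; rewrite c0 ?scaler0 // leq_addr.
Qed.

Lemma vpoly_bound f v0 v1 B : vpoly f v0 v1 ->
  (forall z, modc z = 1 -> hnorm (f z) <= B) -> hnorm v1 <= B.
Proof.
move=> [c [d [_ <- c0 fE]]] hB; apply: (@coef1_bound d.+1) => // z z1.
rewrite -(@vpoly_widen c d) // -?fE; first exact: hB.
by apply: ltnW; rewrite (ltn_trans (ltnSn d)) // ltn_expl.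
Qed.

Lemma vpoly_cst x : vpoly (fun=> x) x 0.
Proof.
exists (fun k => if k is 0%N then x else 0), 1%N; split => //; first by case.
by move=> z; rewrite big_ord1 scale1r.
Qed.

Lemma vpolyD f g v0 v1 (w0 w1 : H) : vpoly f v0 v1 -> vpoly g w0 w1 ->
  vpoly (fun z => f z + g z) (v0 + w0) (v1 + w1).
Proof.
move=> [c [d [<- <- c0 fE]]] [c' [d' [<- <- c0' gE]]].
exists (fun k => c k + c' k), (maxn d d'); split => // [k|z].
  by rewrite geq_max => /andP[/c0 -> /c0' ->]; rewrite addr0.
rewrite fE gE (vpoly_widen _ c0 (leq_maxl d d')) (vpoly_widen _ c0' (leq_maxr d d')).
by rewrite -big_split; apply: eq_bigr => k _; rewrite scalerDr.
Qed.

Lemma vpoly_mulz f v0 v1 : vpoly f v0 v1 -> vpoly (fun z => z *: f z) 0 v0.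
Proof.
move=> [c [d [<- _ c0 fE]]].
exists (fun k => if k is j.+1 then c j else 0), d.+1; split => // [[|k]//|z].
  exact: c0.
rewrite fE big_ord_recl /= scaler0 add0r scaler_sumr; apply: eq_bigr => k _.
by rewrite scalerA -exprS.
Qed.

Lemma vpoly_bop f v0 v1 (B : H -> H) : bounded_op B -> vpoly f v0 v1 ->
  vpoly (fun z => B (f z)) (B v0) (B v1).
Proof.
move=> bB [c [d [<- <- c0 fE]]]; exists (B \o c), d; split => // [k /c0 /= ->|z].
  exact: bop0.
by rewrite fE (bop_sum bB); apply: eq_bigr => k _; rewrite (bopZ bB).
Qed.

End VectorPolynomials.

Section Fuglede.
Variables (R : realType) (H : hilbertType R).
Implicit Types (T B N : H -> H) (z : R[i]).

Lemma iter_commute (f g : H -> H) n : f \o g = g \o f ->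
  iter n f \o g = g \o iter n f.
Proof.
move=> fg; apply/funext => x /=; elim: n => //= n ->.
by rewrite -[LHS]/((f \o g) _) fg.
Qed.

Lemma iter_comp_commute (f g : H -> H) n x : f \o g = g \o f ->
  iter n f (iter n g x) = iter n (f \o g) x.
Proof.
move=> fg; elim: n => //= n <-; congr f.
exact: (congr1 (fun h => h (iter n g x)) (iter_commute n fg)).
Qed.

(** Normality lets the adjoint slide past the powers of [T], one factor at a
time. *)
Lemma normal_hnorm_iter T n x : bounded_op T -> normal_op T ->
  hnorm (iter n T x) = hnorm (iter n (adj T) x).
Proof.
move=> bT nT; elim: n x => // n IH x; rewrite iterS -normal_hnorm //.
have := congr1 (fun f => f x) (iter_commute n nT) => /= e.
by rewrite -e IH -iterSr.
Qed.

(** The operators [1 + z N] and, below, the truncated Neumann series of its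
inverse, [1 - z N + z^2 N^2 - ...] with [m] terms. *)
Definition addZ N z x := x + z *: N x.

Fixpoint geomZ N z m x := if m is j.+1 then x - z *: N (geomZ N z j x) else 0.

Lemma bounded_op_addZ N z : bounded_op N -> bounded_op (addZ N z).
Proof. by move=> bN; apply: bounded_opD (bounded_op_id H) (bounded_opZ z bN). Qed.

Lemma addZ_commute N z B : bounded_op B -> B \o N = N \o B ->
  B \o addZ N z = addZ N z \o B.
Proof.
move=> bB BN; apply/funext => x; rewrite /addZ /= (bopD bB) (bopZ bB).
by rewrite -[N (B x)]/((N \o B) x) -BN.
Qed.

Lemma geomZ_commute N z m B : bounded_op B -> B \o N = N \o B ->
  B \o geomZ N z m = geomZ N z m \o B.
Proof.
move=> bB BN; apply/funext => x /=; elim: m => [|m /= IH]; first exact: bop0.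
rewrite (bopB bB) (bopZ bB) -IH.
by rewrite -[N (B _)]/((N \o B) _) -BN.
Qed.

(** Telescoping of the truncated Neumann series. *)
Lemma addZ_geomZ N z m x : bounded_op N ->
  addZ N z (geomZ N z m x) = x - iter m (fun y => - z *: N y) x.
Proof.
move=> bN; have bA := bounded_op_addZ z bN.
elim: m => [|m IH] /=; first by rewrite (bop0 bA) subrr.
rewrite (bopB bA) (bopZ bA).
have /(congr1 (fun f => f (geomZ N z m x)))/= <- := addZ_commute z bN (erefl _).
rewrite IH {1}/addZ (bopB bN) scalerBr opprB addrACA subrr addr0.
by rewrite scaleNr opprK.
Qed.

(** The [n]-th power of [1 + z N] is [1 + n z N] up to order two; its
truncated inverse, in [vpoly_iter_geomZ], is [1 - n z N]. *)
Lemma vpoly_iter_addZ N n f v0 v1 : bounded_op N -> vpoly f v0 v1 ->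
  vpoly (fun z => iter n (addZ N z) (f z)) v0 (v1 + n%:R *: N v0).
Proof.
move=> bN hf; elim: n => [|n IH]; first by rewrite scale0r addr0.
have := vpolyD IH (vpoly_mulz (vpoly_bop bN IH)).
by rewrite addr0 -addrA -{2}[N v0]scale1r -scalerDl -natr1.
Qed.

Lemma vpoly_geomZ N m f v0 v1 : bounded_op N -> vpoly f v0 v1 ->
  vpoly (fun z => geomZ N z m.+2 (f z)) v0 (v1 - N v0).
Proof.
move=> bN hf.
have base k : exists w, vpoly (fun z => geomZ N z k.+1 (f z)) v0 w.
  elim: k => [|k [w IH]] /=; first exists (v1 + 0).
    have h0 := vpoly_cst (0 : H).
    have := vpolyD hf h0; rewrite !addr0 => -[c [d [c0 c1 cd cE]]].
    by exists c, d; split => // z; rewrite -cE (bop0 bN) scaler0 subr0 addr0.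
  exists (v1 - N v0).
  have := vpolyD hf (vpoly_bop (bounded_opN (bounded_op_id H)) (vpoly_mulz (vpoly_bop bN IH))).
  by rewrite !fctE oppr0 addr0.
have [w hw] := base m.
have := vpolyD hf (vpoly_bop (bounded_opN (bounded_op_id H)) (vpoly_mulz (vpoly_bop bN hw))).
by rewrite !fctE oppr0 addr0.
Qed.

Lemma vpoly_iter_geomZ N m n f v0 v1 : bounded_op N -> vpoly f v0 v1 ->
  vpoly (fun z => iter n (geomZ N z m.+2) (f z)) v0 (v1 - n%:R *: N v0).
Proof.
move=> bN hf; elim: n => [|n IH]; first by rewrite scale0r subr0.
have := vpoly_geomZ m bN IH.
by rewrite -addrA -opprD -{2}[N v0]scale1r -scalerDl -natr1.
Qed.

(** A crude bound suffices, as [a] will be exponentially small in [n]. *)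
Lemma pow1D_le (a : R) n : 0 <= a -> a <= 1 -> (1 + a) ^+ n <= 1 + 4 ^+ n * a.
Proof.
move=> a0 a1; elim: n => [|n IH]; first by rewrite !expr0; lra.
rewrite !exprS.
have h : 1 <= 4 ^+ n :> R by rewrite exprn_ege1 //; lra.
have : (1 + a) * (1 + a) ^+ n <= (1 + a) * (1 + 4 ^+ n * a).
  by rewrite ler_wpM2l //; lra.
move: h; move: ((1 + a) ^+ n) (4 ^+ n) {IH} => p q q1 pq.
have h1 : a <= q * a by rewrite -[leLHS]mul1r ler_wpM2r.
have h2 : q * a * a <= q * a by rewrite -[leRHS]mulr1 ler_wpM2l // (le_trans a0).
lra.
Qed.

Lemma hnorm_iter_le (f : H -> H) (a : R) n x : 0 <= a ->
  (forall y, hnorm (f y) <= a * hnorm y) -> hnorm (iter n f x) <= a ^+ n * hnorm x.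
Proof.
move=> a0 fa; elim: n => [|n IH] /=; first by rewrite expr0 mul1r.
by apply: le_trans (fa _) _; rewrite exprS -mulrA ler_wpM2l.
Qed.

(** Let [N = T^*] and consider, on the unit circle, the polynomial [p z = (1 +
z N)^n B (L z)^n x], where [L z] is the truncated inverse of [1 + z N]. Since
[B] commutes with [1 + conj z T], whose powers are normal with adjoint [(1 + z
N)^n], the factor [B] may be pulled out in norm: [|p z| <= |B| |(1 + z N)^n (L
z)^n x|], and the right hand side is at most [2 |B| |x|] because [|N| <= 1/2].
The coefficient of [z] in [p] is [n (N B - B N) x], so the Cauchy estimate
bounds [n |(N B - B N) x|] independently of [n]. *)
Lemma fuglede_contraction T B : bounded_op T -> bounded_op B -> normal_op T ->
  B \o T = T \o B -> opnorm T <= 2^-1 -> B \o adj T = adj T \o B.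
Proof.
move=> bT bB nT BT T2; set N := adj T.
have bN : bounded_op N := bounded_op_adj bT.
apply/funext => x; apply/esym/subr0_eq/hnorm_eq0/eqP.
rewrite eq_le hnorm_ge0 andbT /= leNgt; apply/negP => pos.
set D := N (B x) - B (N x) in pos *.
suff bound n : n%:R * hnorm D <= 2 * opnorm B * hnorm x.
  pose n := (Num.truncn (2 * opnorm B * hnorm x / hnorm D)).+1.
  have := bound n; rewrite leNgt -ltr_pdivrMr // truncnS_gt //.
(* With [2 n + 2] terms, the error [2^-(2n+2)] of the truncated inverse
survives the [n]-th power, which costs a factor [4^n]. *)
pose m := (n.*2)%N; pose a : R := 2^-1 ^+ m.+2.
have a0 : 0 <= a by rewrite exprn_ge0.
have a1 : a <= 1 by rewrite exprn_ile1 //; lra.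
have := vpoly_iter_addZ n bN (vpoly_bop bB (vpoly_iter_geomZ m n bN (vpoly_cst x))).
rewrite add0r (bopN bB) (bopZ bB) addrC -scalerBr -/D => /vpoly_bound h.
have -> : n%:R * hnorm D = hnorm (n%:R *: D).
  by rewrite hnormZ -realC_nat modc_real ger0_norm.
apply: h => z z1.
set y := iter n (geomZ N z m.+2) x.
pose zT := addZ T (Num.conj z).
have bzT : bounded_op zT by exact: bounded_op_addZ.
have azT : adj zT = addZ N z.
  apply: adj_eq => u v; rewrite /zT /addZ dotpDl dotpDr dotpZl dotpZr.
  by rewrite adjP.
have nzT : normal_op zT.
  rewrite /normal_op azT /zT; apply: addZ_commute; first exact: bounded_op_addZ.
  by apply/esym/addZ_commute => //; rewrite -/N; exact: nT.
have e1 : hnorm (iter n (addZ N z) (B y)) = hnorm (B (iter n zT y)).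
  (* Normality of [1 + conj z T], which commutes with [B]. *)
  rewrite -azT -normal_hnorm_iter //; congr hnorm.
  have /(iter_commute n)/(congr1 (fun f => f y)) := esym (addZ_commute (Num.conj z) bB BT).
  by [].
rewrite e1; apply: le_trans (le_opnorm _ bB) _.
rewrite (mulrC 2) -mulrA ler_wpM2l ?opnorm_ge0 //.
rewrite normal_hnorm_iter // azT /y iter_comp_commute; last first.
  apply: geomZ_commute; first exact: bounded_op_addZ.
  by apply/esym/addZ_commute.
apply: (@le_trans _ _ ((1 + a) ^+ n * hnorm x)); last first.
  apply: ler_wpM2r; first exact: hnorm_ge0.
  apply: le_trans (pow1D_le n a0 a1) _.
  have e : 4 ^+ n * (2^-1 ^+ 2) ^+ n = 1 :> R.
    by rewrite -exprMn (_ : 4 * 2^-1 ^+ 2 = 1) ?expr1n //; field.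
  have -> : a = 2^-1 * (2^-1 * (2^-1 ^+ 2) ^+ n).
    by rewrite /a [LHS]exprS (exprS _ m) /m -mul2n exprM.
  rewrite 2!(mulrCA (4 ^+ n)) e; lra.
apply: hnorm_iter_le => [|u]; first by lra.
rewrite [(_ \o _) u](addZ_geomZ z m.+2 u bN); apply: le_trans (hnormB _ _) _.
rewrite mulrDl mul1r lerD2l; apply: hnorm_iter_le => // v.
rewrite hnormZ modcN z1 mul1r; apply: le_trans (adj_le _ bT) _.
by rewrite ler_wpM2r ?hnorm_ge0.
Qed.

(** Rescaling reduces to an operator of norm at most one half. *)
Theorem fuglede T B : bounded_op T -> bounded_op B -> normal_op T ->
  B \o T = T \o B -> B \o adj T = adj T \o B.
Proof.
move=> bT bB nT BT; pose C := opnorm T + 1.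
have C0 : 0 < C by rewrite ltr_wpDl ?opnorm_ge0.
pose r := (2 * C)^-1; have r0 : 0 < r by rewrite invr_gt0; lra.
pose T' := (r%:C : R[i]) *: T.
have bT' : bounded_op T' by exact: bounded_opZ.
have aT' : adj T' = (r%:C : R[i]) *: adj T by rewrite adjZ // conj_realC.
have scale_comm (A1 A2 : H -> H) : bounded_op A1 -> A1 \o A2 = A2 \o A1 ->
    A1 \o (r%:C *: A2) = (r%:C *: A2) \o A1.
  move=> b1 e; apply/funext => x; rewrite /= !fctE (bopZ b1); congr (_ *: _).
  by rewrite -[LHS]/((A1 \o A2) x) e.
have nT' : normal_op T'.
  rewrite /normal_op aT'; apply: (scale_comm) => //.
  apply: esym; apply: scale_comm; last exact: esym nT.
  exact: bounded_op_adj.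
have : B \o adj T' = adj T' \o B.
  apply: fuglede_contraction => //; first exact: scale_comm.
  apply: opnorm_le => // x; rewrite hnormZ modc_real gtr0_norm //.
  have := le_opnorm x bT; have := hnorm_ge0 x.
  have : r * C = 2^-1 by rewrite /r invfM mulrVK // unitfE gt_eqF.
  rewrite /C => e n0 le; apply: le_trans (_ : r * (C * hnorm x) <= _).
    by rewrite ler_pM2l // /C; lra.
  by rewrite mulrA /C e.
rewrite aT' => e; apply/funext => x.
have := congr1 (fun f => (r%:C)^-1 *: f x) e.
rewrite /= !fctE (bopZ bB) !scalerA mulVf ?scale1r //.
by rewrite -[0]/(0%:C); apply/eqP => /complexI r00; rewrite r00 ltxx in r0.
Qed.

End Fuglede.

(** * Joint approximate eigenvectors of commuting self-adjoint operators *)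

Section PositiveForms.
Variables (R : realType) (H : hilbertType R).
Implicit Types (A B C D : H -> H) (x y : H).

Definition selfadj C := forall x y, dotp (C x) y = dotp x (C y).

(** Cauchy-Schwarz for the form [<D x, y>]; here positivity is evaluated at [x
- |D|^-1 D x]. *)
Lemma positive_op_bound D x : bounded_op D -> selfadj D ->
  (forall y, 0 <= Re (dotp (D y) y)) ->
  hnorm (D x) ^+ 2 <= opnorm D * Re (dotp (D x) x).
Proof.
move=> bD sD pD; have d0 := opnorm_ge0 bD.
have [d00|dn0] := eqVneq (opnorm D) 0.
  have := le_opnorm x bD; rewrite d00 mul0r => h.
  have -> : hnorm (D x) = 0 by apply/eqP; rewrite eq_le h hnorm_ge0.
  by rewrite expr0n mul0r.
have dp : 0 < opnorm D by rewrite lt_neqAle eq_sym dn0.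
have := pD (x - ((opnorm D)^-1)%:C *: D x).
rewrite (bopB bD) (bopZ bD) dotpBl !dotpBr !dotpZl !dotpZr conj_realC.
rewrite [dotp (D (D x)) x]sD dotp_hnorm !(ReD, ReN, Re_mulr).
rewrite ![Re (hnorm _ ^+ 2)%:C]/= => h.
have h2 : Re (dotp (D (D x)) (D x)) <= opnorm D * hnorm (D x) ^+ 2.
  apply: le_trans (Re_dotp_le _ _) _; rewrite expr2 mulrA.
  by rewrite ler_wpM2r ?hnorm_ge0 ?le_opnorm.
move: h h2; set p := Re (dotp (D x) x); set n := hnorm (D x) ^+ 2.
set r := Re (dotp (D (D x)) (D x)); set i := (opnorm D)^-1 => h h2.
have i0 : 0 < i by rewrite invr_gt0.
have id : i * opnorm D = 1 by rewrite mulVf.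
have h3 : i * r <= n by rewrite -[leRHS]mul1r -id -mulrA ler_pM2l.
have h4 : i * (i * r) <= i * n by rewrite ler_pM2l.
have h5 : i * n <= p by lra.
by rewrite -(ler_pM2l i0) (mulrA i (opnorm D)) id mul1r.
Qed.

End PositiveForms.

Section JointStep.
Variables (R : realType) (H : hilbertType R) (n : nat) (B : nat -> H -> H) (C : H -> H).
Hypothesis bB : forall k, bounded_op (B k).
Hypothesis sB : forall k, selfadj (B k).
Hypothesis cB : forall k l, B k \o B l = B l \o B k.
Hypotheses (bC : bounded_op C) (sC : selfadj C).
Hypothesis cC : forall k, C \o B k = B k \o C.
Implicit Types (x y : H) (s t : R).

Let q x := \sum_(k < n) hnorm (B k x) ^+ 2.
Let Q x := \sum_(k < n) B k (B k x).

Hypothesis null : forall e : R, 0 < e -> exists2 x, hnorm x = 1 & q x < e.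

Let q_ge0 x : 0 <= q x.
Proof. by apply: sumr_ge0 => k _; exact: sqr_ge0. Qed.

Let bQ : bounded_op Q.
Proof.
rewrite /Q; elim: n => [|m IH].
  rewrite (_ : (fun x => _) = (0 : H -> H)); first exact: bounded_op0.
  by apply/funext => x; rewrite big_ord0.
rewrite (_ : (fun x => _) = (fun x => \sum_(k < m) B k (B k x)) + (B m \o B m)).
  exact: bounded_opD (IH) (bounded_op_comp _ _).
by apply/funext => x; rewrite big_ord_recr.
Qed.

Let dotQ x y : dotp (Q x) y = \sum_(k < n) dotp (B k x) (B k y).
Proof. by rewrite /Q dotp_suml; apply: eq_bigr => k _; rewrite sB. Qed.

Let sQ : selfadj Q.
Proof.
move=> x y; rewrite dotQ [RHS]dotpC dotQ.
rewrite (rmorph_sum Num.conj) /=; apply: eq_bigr => k _; by rewrite -dotpC.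
Qed.

Let Re_sum m (F : 'I_m -> R[i]) : Re (\sum_k F k) = \sum_k Re (F k).
Proof. by elim/big_rec2 : _ => // k s r _ <-; rewrite ReD. Qed.

Let dotQq x : Re (dotp (Q x) x) = q x.
Proof. by rewrite dotQ Re_sum; apply: eq_bigr => k _; rewrite dotp_hnorm. Qed.

Let BQ k x : B k (Q x) = Q (B k x).
Proof.
rewrite /Q (bop_sum (bB k)); apply: eq_bigr => l _.
have cBx y : B k (B l y) = B l (B k y) by exact: (congr1 (fun f => f y) (cB k l)).
by rewrite !cBx.
Qed.

Let g t x := Re (dotp (C x) x) - t * q x.

Let G t := [set g t x | x in [set x : H | hnorm x = 1]].

Let unit_exists : exists x : H, hnorm x = 1.
Proof. by have [x x1 _] := null ltr01; exists x. Qed.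

Let G_sup t : 0 <= t -> has_sup (G t).
Proof.
move=> t0; split; first by have [x x1] := unit_exists; exists (g t x), x.
exists (opnorm C) => _ [x /= x1 <-]; rewrite /g.
have := Re_dotp_le (C x) x; have := le_opnorm x bC; rewrite x1 !mulr1.
have : 0 <= t * q x by rewrite mulr_ge0.
lra.
Qed.

Let c t := sup (G t).

Let g_le t x : 0 <= t -> g t x <= c t * hnorm x ^+ 2.
Proof.
move=> t0; have [->|xn0] := eqVneq x 0.
  rewrite /g (bop0 bC) dotp0l hnorm0 expr0n mulr0 /= sub0r oppr_le0.
  by rewrite mulr_ge0.
have hx : 0 < hnorm x.
  rewrite lt_neqAle hnorm_ge0 andbT eq_sym; apply/eqP => /hnorm_eq0 e.
  by rewrite e eqxx in xn0.
pose i := (hnorm x)^-1; have i0 : 0 < i by rewrite invr_gt0.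
have ix : i * hnorm x = 1 by rewrite mulVf ?gt_eqF.
pose y : H := i%:C *: x.
have y1 : hnorm y = 1 by rewrite hnormZ modc_real gtr0_norm.
have gy : g t y = i ^+ 2 * g t x.
  rewrite /g /y (bopZ bC) dotpZl dotpZr conj_realC !Re_mulr.
  have -> : q (i%:C *: x) = i ^+ 2 * q x.
    rewrite /q mulr_sumr; apply: eq_bigr => k _.
    by rewrite (bopZ (bB k)) hnormZ modc_real gtr0_norm // exprMn.
  ring.
have : g t y <= c t by apply: ub_le_sup; [exact: (G_sup t0).2|exists y].
rewrite gy => h.
rewrite -(ler_pM2l (exprn_gt0 2 i0)) mulrCA -exprMn ix expr1n mulr1 //.
Qed.

Let c_anti s t : 0 <= s -> s <= t -> c t <= c s.
Proof.
move=> s0 st; have t0 := le_trans s0 st.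
apply: sup_le_ub; first by have [x x1] := unit_exists; exists (g t x), x.
move=> _ [x /= x1 <-]; have := g_le x s0; rewrite x1 expr1n mulr1 /g.
have := ler_wpM2r (q_ge0 x) st; lra.
Qed.

Let c_ge t : 0 <= t -> - opnorm C <= c t.
Proof.
move=> t0; apply/ler_addgt0Pl => e e0.
have [x x1 qx] := null (e := e / (t + 1)) ltac:(by rewrite divr_gt0 // ltr_wpDl).
have := g_le x t0; rewrite x1 expr1n mulr1 /g.
have tq : t * q x <= e.
  move: qx; rewrite ltr_pdivlMr ?ltr_wpDl // => qx; have := q_ge0 x; lra.
have := Re_dotp_le (- C x) x; rewrite dotpNl ReN hnormN.
have := le_opnorm x bC; rewrite x1 !mulr1; lra.
Qed.

(** Adjoining an operator [C] to a family [B] with approximate joint kernel.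
Penalize by [Q = sum B_k^2]: let [c t] be the supremum of [<C x, x> - t <Q x,
x>] over unit vectors. It decreases with [t] to a limit [a], because the [B_k]
have an approximate joint kernel. Take [t] with [c t] close to [a], and a unit
vector [x] nearly attaining [c (2 t)]. The positive operator [D = c (2 t) - C
+ 2 t Q] is then small at [x], and comparing [c t] with [c (2 t)], at [x] and
at the vectors [B_k x], shows that [<Q x, x>] and even [t |Q x|] are small.
Hence [C x] is close to [a x]. *)
Lemma joint_step : exists a : R, forall e, 0 < e ->
  exists2 x, hnorm x = 1 & q x < e /\ hnorm (C x - a%:C *: x) < e.
Proof.
pose E := [set c t | t in [set t : R | 1 <= t]].
have E_inf : has_inf E.
  split; first by exists (c 1), 1 => /=.
  exists (- opnorm C) => _ [t /= t1 <-]; apply: c_ge; exact: le_trans t1.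
pose a := inf E.
have a_le t : 1 <= t -> a <= c t.
  by move=> t1; apply: ge_inf; [exact: E_inf.2|exists t].
exists a => e e0.
pose h := e / 7; have h0 : 0 < h by rewrite divr_gt0.
have [_ [t /= t1 <-] ct] := inf_adherent h0 E_inf; rewrite -/a in ct.
have t0 : 0 <= t by exact: le_trans t1.
have tt0 : 0 <= 2 * t by lra.
have ac : a <= c (2 * t) by apply: a_le; lra.
have cc : c (2 * t) <= c t by apply: c_anti; lra.
pose D x := (c (2 * t))%:C *: x - C x + (2 * t)%:C *: Q x.
have bD : bounded_op D.
  apply: bounded_opD; last exact: bounded_opZ.
  by apply: bounded_opB => //; apply: (bounded_opZ _ (bounded_op_id H)).
have sD : selfadj D.
  move=> x y; rewrite /D !(dotpDl, dotpDr, dotpNl, dotpNr, dotpZl, dotpZr) !conj_realC.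
  by rewrite sC sQ.
have DE y : Re (dotp (D y) y) = c (2 * t) * hnorm y ^+ 2 - g (2 * t) y.
  rewrite /D !dotpDl dotpNl !dotpZl !ReD ReN !Re_mulr dotQq dotp_hnorm /g [Re _%:C]/=.
  ring.
have Dpos y : 0 <= Re (dotp (D y) y) by rewrite DE subr_ge0 g_le.
(* Comparison of the penalties [t] and [2 t]. *)
have key y : t * q y <= Re (dotp (D y) y) + h * hnorm y ^+ 2.
  rewrite DE; have := g_le y t0; rewrite /g.
  have : (c (2 * t) - c t + h) * hnorm y ^+ 2 >= 0.
    by rewrite mulr_ge0 ?sqr_ge0 //; lra.
  lra.
(* Precision with which [x] attains [c (2 t)]; it depends on [D], hence on
[t]. *)
pose u := Order.min h (h ^+ 2 / (opnorm D + 1)).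
have D1 : 0 < opnorm D + 1 by rewrite ltr_wpDl ?opnorm_ge0.
have u0 : 0 < u by rewrite lt_min h0 divr_gt0 ?exprn_gt0.
have uh : u <= h by rewrite ge_min lexx.
have uD : opnorm D * u <= h ^+ 2.
  apply: (@le_trans _ _ ((opnorm D + 1) * u)); first by rewrite ler_wpM2r //; lra.
  by rewrite mulrC -ler_pdivlMr // ge_min lexx orbT.
have [_ [x /= x1 <-] gx] := sup_adherent u0 (G_sup tt0).
rewrite -/(c _) in gx.
have Dx : Re (dotp (D x) x) < u by rewrite DE x1 expr1n mulr1; lra.
exists x => //.
have qx : t * q x <= 2 * h.
  have := key x; rewrite x1 expr1n mulr1; lra.
have Dxh : hnorm (D x) <= h.
  rewrite -(ler_pXn2r (n := 2)) ?nnegrE ?hnorm_ge0 ?(ltW h0) //.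
  apply: le_trans (positive_op_bound x bD sD Dpos) _; apply: le_trans _ uD.
  by rewrite ler_wpM2l ?opnorm_ge0 ?ltW.
have QQ : hnorm (Q x) ^+ 2 = \sum_(k < n) q (B k x).
  have -> : hnorm (Q x) ^+ 2 = Re (dotp (Q x) (Q x)) by rewrite dotp_hnorm.
  rewrite dotQ Re_sum; apply: eq_bigr => k _; rewrite BQ -dotQq; congr (Re _).
  exact: esym (sQ _ _).
have DQ : \sum_(k < n) Re (dotp (D (B k x)) (B k x)) = Re (dotp (D x) (Q x)).
  rewrite -[dotp (D x) (Q x)]sQ dotQ Re_sum; apply: eq_bigr => k _; congr (Re _).
  congr dotp; rewrite /D (bopD (bB k)) (bopB (bB k)) !(bopZ (bB k)) BQ.
  by have /(congr1 (fun f => f x))/= -> := cC k.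
(* Sum of the comparison over the vectors [B_k x]; [D] commutes with every
[B_k]. *)
have T2 : t * hnorm (Q x) ^+ 2 <= hnorm (D x) * hnorm (Q x) + h * q x.
  rewrite QQ mulr_sumr.
  apply: (@le_trans _ _ (\sum_(k < n) (Re (dotp (D (B k x)) (B k x)) + h * hnorm (B k x) ^+ 2))).
    by apply: ler_sum => k _; exact: key.
  by rewrite big_split /= DQ -mulr_sumr lerD2r Re_dotp_le.
have Th : t * hnorm (Q x) <= 2 * h.
  have w0 := hnorm_ge0 (Q x); have v0 := hnorm_ge0 (D x).
  move: T2 Dxh qx w0 v0; move: (hnorm (Q x)) (hnorm (D x)) (q x) (q_ge0 x).
  move=> w v p p0 T2 vh qh w0 v0.
  (* A quadratic inequality for [t |Q x|]. *)
  have T3 : (t * w) ^+ 2 <= h * (t * w) + 2 * h ^+ 2.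
    have : t * (t * w ^+ 2) <= t * (v * w + h * p) by rewrite ler_wpM2l.
    have : v * (t * w) <= h * (t * w) by rewrite ler_wpM2r // mulr_ge0.
    have : h * (t * p) <= h * (2 * h) by rewrite ler_wpM2l // ltW.
    lra.
  rewrite leNgt; apply/negP => lt2.
  have : 0 < (t * w - 2 * h) * (t * w + h) by rewrite mulr_gt0 //; lra.
  lra.
split.
  have : q x <= t * q x by rewrite -[leLHS]mul1r ler_wpM2r.
  rewrite /h in qx *; lra.
have -> : C x - a%:C *: x = (c (2 * t) - a)%:C *: x + ((2 * t)%:C *: Q x - D x).
  rewrite /D realCB scalerBl opprD opprB [X in _ = _ + X]addrCA subrr addr0.
  by rewrite [RHS]addrC addrA subrK.
apply: le_lt_trans (hnormD _ _) _.
have := hnormB ((2 * t)%:C *: Q x) (D x).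
rewrite !hnormZ x1 mulr1 !modc_real !ger0_norm //; last by lra.
rewrite -mulrA /h in Th Dxh ct *; lra.
Qed.

End JointStep.

Section JointApprox.
Variables (R : realType) (H : hilbertType R).
Implicit Types (C : nat -> H -> H) (x y : H).

Definition shift_op (C : H -> H) (a : R) x := C x - a%:C *: x.

Lemma bounded_op_shift (C : H -> H) a : bounded_op C -> bounded_op (shift_op C a).
Proof. by move=> bC; exact: bounded_opB bC (bounded_opZ a%:C (bounded_op_id H)). Qed.

Lemma selfadj_shift (C : H -> H) a : selfadj C -> selfadj (shift_op C a).
Proof.
by move=> sC x y; rewrite /shift_op dotpBl dotpBr dotpZl dotpZr conj_realC sC.
Qed.

Lemma comm_shift (A C : H -> H) a : bounded_op A -> A \o C = C \o A ->
  A \o shift_op C a = shift_op C a \o A.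
Proof.
move=> bA AC; apply/funext => x; rewrite /shift_op /= (bopB bA) (bopZ bA).
by rewrite -[A (C x)]/((A \o C) x) AC.
Qed.

(** One operator is adjoined at a time, replacing those already treated by
their shifts, which have an approximate joint kernel. *)
Lemma joint_approx n C a0 :
  (forall k, bounded_op (C k)) -> (forall k, selfadj (C k)) ->
  (forall k l, C k \o C l = C l \o C k) ->
  (forall e : R, 0 < e -> exists2 x, hnorm x = 1 & hnorm (C 0%N x - a0%:C *: x) < e) ->
  exists2 a : nat -> R, a 0%N = a0 & forall e : R, 0 < e ->
    exists2 x, hnorm x = 1 & forall k, (k <= n)%N -> hnorm (C k x - (a k)%:C *: x) < e.
Proof.
move=> bC sC cC h0; elim: n => [|n [a a00 ha]].
  exists (fun=> a0) => // e /h0[x x1 hx]; exists x => // k.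
  by rewrite leqn0 => /eqP ->.
pose B k := shift_op (C k) (a k).
have [b hb] : exists b : R, forall e : R, 0 < e -> exists2 x, hnorm x = 1 &
    \sum_(k < n.+1) hnorm (B k x) ^+ 2 < e /\ hnorm (C n.+1 x - b%:C *: x) < e.
  apply: joint_step => // [k|k|k l|k|e e0].
  - exact: bounded_op_shift.
  - exact: selfadj_shift.
  - apply: comm_shift; first exact: bounded_op_shift.
    by apply/esym; apply: comm_shift.
  - exact: comm_shift.
  pose u := Order.min 1 (e / (n.+1%:R + 1)).
  have n1 : 0 < n.+1%:R + 1 :> R by rewrite ltr_wpDl.
  have u0 : 0 < u by rewrite lt_min ltr01 divr_gt0.
  have [x x1 hx] := ha u u0; exists x => //.
  apply: (@le_lt_trans _ _ (\sum_(k < n.+1) u)).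
    apply: ler_sum => k _; have /ltW kx := hx k (leq_ord k).
    apply: le_trans (_ : hnorm (B k x) * 1 <= _); last by rewrite mulr1.
    rewrite expr2 ler_wpM2l ?hnorm_ge0 //; apply: le_trans kx _.
    by rewrite ge_min lexx.
  rewrite sumr_const card_ord -mulr_natl.
  apply: (@lt_le_trans _ _ ((n.+1%:R + 1) * u)).
    by rewrite ltr_pM2r // ltrDl.
  by rewrite mulrC -ler_pdivlMr // ge_min lexx orbT.
exists (fun k => if (k <= n)%N then a k else b) => [|e e0]; first by rewrite leq0n.
pose u := Order.min e (e ^+ 2).
have u0 : 0 < u by rewrite lt_min e0 exprn_gt0.
have [x x1 [sx cx]] := hb u u0; exists x => // k kn.
case: leqP => [le|lt].
  rewrite -(ltr_pXn2r (n := 2)) ?nnegrE ?hnorm_ge0 ?(ltW e0) //.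
  apply: (@lt_le_trans _ _ u); last by rewrite ge_min lexx orbT.
  apply: le_lt_trans sx; rewrite -ltnS in le.
  rewrite (bigD1 (Ordinal le)) //= lerDl sumr_ge0 // => i _; exact: sqr_ge0.
have -> : k = n.+1 by apply/eqP; rewrite eqn_leq kn lt.
by apply: lt_le_trans cx _; rewrite ge_min lexx.
Qed.

End JointApprox.

Section CommutativeAlgebra.
Variables (R : realType) (H : hilbertType R) (T : nat -> H -> H).
Hypothesis bT : forall j, bounded_op (T j).
Hypothesis nT : forall j, normal_op (T j).
Hypothesis cT : forall i j, T i \o T j = T j \o T i.
Implicit Types (A B : H -> H) (x y : H).

Let cTa i j : T i \o adj (T j) = adj (T j) \o T i.
Proof. exact: fuglede. Qed.

Let caa i j : adj (T i) \o adj (T j) = adj (T j) \o adj (T i).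
Proof. by rewrite -!adj_comp // cT. Qed.

(** The von Neumann algebra generated by the family and its adjoints. Being
defined by commutation, it is closed under all operations at once, and
Fuglede's theorem makes it commutative. *)
Definition bicommutant A := bounded_op A /\
  forall B, bounded_op B -> (forall j, B \o T j = T j \o B) ->
    (forall j, B \o adj (T j) = adj (T j) \o B) -> A \o B = B \o A.

Lemma bicommutantT j : bicommutant (T j).
Proof. by split => // B bB h1 h2. Qed.

(** By Fuglede's theorem each [T j] commutes with the adjoints of the others,
so that the family lies in its own commutant. *)
Lemma bicommutant_comm A B : bicommutant A -> bicommutant B -> A \o B = B \o A.
Proof.
move=> [bA hA] [bB hB]; apply: hA => // j; apply: hB => //.
exact: bounded_op_adj.
Qed.

Lemma bicommutant_comp A B : bicommutant A -> bicommutant B -> bicommutant (A \o B).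
Proof.
move=> [bA hA] [bB hB]; split; first exact: bounded_op_comp.
by move=> D bD h1 h2; rewrite -compA hB // compA hA.
Qed.

Lemma bicommutant_adj A : bicommutant A -> bicommutant (adj A).
Proof.
move=> [bA hA]; split; first exact: bounded_op_adj.
move=> B bB h1 h2; have bB' := bounded_op_adj bB.
have bTa j : bounded_op (adj (T j)) := bounded_op_adj (bT j).
have : A \o adj B = adj B \o A.
  apply: hA => // j.
    by rewrite -{1}(adjK (bT j)) -adj_comp // -h2 adj_comp // adjK.
  by rewrite -!adj_comp // h1.
by move=> /(congr1 (@adj _ _ _)); rewrite (adj_comp bA bB') (adj_comp bB' bA) (adjK bB) => ->.
Qed.

Lemma bicommutantD A B : bicommutant A -> bicommutant B -> bicommutant (A + B).
Proof.
move=> [bA hA] [bB hB]; split; first exact: bounded_opD.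
move=> D bD h1 h2; apply/funext => x; rewrite /= !fctE (bopD bD).
have /(congr1 (fun f => f x))/= -> := hA D bD h1 h2.
by have /(congr1 (fun f => f x))/= -> := hB D bD h1 h2.
Qed.

Lemma bicommutantZ (a : R[i]) A : bicommutant A -> bicommutant (a *: A).
Proof.
move=> [bA hA]; split; first exact: bounded_opZ.
move=> D bD h1 h2; apply/funext => x; rewrite /= !fctE (bopZ bD).
by have /(congr1 (fun f => f x))/= -> := hA D bD h1 h2.
Qed.

Lemma bicommutantN A : bicommutant A -> bicommutant (- A).
Proof.
move=> hA; rewrite (_ : - A = (-1 : R[i]) *: A); first exact: bicommutantZ.
by apply/funext => x; rewrite !fctE scaleN1r.
Qed.

Lemma bicommutant_id : bicommutant idfun.
Proof. by split => //; exact: bounded_op_id. Qed.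

Definition repart A : H -> H := (2^-1 : R[i]) *: (A + adj A).
Definition impart A : H -> H := ((2 * 'i)^-1 : R[i]) *: (A - adj A).

Lemma bicommutant_repart A : bicommutant A -> bicommutant (repart A).
Proof.
by move=> hA; apply: bicommutantZ; apply: bicommutantD => //; exact: bicommutant_adj.
Qed.

Lemma bicommutant_impart A : bicommutant A -> bicommutant (impart A).
Proof.
move=> hA; apply: bicommutantZ; apply: bicommutantD => //.
by apply: bicommutantN; exact: bicommutant_adj.
Qed.

Lemma selfadj_repart A : bounded_op A -> selfadj (repart A).
Proof.
move=> bA x y; rewrite /repart !fctE dotpZl dotpZr dotpDl dotpDr.
by rewrite (adjP _ _ bA) (adjPr _ _ bA) addrC conjV conj_nat.
Qed.

Lemma selfadj_impart A : bounded_op A -> selfadj (impart A).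
Proof.
move=> bA x y; rewrite /impart !fctE dotpZl dotpZr dotpBl dotpBr.
rewrite (adjP _ _ bA) (adjPr _ _ bA) conjV conjM conj_nat conjCi.
by rewrite mulrN invrN mulNr -mulrN opprB.
Qed.

Lemma repart_impart A x : A x = repart A x + 'i *: impart A x.
Proof.
rewrite -[repart A x]/(2^-1 *: (A x + adj A x)).
rewrite -[impart A x]/((2 * 'i)^-1 *: (A x - adj A x)).
have i0 : 'i != 0 :> R[i] by rewrite neq0Ci.
have ie : 'i * (2 * 'i)^-1 = 2^-1 :> R[i] by rewrite invfM mulrCA mulfV ?mulr1.
rewrite [X in _ = _ + X](scalerA ('i : R[i])) ie -scalerDr addrACA subrr addr0.
by rewrite -mulr2n -[A x *+ 2]scaler_nat [RHS](scalerA (2^-1 : R[i])) mulVf ?scale1r.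
Qed.

Lemma opnorm_approx A e : bounded_op A -> A <> 0 -> 0 < e ->
  exists2 x, hnorm x = 1 & opnorm A - e < hnorm (A x).
Proof.
move=> bA A0 e0.
have [y y0] : exists y, A y <> 0.
  by apply/existsNP => h; apply: A0; apply/funext.
have yp (z : H) : z <> 0 -> 0 < hnorm z.
  move=> z0; rewrite lt_neqAle hnorm_ge0 andbT eq_sym; apply/eqP => /hnorm_eq0 //.
have nrm (z : H) : z <> 0 -> exists2 x, hnorm x = 1 & z = (hnorm z)%:C *: x.
  move=> z0; have zp := yp z z0; exists (((hnorm z)^-1)%:C *: z).
    by rewrite hnormZ modc_real gtr0_norm ?invr_gt0 // mulVf // gt_eqF.
  by rewrite scalerA -realCM mulfV ?gt_eqF // scale1r.
have yn0 : y <> 0 by move=> e'; apply: y0; rewrite e' (bop0 bA).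
have [u u1 uE] := nrm y yn0.
apply: contrapT => h.
have hle x : hnorm x = 1 -> hnorm (A x) <= opnorm A - e.
  by move=> x1; rewrite leNgt; apply/negP => lt; apply: h; exists x.
have p0 : 0 <= opnorm A - e by apply: le_trans (hle u u1); exact: hnorm_ge0.
suff : opnorm A <= opnorm A - e by lra.
apply: opnorm_le => // z; have [->|/eqP zn0] := eqVneq z 0.
  by rewrite (bop0 bA) !hnorm0 mulr0.
have [v v1 vE] := nrm z zn0.
rewrite {1}vE (bopZ bA) hnormZ modc_real ger0_norm ?hnorm_ge0 // mulrC.
by rewrite ler_wpM2r ?hnorm_ge0 // hle.
Qed.

(** If [|A x|] is close to [|A|] on a unit vector, then [A^* A x] is close to
[|A|^2 x], since [|A^* A x| <= |A| |A x|]. *)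
Lemma opnorm_approx_eigen A e : bounded_op A -> A <> 0 -> 0 < e ->
  exists2 x, hnorm x = 1 & hnorm (adj A (A x) - (opnorm A ^+ 2)%:C *: x) < e.
Proof.
move=> bA A0 e0; have M0 := opnorm_ge0 bA; set M := opnorm A in M0 *.
pose u := e ^+ 2 / (2 * M ^+ 3 + 1).
have p0 : 0 <= M ^+ 3 by rewrite exprn_ge0.
have D0 : 0 < 2 * M ^+ 3 + 1 by lra.
have u0 : 0 < u by rewrite divr_gt0 // exprn_gt0.
have [x x1 hx] := opnorm_approx bA A0 u0; rewrite -/M in hx.
exists x => //; rewrite -(ltr_pXn2r (n := 2)) ?nnegrE ?hnorm_ge0 ?(ltW e0) //.
rewrite hnormB_sq dotpZr conj_realC Re_mulr hnormZ x1 mulr1 modc_real ger0_norm ?sqr_ge0 //.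
rewrite -hnorm_adj_sq //.
have le1 : hnorm (adj A (A x)) ^+ 2 <= M ^+ 2 * hnorm (A x) ^+ 2.
  by rewrite -exprMn ler_pXn2r ?nnegrE ?mulr_ge0 ?hnorm_ge0 // adj_le.
have le2 : hnorm (A x) <= M by have := le_opnorm x bA; rewrite x1 mulr1.
have uD : (2 * M ^+ 3 + 1) * u = e ^+ 2 by rewrite mulrC divfK ?gt_eqF.
have n0 := hnorm_ge0 (A x).
move: (hnorm (A x)) (hnorm (adj A (A x)) ^+ 2) le1 le2 hx n0 => a b le1 le2 hx a0.
have sq : M ^+ 2 - a ^+ 2 <= 2 * M * u.
  have : (M - a) * (M + a) <= u * (2 * M) by apply: ler_pM; lra.
  lra.
have : M ^+ 2 * (M ^+ 2 - a ^+ 2) <= M ^+ 2 * (2 * M * u) by rewrite ler_wpM2l ?sqr_ge0.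
lra.
Qed.

(** Start from approximate eigenvectors of [A^* A] for the eigenvalue [|A|^2],
on which [A] stays away from zero, and adjoin successively the real and
imaginary parts of the operators [T j]. *)
Lemma joint_approx_eigen d A : bicommutant A -> A <> 0 ->
  exists l : nat -> R[i], exists2 m : R, 0 < m & forall e : R, 0 < e ->
    exists x, [/\ hnorm x = 1, m <= hnorm (A x) &
      forall j, (j < d)%N -> hnorm (T j x - l j *: x) < e].
Proof.
move=> hA A0; have bA := hA.1.
pose C k := if k is j.+1 then
  (if odd j then impart (T j./2) else repart (T j./2)) else adj A \o A.
have hC k : bicommutant (C k).
  case: k => [|j] /=; first by apply: bicommutant_comp => //; exact: bicommutant_adj.
  by case: ifP => _; [apply: bicommutant_impart|apply: bicommutant_repart];
    exact: bicommutantT.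
have sC k : selfadj (C k).
  case: k => [|j] /=; last first.
    by case: ifP => _; [apply: selfadj_impart|apply: selfadj_repart].
  by move=> x y /=; rewrite -adjP // adjPr // adjK.
pose M := opnorm A.
have [a a0 ha] := @joint_approx _ _ d.*2 C (M ^+ 2) (fun k => (hC k).1) sC
  (fun k l => bicommutant_comm (hC k) (hC l)) (fun e => opnorm_approx_eigen bA A0).
have Mp : 0 < M.
  rewrite lt_neqAle opnorm_ge0 // andbT eq_sym; apply/eqP => M0; apply: A0.
  apply/funext => x; apply: hnorm_eq0; apply/eqP; rewrite eq_le hnorm_ge0 andbT.
  by have := le_opnorm x bA; rewrite -/M M0 mul0r.
exists (fun j => (a j.*2.+1)%:C + 'i * (a j.*2.+2)%:C), (M / 2); first by rewrite divr_gt0.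
move=> e e0; pose u := Order.min (e / 2) (M ^+ 2 / 2).
have u0 : 0 < u by rewrite lt_min !divr_gt0 // exprn_gt0.
have ue : u <= e / 2 by rewrite ge_min lexx.
have uM : u <= M ^+ 2 / 2 by rewrite ge_min lexx orbT.
have [x x1 hx] := ha u u0; exists x; split => // [|j jd].
  have := hx 0%N (leq0n _); rewrite a0 /= => h.
  have := hnormD (adj A (A x)) ((M ^+ 2)%:C *: x - adj A (A x)).
  rewrite addrC subrK hnormZ x1 mulr1 modc_real ger0_norm ?sqr_ge0 // (hnormBC (_ *: _)).
  have := adj_le (A x) bA; rewrite -/M => h1 h2.
  rewrite -(ler_pM2l Mp); lra.
have h1 := hx j.*2.+1; have h2 := hx j.*2.+2.
rewrite /= odd_double /= doubleK in h1.
rewrite /= odd_double /= uphalf_double in h2.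
rewrite (_ : T j x = repart (T j) x + 'i *: impart (T j) x); last exact: repart_impart.
rewrite scalerDl -scalerA opprD addrACA -scalerBr.
apply: le_lt_trans (hnormD _ _) _; rewrite hnormZ.
have -> : modc 'i = 1 :> R by rewrite /modc normCi.
have := h1 ltac:(by rewrite ltn_double); have := h2 ltac:(by rewrite -doubleS leq_double).
lra.
Qed.

End CommutativeAlgebra.

(** * From the Taylor spectrum to algebraic relations *)

Section Koszul.
Variables (R : realType) (H : hilbertType R) (d : nat).
Implicit Types (T : 'I_d -> H -> H).

(** Exactness at the top exterior power: a vector placed there is a cycle,
hence a boundary. *)
Lemma koszul_exact_onto T : (forall i, bounded_op (T i)) -> koszul_exact T ->
  forall x, exists y : 'I_d -> H, x = \sum_i T i (y i).
Proof.
move=> bT eT x.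
pose X := [ffun A : {set 'I_d} => if A == [set: 'I_d]%SET then x else 0].
have [|Y XY] := eT X.
  apply/ffunP => A; rewrite !ffunE big1 // => i iA.
  rewrite ffunE; case: eqP => [e|_]; last by rewrite (bop0 (bT i)) scaler0.
  by have := finset.in_setT i; rewrite -e !inE eqxx.
exists (fun i : 'I_d => ((-1) ^+ #|[set j in [set: 'I_d] | (j < i)%N]%SET| : R[i])
  *: Y ([set: 'I_d] :\ i)%SET).
have := congr1 (fun f : {ffun {set 'I_d} -> H} => f [set: 'I_d]%SET) XY.
rewrite !ffunE eqxx => ->; apply: eq_big => [i|i _]; first by rewrite inE.
by rewrite (bopZ (bT i)).
Qed.

(** If [x_n] are unit vectors with [|T_i^* x_n| < 1 / (n + 1)], the vectors
[(n + 1) x_n] are weakly bounded on the sum of the ranges of the [T_i], that is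
everywhere, but not bounded in norm. *)
Lemma onto_no_approx_kernel T : (forall i, bounded_op (T i)) ->
  (forall x, exists y : 'I_d -> H, x = \sum_i T i (y i)) ->
  ~ (forall e : R, 0 < e -> exists2 x, hnorm x = 1 & forall i, hnorm (adj (T i) x) < e).
Proof.
move=> bT sT apx.
have /choice[x hx] : forall n, exists x : H, hnorm x = 1 /\
    forall i, hnorm (adj (T i) x) < invS R n.
  by move=> n; have [x x1 hx] := apx _ (invS_gt0 R n); exists x.
pose w n : H := (n.+1%:R : R)%:C *: x n.
have [|C hC] := uniform_boundedness (w := w).
  move=> z; have [y ->] := sT z; exists (\sum_i hnorm (y i)) => n.
  rewrite dotp_suml; apply: (@le_trans _ _ (\sum_i modc (dotp (T i (y i)) (w n)))).
    elim/big_rec2 : _ => [|i a b _ ab]; first by rewrite modc0.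
    by apply: le_trans (modcD _ _) _; rewrite lerD2l.
  apply: ler_sum => i _; rewrite adjP // /w (bopZ (bounded_op_adj (bT i))).
  apply: le_trans (cauchy_schwarz _ _) _.
  rewrite -[leRHS]mulr1 ler_wpM2l ?hnorm_ge0 // hnormZ modc_real ger0_norm //.
  have e1 : n.+1%:R * invS R n = 1 by rewrite mulfV ?pnatr_eq0.
  apply: le_trans (_ : n.+1%:R * invS R n <= _); last by rewrite e1.
  by rewrite ler_wpM2l //; exact: ltW ((hx n).2 i).
pose n := Num.truncn C.
have := hC n; rewrite /w hnormZ (hx n).1 mulr1 modc_real ger0_norm // leNgt.
by rewrite truncnS_gt.
Qed.

End Koszul.

Section SpectralVanishing.
Variables (R : realType) (H : hilbertType R) (d : nat).
Variable T : 'I_d -> H -> H.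
Hypothesis bT : forall j, bounded_op (T j).
Hypothesis nT : forall j, normal_op (T j).
Hypothesis cT : commuting T.
Implicit Types (A B C : H -> H).

(** Padding by zero operators: the joint spectrum argument indexes the family
by [nat]. *)
Definition extend_ops (j : nat) : H -> H := oapp T 0 (insub j).

Lemma extend_opsE (j : 'I_d) : extend_ops j = T j.
Proof. by rewrite /extend_ops valK. Qed.

Lemma comp_zeror A : bounded_op A -> A \o (0 : H -> H) = 0.
Proof. by move=> bA; apply/funext => x; exact: bop0. Qed.

Lemma bounded_op_extend j : bounded_op (extend_ops j).
Proof. by rewrite /extend_ops; case: insubP => [i _ _|_] //=; exact: bounded_op0. Qed.

Lemma normal_op_extend j : normal_op (extend_ops j).
Proof. by rewrite /extend_ops; case: insubP => [i _ _|_] //=; rewrite /normal_op adj0. Qed.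

Lemma commuting_extend i j : extend_ops i \o extend_ops j = extend_ops j \o extend_ops i.
Proof.
rewrite /extend_ops; case: insubP => [i' _ _|_] /=; case: insubP => [j' _ _|_] //=.
  by rewrite comp_zeror.
by rewrite comp_zeror.
Qed.

Definition eigen_op A (a : R[i]) : H -> H := A - a *: idfun.

Lemma eigen_opE A a x : eigen_op A a x = A x - a *: x.
Proof. by []. Qed.

Lemma bounded_op_eigen A a : bounded_op A -> bounded_op (eigen_op A a).
Proof. by move=> bA; apply: bounded_opB bA (bounded_opZ a (bounded_op_id H)). Qed.

Lemma adj_eigen_op A a : bounded_op A -> adj (eigen_op A a) = eigen_op (adj A) (Num.conj a).
Proof.
move=> bA; have bi := bounded_op_id H; have bz := bounded_opZ a bi.
by rewrite adjB // adjZ // adj_id.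
Qed.

Lemma normal_op_eigen A a : bounded_op A -> normal_op A -> normal_op (eigen_op A a).
Proof.
move=> bA nA; have bA' := bounded_op_adj bA.
rewrite /normal_op adj_eigen_op //; apply/funext => x.
rewrite -[LHS]/(A (adj A x - Num.conj a *: x) - a *: (adj A x - Num.conj a *: x)).
rewrite -[RHS]/(adj A (A x - a *: x) - Num.conj a *: (A x - a *: x)).
rewrite (bopB bA) (bopB bA') (bopZ bA) (bopZ bA').
have /(congr1 (fun f => f x))/= -> := nA.
rewrite !scalerBr !opprB !scalerA (mulrC a) -!addrA; congr (_ + _).
by rewrite addrCA [RHS]addrCA; congr (_ + _); exact: addrC.
Qed.

Lemma hnorm_adj_eigen A a x : bounded_op A -> normal_op A ->
  hnorm (adj A x - Num.conj a *: x) = hnorm (A x - a *: x).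
Proof.
move=> bA nA; rewrite -!eigen_opE -adj_eigen_op // normal_hnorm //.
  exact: bounded_op_eigen.
exact: normal_op_eigen.
Qed.

(** Otherwise some point of the joint approximate spectrum does not annihilate
[A]. It cannot lie in [G] by assumption; outside [G] the Koszul complex is
exact, which excludes approximate eigenvectors. By normality it does not
matter whether these are taken for the operators or for their adjoints. *)
Lemma spectral_vanishing (G : set 'rV[R[i]]_d) A : taylor_spectrum T `<=` G ->
  bicommutant extend_ops A ->
  (forall l, G l -> forall m : R, 0 < m -> exists2 e : R, 0 < e & forall x, hnorm x = 1 ->
     (forall j, hnorm (T j x - l 0 j *: x) < e) -> hnorm (A x) < m) ->
  A = 0.
Proof.
move=> TG hA hG; apply: contrapT => A0.
have [l [m m0 hl]] := joint_approx_eigen bounded_op_extend normal_op_extend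
  commuting_extend d hA A0.
pose r : 'rV[R[i]]_d := \row_j l j.
have hr e : 0 < e -> exists x, [/\ hnorm x = 1, m <= hnorm (A x) &
    forall j, hnorm (T j x - r 0 j *: x) < e].
  move=> /hl[x [x1 mx hx]]; exists x; split => // j.
  by rewrite mxE -extend_opsE; exact: hx.
have [Gr|nGr] := pselect (G r).
  have [e e0 he] := hG r Gr m m0; have [x [x1 mx hx]] := hr e e0.
  by have := he x x1 hx; rewrite ltNge mx.
have ex : koszul_exact (fun j => T j - r 0 j *: idfun).
  by apply: contrapT => nex; apply: nGr; apply: TG.
have bE j : bounded_op (eigen_op (T j) (r 0 j)) by exact: bounded_op_eigen.
apply: (onto_no_approx_kernel bE (koszul_exact_onto bE ex)) => e /hr[x [x1 mx hx]].
exists x => // j; rewrite normal_hnorm //; [exact: hx|exact: normal_op_eigen].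
Qed.

Lemma approx_relation A B C (a b c : R[i]) e x :
  bounded_op A -> normal_op A -> Num.conj a * b = c ->
  hnorm (A x - a *: x) <= e -> hnorm (B x - b *: x) <= e -> hnorm (C x - c *: x) <= e ->
  hnorm (adj A (B x) - C x) <= (opnorm A + modc b + 1) * e.
Proof.
move=> bA nA abc ha hb hc; have bA' := bounded_op_adj bA.
have -> : adj A (B x) - C x =
    adj A (B x - b *: x) + (b *: (adj A x - Num.conj a *: x) - (C x - c *: x)).
  rewrite (bopB bA') (bopZ bA') scalerBr scalerA (mulrC b) abc opprB.
  by rewrite [X in _ = _ + X]addrA subrK addrA subrK.
apply: le_trans (hnormD _ _) _.
have := hnormB (b *: (adj A x - Num.conj a *: x)) (C x - c *: x).
rewrite hnormZ hnorm_adj_eigen //.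
have := adj_le (B x - b *: x) bA.
have : opnorm A * hnorm (B x - b *: x) <= opnorm A * e by rewrite ler_wpM2l ?opnorm_ge0.
have : modc b * hnorm (A x - a *: x) <= modc b * e by rewrite ler_wpM2l ?modc_ge0.
lra.
Qed.

Lemma spectral_relation (G : set 'rV[R[i]]_d) A B C (a b c : 'rV[R[i]]_d -> R[i]) :
  taylor_spectrum T `<=` G -> bicommutant extend_ops A -> bicommutant extend_ops B ->
  bicommutant extend_ops C -> normal_op A ->
  (forall l, G l -> Num.conj (a l) * b l = c l) ->
  (forall l x (e : R), G l -> 0 < e -> (forall j, hnorm (T j x - l 0 j *: x) < e) ->
    [/\ hnorm (A x - a l *: x) <= e, hnorm (B x - b l *: x) <= e &
        hnorm (C x - c l *: x) <= e]) ->
  adj A \o B = C.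
Proof.
move=> TG hA hB hC nA abc h; apply/funext => x; apply/subr0_eq.
suff : (adj A \o B) - C = 0 by move=> /(congr1 (fun f => f x)).
apply: (spectral_vanishing TG).
  apply: bicommutantD; last exact: bicommutantN.
  apply: bicommutant_comp => //; apply: bicommutant_adj => //.
  exact: bounded_op_extend.
move=> l Gl m m0; pose K := opnorm A + modc (b l) + 1.
have K0 : 0 < K by rewrite /K ltr_wpDl ?addr_ge0 ?opnorm_ge0 ?modc_ge0 //; exact: hA.1.
exists (m / (2 * K)) => [|y y1 hy]; first by rewrite divr_gt0 // mulr_gt0.
have e0 : 0 < m / (2 * K) by rewrite divr_gt0 // mulr_gt0.
have [ha hb hc] := h l y _ Gl e0 hy.
apply: le_lt_trans (approx_relation hA.1 nA (abc l Gl) ha hb hc) _; rewrite -/K.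
have -> : K * (m / (2 * K)) = m / 2 by field; rewrite gt_eqF.
lra.
Qed.

End SpectralVanishing.

Section SymmetrizationIdentities.
Variables (R : realType) (d : nat).
Implicit Types (z l : 'rV[R[i]]_d).

Lemma conj_unit_modulus (a : R[i]) : `|a| = 1 -> a * Num.conj a = 1.
Proof. by move=> a1; rewrite -normCK a1 expr1n. Qed.

(** Stated for [l] rather than for the symmetrization itself so that it
rewrites coordinates of points of [bGamma]. *)
Lemma symmetrizationE l z (j : 'I_d) : symmetrization z = l ->
  l 0 j = \sum_(A : {set 'I_d} | #|A| == j.+1) \prod_(k in A) z 0 k.
Proof. by move=> <-; rewrite [LHS]mxE. Qed.

(** The last coordinate is the product of all [z_k]; on the torus, multiplying
by it a conjugated product over [A] gives the product over the complement of
[A]. This is the source of [bGamma_last] and [bGamma_rev]. *)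
Lemma symmetrization_last l z (j : 'I_d) : symmetrization z = l -> j.+1 = d ->
  l 0 j = \prod_k z 0 k.
Proof.
move=> zl jd; rewrite (symmetrizationE j zl) jd (big_pred1 [set: 'I_d]%SET) => [|A]; last first.
  rewrite /= eqEcard finset.subsetT /= cardsT card_ord eqn_leq.
  by rewrite -[X in (_ <= X)%N && _](card_ord d) max_card.
by apply: eq_bigl => k; rewrite inE.
Qed.

Lemma bGamma_last l (j : 'I_d) : bGamma l -> j.+1 = d -> Num.conj (l 0 j) * l 0 j = 1.
Proof.
move=> [z z1 zl] jd; rewrite (symmetrization_last zl jd) mulrC (rmorph_prod Num.conj) /=.
by rewrite -big_split big1 //= => k _; rewrite conj_unit_modulus.
Qed.

Lemma bGamma_rev l (i j k : 'I_d) : bGamma l -> k.+1 = d -> (i.+1 + j.+1 = d)%N ->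
  Num.conj (l 0 i) * l 0 k = l 0 j.
Proof.
move=> [z z1 zl] kd ijd; rewrite (symmetrization_last zl kd).
rewrite (symmetrizationE i zl) (symmetrizationE j zl) (rmorph_sum Num.conj) /=.
rewrite mulr_suml (reindex_inj (@finset.setC_inj 'I_d)) /=; apply: eq_big => A.
  rewrite cardsCs finset.setCK card_ord.
  have := max_card A; rewrite card_ord => Ad; apply/eqP/eqP => [h|->].
    by apply: (@addnI i.+1); rewrite ijd -h subnK.
  by rewrite -[X in (X - _)%N]ijd addnK.
move=> _; rewrite (rmorph_prod Num.conj) /=.
rewrite [X in _ * X](bigID (fun k => k \in A)) /= mulrCA -[RHS]mulr1; congr (_ * _).
rewrite [X in _ * X](eq_bigl (fun k => k \in ~: A)%SET) => [|m]; last by rewrite inE.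
rewrite -big_split big1 //= => m _.
by rewrite mulrC conj_unit_modulus.
Qed.

End SymmetrizationIdentities.

Section GammaUnitaryRelations.
Variables (R : realType) (K : hilbertType R) (d : nat).
Variables (N : 'I_d.-1 -> K -> K) (U : K -> K).

Lemma optuple_last (j : 'I_d) : j.+1 = d -> optuple N U j = U.
Proof. by move=> jd; rewrite /optuple insubF //; lia. Qed.

Lemma optuple_init (i : 'I_d.-1) (j : 'I_d) : j = i :> nat -> optuple N U j = N i.
Proof.
by move=> ji; rewrite /optuple ji valK.
Qed.

Hypothesis d0 : (0 < d)%N.

Lemma last_index : {j : 'I_d | j.+1 = d}.
Proof.
have lt : (d.-1 < d)%N by rewrite prednK.
by exists (Ordinal lt); rewrite /= prednK.
Qed.

Lemma init_index (i : 'I_d.-1) : {j : 'I_d | j = i :> nat}.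
Proof.
have lt : (i < d)%N by rewrite (leq_trans (ltn_ord i)) ?leq_pred.
by exists (Ordinal lt).
Qed.

(** These relations hold for the coordinates of every point of [bGamma]:
[|l_d| = 1] and [conj l_i l_d = l_(d-i)]. *)
Lemma gamma_unitary_relations : gamma_unitary N U ->
  [/\ adj U \o U = idfun, U \o adj U = idfun &
      forall i, adj (N i) \o U = N (rev_ord i)].
Proof.
move=> [bT cT nT TG]; set T := optuple N U in bT cT nT TG *.
have [k kd] := last_index; have Tk : T k = U by exact: optuple_last.
have hT j : bicommutant (extend_ops T) (T j).
  by rewrite -extend_opsE; apply: bicommutantT => ?; exact: bounded_op_extend.
have nU : normal_op U by rewrite -Tk.
have UU : adj U \o U = idfun.
  rewrite -Tk; apply: (@spectral_relation _ _ _ T bT nT cT _ (T k) (T k) idfun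
    (fun l => l 0 k) (fun l => l 0 k) (fun=> 1) TG) => //.
  - exact: bicommutant_id.
  - by move=> l Gl; exact: bGamma_last.
  - move=> l x e Gl e0 hx; split; try exact: ltW.
    by rewrite scale1r subrr hnorm0 ltW.
split => // [|i]; first by rewrite -UU; exact: nU.
have [j ji] := init_index i; have [j' ji'] := init_index (rev_ord i).
rewrite -(optuple_init ji) -/(T j) -(optuple_init ji') -/(T j') -Tk.
apply: (@spectral_relation _ _ _ T bT nT cT _ (T j) (T k) (T j')
  (fun l => l 0 j) (fun l => l 0 k) (fun l => l 0 j') TG) => //.
  move=> l Gl; apply: bGamma_rev => //; rewrite ji ji' /=.
  have := ltn_ord i; lia.
by move=> l x e Gl e0 hx; split; exact: ltW.
Qed.

End GammaUnitaryRelations.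

(** * Closed subspaces as Hilbert spaces *)

Record closed_subspace (R : realType) (K : hilbertType R) := ClosedSubspace {
  cs_set :> set K;
  cs_closed : closed cs_set;
  cs_subspace : subspace cs_set }.

Arguments cs_closed {R K} M : rename.

Section SubHilbert.
Variables (R : realType) (K : hilbertType R) (M : closed_subspace K).

Record subH := SubH { subH_val : K; subH_prop : `[< cs_set M subH_val >] }.

HB.instance Definition _ := [isSub for subH_val].
HB.instance Definition _ := [Choice of subH by <:].

Lemma subHP (x : subH) : cs_set M (subH_val x).
Proof. exact/asboolP/subH_prop. Qed.

Definition mkSub (x : K) (Mx : cs_set M x) : subH := SubH (asboolT Mx).

Lemma subH_inj (x y : subH) : subH_val x = subH_val y -> x = y.
Proof. exact: val_inj. Qed.

Let sM := cs_subspace M.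

Definition subH_zero : subH := mkSub sM.1.
Definition subH_add (x y : subH) : subH := mkSub (subspaceD sM (subHP x) (subHP y)).
Definition subH_opp (x : subH) : subH := mkSub (subspaceZ (-1) sM (subHP x)).
Definition subH_scale (a : R[i]) (x : subH) : subH := mkSub (subspaceZ a sM (subHP x)).

Lemma subH_addA : associative subH_add.
Proof. by move=> x y z; apply: subH_inj; rewrite /= addrA. Qed.
Lemma subH_addC : commutative subH_add.
Proof. by move=> x y; apply: subH_inj; rewrite /= addrC. Qed.
Lemma subH_add0 : left_id subH_zero subH_add.
Proof. by move=> x; apply: subH_inj; rewrite /= add0r. Qed.
Lemma subH_addN : left_inverse subH_zero subH_opp subH_add.
Proof. by move=> x; apply: subH_inj; rewrite /= scaleN1r addNr. Qed.

HB.instance Definition _ :=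
  GRing.isZmodule.Build subH subH_addA subH_addC subH_add0 subH_addN.

Lemma subH_scaleA a b x : subH_scale a (subH_scale b x) = subH_scale (a * b) x.
Proof. by apply: subH_inj; rewrite /= scalerA. Qed.
Lemma subH_scale1 : left_id 1 subH_scale.
Proof. by move=> x; apply: subH_inj; rewrite /= scale1r. Qed.
Lemma subH_scaleDr : right_distributive subH_scale +%R.
Proof. by move=> a x y; apply: subH_inj; rewrite /= scalerDr. Qed.
Lemma subH_scaleDl x : {morph subH_scale^~ x : a b / a + b}.
Proof. by move=> a b; apply: subH_inj; rewrite /= scalerDl. Qed.

HB.instance Definition _ := GRing.Zmodule_isLmodule.Build R[i] subH
  subH_scaleA subH_scale1 subH_scaleDr subH_scaleDl.

Definition subH_norm (x : subH) : R[i] := `|subH_val x|.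

Lemma subH_normD x y : subH_norm (x + y) <= subH_norm x + subH_norm y.
Proof. exact: ler_normD. Qed.
Lemma subH_normZ (a : R[i]) x : subH_norm (a *: x) = `|a| * subH_norm x.
Proof. exact: normrZ. Qed.
Lemma subH_norm0 x : subH_norm x = 0 -> x = 0.
Proof. by move=> /normr0_eq0 x0; apply: subH_inj. Qed.

HB.instance Definition _ := Lmodule_isNormed.Build R[i] subH
  subH_normD subH_normZ subH_norm0.

Lemma subH_hnormB (x y : subH) : `|x - y| = (hnorm (subH_val x - subH_val y))%:C.
Proof.
rewrite -normhE -[LHS]/(`|(subH_val x) + (-1 : R[i]) *: (subH_val y)|).
by rewrite scaleN1r.
Qed.

(** A Cauchy filter is traced by the centres of balls of radius [invS n]
belonging to it; their limit in the ambient space stays in the closed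
subspace. *)
Lemma subH_complete (F : set_system subH) : ProperFilter F -> cauchy F -> cvg F.
Proof.
move=> FF /cauchyP cF.
have /choice[x hx] : forall n, exists x : subH, F (ball x (invS R n)%:C).
  by move=> n; apply: cF; rewrite ltcR invS_gt0.
have dist m n : hnorm (subH_val (x m) - subH_val (x n)) <= invS R m + invS R n.
  have [y [/= hm hn]] := filter_ex (filterI (hx m) (hx n)).
  rewrite -ball_normE /= subH_hnormB ltcR in hm.
  rewrite -ball_normE /= subH_hnormB ltcR in hn.
  have := hnorm_dist (subH_val y) (subH_val (x m)) (subH_val (x n)).
  rewrite (hnormBC (subH_val y)) => h; apply: le_trans h _; exact: lerD (ltW hm) (ltW hn).
have [|l xl] := @hcomplete _ K (fun n => subH_val (x n)).
  move=> e e0; have [N hN] := invS_small (e := e / 2) ltac:(lra).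
  exists N => n Nn; have := hN n Nn; have := hN N (leqnn _); have := dist n N; lra.
have Ml : cs_set M l.
  by apply: (closed_hcvg (cs_closed M) _ xl) => n; exact: subHP.
apply/cvg_ex; exists (mkSub Ml); apply/fcvg_ballP => e e0.
have eE : e = (Re e)%:C by rewrite RRe_real // gtr0_real.
have e0' : 0 < Re e by rewrite -ltcR -eE.
have e2 : 0 < Re e / 2 by rewrite divr_gt0.
have [N1 h1] := xl _ e2; have [N2 h2] := invS_small e2.
pose n := maxn N1 N2.
apply: filterS (hx n) => y.
rewrite -!ball_normE /= !subH_hnormB eE !ltcR /= => yn.
have := h1 n (leq_maxl _ _); have := h2 n (leq_maxr _ _).
have := hnorm_dist (subH_val (x n)) l (subH_val y); rewrite (hnormBC l (subH_val (x n))); lra.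
Qed.

HB.instance Definition _ := Uniform_isComplete.Build subH subH_complete.

Definition subH_dot (x y : subH) : R[i] := dotp (subH_val x) (subH_val y).

Lemma subH_dotDl x y z : subH_dot (x + y) z = subH_dot x z + subH_dot y z.
Proof. exact: dotpDl. Qed.
Lemma subH_dotZl (a : R[i]) x y : subH_dot (a *: x) y = a * subH_dot x y.
Proof. exact: dotpZl. Qed.
Lemma subH_dotC x y : subH_dot x y = Num.conj (subH_dot y x).
Proof. exact: dotpC. Qed.
Lemma subH_dotxx x : subH_dot x x = `|x| ^+ 2.
Proof. exact: dotpxx. Qed.

HB.instance Definition _ := CompleteNormedModule_isHilbert.Build R subH
  subH_dotDl subH_dotZl subH_dotC subH_dotxx.

Lemma subH_isometry : isometric_embedding (subH_val : subH -> K).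
Proof. by split. Qed.

End SubHilbert.

Section Restriction.
Variables (R : realType) (K : hilbertType R) (M : closed_subspace K).
Local Notation j := (@subH_val R K M).

(** Written with the adjoint of the inclusion so as to be defined for every
operator; on an invariant subspace it is the restriction, by [compressE]. *)
Definition compress (T : K -> K) : subH M -> subH M := adj j \o T \o j.

Let Ij := subH_isometry M.
Let bj := isometry_bounded Ij.

Lemma subH_adjK x : cs_set M x -> j (adj j x) = x.
Proof.
move=> Mx; rewrite -[in LHS](_ : j (mkSub Mx) = x) //.
by rewrite isometry_adjK.
Qed.

Lemma bounded_op_compress T : bounded_op T -> bounded_op (compress T).
Proof.
move=> bT; apply: bounded_op_comp => //; apply: bounded_op_comp => //.
exact: bounded_op_adj.
Qed.

Lemma compressE T x : (forall y, cs_set M y -> cs_set M (T y)) ->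
  j (compress T x) = T (j x).
Proof. by move=> MT; rewrite /compress /= subH_adjK //; apply/MT/subHP. Qed.

Lemma adj_compress T : bounded_op T -> adj (compress T) = compress (adj T).
Proof.
move=> bT; apply: adj_eq => x y; rewrite /compress /=.
by rewrite -adjPr // adjP // (adjP _ _ bj).
Qed.

(** The subspace being invariant under the adjoint, compression is intertwined
with the orthogonal projection. *)
Lemma adj_compressE T x : bounded_op T ->
  (forall y, cs_set M y -> cs_set M (adj T y)) -> compress T (adj j x) = adj j (T x).
Proof.
move=> bT MT; apply: dotp_extr => y.
rewrite (adjPr _ _ (bounded_op_compress bT)) adj_compress //.
by rewrite -!adjP // compressE // -adjPr.
Qed.

End Restriction.

Arguments compress {R K} M T _ : rename.

(** * Strong limits along the backward orbit of a unitary dilation *)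

Section StrongLimits.
Variable R : realType.
Implicit Types (H K L : hilbertType R).

Lemma hcvg_contraction K L (F : nat -> K -> L) (C : R) u x y : 0 <= C ->
  (forall n a b, hnorm (F n a - F n b) <= C * hnorm (a - b)) ->
  hcvg u x -> hcvg (fun n => F n x) y -> hcvg (fun n => F n (u n)) y.
Proof.
move=> C0 FC ux Fx e e0; have e2 : 0 < e / 2 by lra.
have [N hN] := ux (e / 2 / (C + 1)) ltac:(by rewrite divr_gt0 // ltr_wpDl).
have [M hM] := Fx _ e2; exists (maxn N M) => n.
rewrite geq_max => /andP[/hN h1 /hM h2].
rewrite ltr_pdivlMr ?ltr_wpDl // in h1.
have := FC n (u n) x; have := hnorm_dist (F n x) (F n (u n)) y.
have := hnorm_ge0 (u n - x); lra.
Qed.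

Lemma strong_limit K L (F : nat -> K -> L) (C : R) :
  (forall n, linear (F n)) -> 0 <= C -> (forall n x, hnorm (F n x) <= C * hnorm x) ->
  (forall x (e : R), 0 < e -> exists2 x', hnorm (x - x') < e & hcauchy (fun n => F n x')) ->
  exists Y : K -> L, [/\ bounded_op Y, forall x, hcvg (fun n => F n x) (Y x) &
    forall x, hnorm (Y x) <= C * hnorm x].
Proof.
move=> lF C0 FC hF.
have bF n : bounded_op (F n) by exact: bopI (lF n) C0 (FC n).
have lipF n a b : hnorm (F n a - F n b) <= C * hnorm (a - b).
  by rewrite -(bopB (bF n)).
have /choice[Y hY] : forall x, exists y, hcvg (fun n => F n x) y.
  move=> x; apply: hcomplete => e e0.
  have e3 : 0 < e / 3 / (C + 1) by rewrite !divr_gt0 // ltr_wpDl.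
  have [x' xx' /(_ (e / 3) ltac:(lra))[N hN]] := hF x _ e3; exists N => n /hN h.
  rewrite ltr_pdivlMr ?ltr_wpDl // in xx'.
  have := lipF n x x'; have := lipF N x x'.
  have := hnorm_dist (F n x') (F n x) (F N x).
  have := hnorm_dist (F N x') (F n x') (F N x).
  rewrite (hnormBC (F N x') (F N x)); have := hnorm_ge0 (x - x'); lra.
have Yle x : hnorm (Y x) <= C * hnorm x.
  by apply: hcvg_hnorm_le (hY x) _.
exists Y; split => //; apply: (bopI _ C0 Yle).
move=> a x y; apply: hcvg_unique (hY _) _.
by apply: hcvg_ext (hcvgD (hcvgZ a (hY x)) (hY y)) => n; rewrite lF.
Qed.

Lemma hcauchy_evt_cst K (u : nat -> K) x N :
  (forall n, (N <= n)%N -> u n = x) -> hcauchy u.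
Proof.
by move=> h; apply: (@hcvg_cauchy _ _ _ x) => e e0; exists N => n /h ->; rewrite subrr hnorm0.
Qed.

Lemma hnorm_isometry_proj H K (f : H -> K) y : isometric_embedding f ->
  hnorm (y - f (adj f y)) ^+ 2 = hnorm y ^+ 2 - hnorm (f (adj f y)) ^+ 2.
Proof.
move=> If; have bf := isometry_bounded If; rewrite hnormB_sq.
have -> : Re (dotp y (f (adj f y))) = hnorm (f (adj f y)) ^+ 2.
  by rewrite adjPr // isometry_hnorm // dotp_hnorm.
ring.
Qed.

(** The squared norms increase and are bounded, so their increments, which are
the squared distances, tend to zero. *)
Lemma pythagoras_cauchy K (u : nat -> K) (C : R) N :
  (forall n, hnorm (u n) <= C) ->
  (forall n p, (N <= n)%N -> (n <= p)%N ->
     hnorm (u p - u n) ^+ 2 = hnorm (u p) ^+ 2 - hnorm (u n) ^+ 2) -> hcauchy u.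
Proof.
move=> uC pyth e e0.
pose E := [set hnorm (u n) ^+ 2 | n in [set n | (N <= n)%N]].
have C0 : 0 <= C := le_trans (hnorm_ge0 _) (uC 0%N).
have E_sup : has_sup E.
  split; first by exists (hnorm (u N) ^+ 2), N => /=.
  by exists (C ^+ 2) => _ [n _ <-]; rewrite ler_pXn2r ?nnegrE ?hnorm_ge0.
have e2 : 0 < e ^+ 2 by rewrite exprn_gt0.
have [_ [n /= Nn <-] hn] := sup_adherent e2 E_sup.
exists n => p np.
rewrite -(ltr_pXn2r (n := 2)) ?nnegrE ?hnorm_ge0 ?(ltW e0) // pyth //.
have : hnorm (u p) ^+ 2 <= sup E.
  by apply: ub_le_sup; [exact: E_sup.2|exists p => //=; exact: leq_trans np].
lra.
Qed.

End StrongLimits.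

Section Tower.
Variables (R : realType) (H K : hilbertType R) (V : H -> H) (iota : H -> K) (U : K -> K).

Record unitary_dilation : Prop := UnitaryDilation {
  dd_iso : isometric_embedding iota;
  dd_bounded : bounded_op U;
  dd_adjl : adj U \o U = idfun;
  dd_adjr : U \o adj U = idfun;
  dd_boundedV : bounded_op V;
  dd_intertwine : forall h, U (iota h) = iota (V h) }.

Hypothesis D : unitary_dilation.

Let Iiota := dd_iso D.
Let bU := dd_bounded D.
Let bV := dd_boundedV D.
Let biota := isometry_bounded Iiota.
Let bU' := bounded_op_adj bU.

Lemma unitary_adjK k : adj U (U k) = k.
Proof. exact: (congr1 (fun f => f k) (dd_adjl D)). Qed.

Lemma unitary_Kadj k : U (adj U k) = k.
Proof. exact: (congr1 (fun f => f k) (dd_adjr D)). Qed.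

(** [emb n h] is [U^{-n} iota h] and [coemb n k] is [iota^* U^n k]: isometries
whose ranges increase, and their adjoints. All limits below are taken along
them. *)
Definition emb n (h : H) : K := iter n (adj U) (iota h).
Definition coemb n (k : K) : H := adj iota (iter n U k).

Lemma dotp_unitary x y : dotp (adj U x) (adj U y) = dotp x y.
Proof. by rewrite -adjP // unitary_Kadj. Qed.

Lemma emb_isometry n : isometric_embedding (emb n).
Proof.
have be : bounded_op (emb n) by exact: bounded_op_comp (bounded_op_iter n bU') biota.
split; first exact: be.1.
move=> x y; rewrite -(Iiota.2); rewrite /emb; elim: n {be} => // n IH.
by rewrite /= dotp_unitary.
Qed.

Lemma dotp_iter_adj n x y : dotp (iter n (adj U) x) y = dotp x (iter n U y).
Proof. by elim: n y => // n IH y; rewrite iterS -adjPr // IH iterSr. Qed.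

Lemma adj_emb n : adj (emb n) = coemb n.
Proof. by apply: adj_eq => x y; rewrite /emb /coemb dotp_iter_adj adjP. Qed.

Lemma bounded_op_emb n : bounded_op (emb n).
Proof. exact/isometry_bounded/emb_isometry. Qed.

Lemma bounded_op_coemb n : bounded_op (coemb n).
Proof. by rewrite -adj_emb; apply/bounded_op_adj/bounded_op_emb. Qed.

Lemma coemb_le n k : hnorm (coemb n k) <= hnorm k.
Proof. by rewrite -adj_emb adj_isometry_le //; exact: emb_isometry. Qed.

Lemma hnorm_emb n h : hnorm (emb n h) = hnorm h.
Proof. exact/isometry_hnorm/emb_isometry. Qed.

Lemma embK n h : coemb n (emb n h) = h.
Proof. by rewrite -adj_emb isometry_adjK //; exact: emb_isometry. Qed.

Lemma dotp_emb n h k : dotp (emb n h) k = dotp h (coemb n k).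
Proof. by rewrite -adj_emb adjP //; exact: bounded_op_emb. Qed.

(** The ranges increase because [iota V = U iota]. *)
Lemma embS n h : emb n h = emb n.+1 (V h).
Proof. by rewrite /emb iterSr -dd_intertwine ?unitary_adjK. Qed.

Lemma emb_add n m h : emb n h = emb (n + m) (iter m V h).
Proof. by elim: m h => [|m IH] h; rewrite ?addn0 // addnS -embS IH. Qed.

Lemma emb_sub m n h : (m <= n)%N -> emb m h = emb n (iter (n - m) V h).
Proof. by move=> mn; rewrite (emb_add m (n - m)) subnKC. Qed.

Lemma emb_coemb_le n k : hnorm (emb n (coemb n k)) <= hnorm k.
Proof. by rewrite hnorm_emb coemb_le. Qed.

Lemma isometryV h h' : dotp (V h) (V h') = dotp h h'.
Proof.
rewrite -(Iiota.2) -!dd_intertwine // adjPr // unitary_adjK.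
exact: Iiota.2.
Qed.

Lemma adjV_V : adj V \o V = idfun.
Proof. by apply/funext => h /=; apply: dotp_extr => x; rewrite -adjP // isometryV. Qed.

Definition dense_orbit := forall k (e : R), 0 < e ->
  exists n h, hnorm (k - emb n h) < e.

Hypothesis dense : dense_orbit.

(** [emb n (coemb n k)] is the projection of [k] on the range of [emb n]; on a
vector of some range these projections are eventually the identity. *)
Lemma emb_coemb_cvg k : hcvg (fun n => emb n (coemb n k)) k.
Proof.
move=> e e0; have e2 : 0 < e / 2 by lra.
have [m [h hk]] := dense k e2; exists m => n mn.
rewrite (emb_sub h mn) in hk; set y := emb n _ in hk.
have -> : emb n (coemb n k) - k = emb n (coemb n (k - y)) - (k - y).
  rewrite (bopB (bounded_op_coemb n)) (bopB (bounded_op_emb n)) /y embK.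
  by rewrite opprB addrA subrK.
by have := hnormB (emb n (coemb n (k - y))) (k - y); have := emb_coemb_le n (k - y); lra.
Qed.

(** The symbol map: [Y] is the strong limit of [U^{-n} iota X iota^* U^n]. It
turns Toeplitz operators into their dilations and [C^*(S)] into [C^*(R)]. *)
Definition slim (X : H -> H) (Y : K -> K) :=
  forall k, hcvg (fun n => emb n (X (coemb n k))) (Y k).

(** Compression to [H], the inverse of the symbol map on Toeplitz operators.
*)
Definition rho (B : K -> K) : H -> H := adj iota \o B \o iota.

Lemma slim_unique X Y Y' : slim X Y -> slim X Y' -> Y = Y'.
Proof. by move=> h h'; apply/funext => k; exact: hcvg_unique (h k) (h' k). Qed.

Lemma slim_approx_le X n k : bounded_op X ->
  hnorm (emb n (X (coemb n k))) <= opnorm X * hnorm k.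
Proof.
move=> bX; rewrite hnorm_emb; apply: le_trans (le_opnorm _ bX) _.
by rewrite ler_wpM2l ?opnorm_ge0 ?coemb_le.
Qed.

Lemma bounded_op_approx X n : bounded_op X -> bounded_op (emb n \o X \o coemb n).
Proof.
move=> bX; apply: bounded_op_comp; last exact: bounded_op_coemb.
by apply: bounded_op_comp => //; exact: bounded_op_emb.
Qed.

Lemma slim_le X Y k : bounded_op X -> slim X Y -> hnorm (Y k) <= opnorm X * hnorm k.
Proof. by move=> bX XY; apply: hcvg_hnorm_le (XY k) _ => n; exact: slim_approx_le. Qed.

Lemma slim_bounded X Y : bounded_op X -> slim X Y -> bounded_op Y.
Proof.
move=> bX XY; apply: (bopI _ (opnorm_ge0 bX)); last by move=> k; exact: slim_le.
move=> a x y; apply: hcvg_unique (XY _) _.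
apply: hcvg_ext (hcvgD (hcvgZ a (XY x)) (XY y)) => n.
by rewrite -(bopZD (bounded_op_approx n bX)).
Qed.

Lemma slim_opnorm X Y : bounded_op X -> slim X Y -> opnorm Y <= opnorm X.
Proof.
move=> bX XY; apply: opnorm_le; first exact: opnorm_ge0.
by move=> k; exact: slim_le.
Qed.

Lemma slimD X X' Y Y' : bounded_op X -> bounded_op X' ->
  slim X Y -> slim X' Y' -> slim (X + X') (Y + Y').
Proof.
move=> bX bX' XY XY' k.
apply: hcvg_ext (hcvgD (XY k) (XY' k)) => n.
by rewrite -(bopD (bounded_op_emb n)).
Qed.

Lemma slimZ (a : R[i]) X Y : slim X Y -> slim (a *: X) (a *: Y).
Proof.
move=> XY k; apply: hcvg_ext (hcvgZ a (XY k)) => n.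
by rewrite -(bopZ (bounded_op_emb n)).
Qed.

(** Compositions pass to the limit because [coemb n] is a left inverse of [emb
n]. *)
Lemma slim_comp X X' Y Y' : bounded_op X -> bounded_op X' ->
  slim X Y -> slim X' Y' -> slim (X \o X') (Y \o Y').
Proof.
move=> bX bX' XY XY' k.
have h := hcvg_contraction (opnorm_ge0 bX) (F := fun n => emb n \o X \o coemb n) _
  (XY' k) (XY (Y' k)).
apply: hcvg_ext (h _) => [n|n x y] /=; first by rewrite embK.
have /= e := bopB (bounded_op_approx n bX) x y.
by rewrite -e; exact: slim_approx_le.
Qed.

Lemma slim_id : slim idfun idfun.
Proof. exact: emb_coemb_cvg. Qed.

Lemma dotp_approx X n x y : bounded_op X ->
  dotp (emb n (X (coemb n x))) y = dotp x (emb n (adj X (coemb n y))).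
Proof.
move=> bX; rewrite dotp_emb adjP // [RHS]dotpC dotp_emb -dotpC.
by [].
Qed.

Lemma slim_adj X Y Y' : bounded_op X -> slim X Y -> slim (adj X) Y' -> adj Y = Y'.
Proof.
move=> bX XY XY'; apply: adj_eq => x y.
apply/subr0_eq/modc_eq0/eqP; rewrite eq_le modc_ge0 andbT.
apply/ler_addgt0Pl => e e0; rewrite addr0.
pose C := hnorm x + hnorm y + 1.
have C0 : 0 < C by rewrite ltr_wpDl ?addr_ge0 ?hnorm_ge0.
have e' : 0 < e / C by rewrite divr_gt0.
have [N hN] := XY x _ e'; have [M hM] := XY' y _ e'.
pose n := maxn N M.
have := hN n (leq_maxl _ _); have := hM n (leq_maxr _ _).
set u := emb n (X _); set v := emb n (adj X _).
rewrite !ltr_pdivlMr // => h1 h2.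
have uv : dotp u y = dotp x v by exact: dotp_approx.
have -> : dotp (Y x) y - dotp x (Y' y) = dotp x (v - Y' y) - dotp (u - Y x) y.
  by rewrite dotpBr dotpBl uv opprB [RHS]addrC addrA subrK.
have := modcD (dotp x (v - Y' y)) (- dotp (u - Y x) y); rewrite modcN.
have := cauchy_schwarz x (v - Y' y); have := cauchy_schwarz (u - Y x) y.
have := hnorm_ge0 (v - Y' y); have := hnorm_ge0 (u - Y x).
have := hnorm_ge0 x; have := hnorm_ge0 y.
move: h1 h2; rewrite /C.
move: (hnorm (v - Y' y)) (hnorm (u - Y x)) (hnorm x) (hnorm y) => p q a b h1 h2 b0 a0 q0 p0.
have [pq|/ltW pq] := leP p q.
  have : a * p <= a * q by rewrite ler_wpM2l.
  lra.
have : q * b <= p * b by rewrite ler_wpM2r.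
lra.
Qed.

(** Multiply [B U = U B] by [U^*] on both sides. *)
Lemma comm_adjU B : B \o U = U \o B -> B \o adj U = adj U \o B.
Proof.
move=> BU; apply/funext => k /=.
have /(congr1 (fun f => f (adj U k)))/= := BU.
by rewrite unitary_Kadj => ->; rewrite unitary_adjK.
Qed.

(** Compressing an operator commuting with [U] to any of the translates of [H]
gives the same result. *)
Lemma rho_coemb B n h : B \o U = U \o B -> coemb n (B (emb n h)) = rho B h.
Proof.
move=> BU; rewrite /coemb /emb /rho /=; congr (adj iota _).
have e1 : B (iter n (adj U) (iota h)) = iter n (adj U) (B (iota h)).
  exact: (congr1 (fun f => f (iota h)) (esym (iter_commute n (esym (comm_adjU BU))))).
rewrite e1; elim: n (B _) {e1} => // n IH k.
by rewrite iterSr /= unitary_Kadj.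
Qed.

Lemma bounded_op_rho B : bounded_op B -> bounded_op (rho B).
Proof.
move=> bB; apply: bounded_op_comp => //; apply: bounded_op_comp => //.
exact: bounded_op_adj.
Qed.

Lemma rho_le B x : bounded_op B -> hnorm (rho B x) <= opnorm B * hnorm x.
Proof.
move=> bB; apply: le_trans (adj_isometry_le _ Iiota) _.
by apply: le_trans (le_opnorm _ bB) _; rewrite isometry_hnorm.
Qed.

(** Such a [B] is compressed by the projections of [emb_coemb_cvg], which tend
to the identity. *)
Lemma slim_rho B : bounded_op B -> B \o U = U \o B -> slim (rho B) B.
Proof.
move=> bB BU k.
have h := hcvg_contraction (F := fun n => emb n \o coemb n) ler01 _
  (hcvg_bop bB (emb_coemb_cvg k)) (emb_coemb_cvg (B k)).
apply: hcvg_ext (h _) => [n|n x y] /=; first by rewrite rho_coemb.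
rewrite -(bopB (bounded_op_emb n)) -(bopB (bounded_op_coemb n)) mul1r.
exact: emb_coemb_le.
Qed.

Lemma rho_inj B B' : bounded_op B -> bounded_op B' -> B \o U = U \o B ->
  B' \o U = U \o B' -> rho B = rho B' -> B = B'.
Proof.
move=> bB bB' BU BU' e; apply: slim_unique (slim_rho bB BU) _.
by rewrite e; exact: slim_rho.
Qed.

Lemma opnorm_rho B : bounded_op B -> B \o U = U \o B -> opnorm (rho B) = opnorm B.
Proof.
move=> bB BU; apply/eqP; rewrite eq_le opnorm_le ?opnorm_ge0 //=; last first.
  by move=> x; exact: rho_le.
apply: slim_opnorm; [exact: bounded_op_rho|exact: slim_rho].
Qed.

Lemma adj_rho B : bounded_op B -> adj (rho B) = rho (adj B).
Proof.
move=> bB; apply: adj_eq => x y; rewrite /rho /= -adjPr // adjP //.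
by rewrite -(adjP _ _ biota).
Qed.

Lemma slim_comm_U X Y : slim X Y -> Y \o U = U \o Y.
Proof.
move=> XY; apply/funext => k /=; apply: hcvg_unique (XY (U k)) _.
have := hcvgS 1%N (hcvg_bop bU (XY k)); apply: hcvg_ext => n.
by rewrite addn1 /emb /coemb /= unitary_Kadj -iterS iterSr.
Qed.

Lemma iter_toeplitz X j h : adj V \o X \o V = X ->
  iter j (adj V) (X (iter j V h)) = X h.
Proof.
move=> tX; elim: j h => // j IH h.
by rewrite iterSr iterS -[in RHS]IH; congr iter; rewrite -[in RHS]tX.
Qed.

Lemma coemb_sub n p h : (n <= p)%N -> coemb n (emb p h) = iter (p - n) (adj V) h.
Proof.
move=> np; apply: dotp_extr => x; rewrite -dotp_emb (emb_sub x np).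
rewrite (emb_isometry p).2; elim: (p - n)%N h => // j IH h.
by rewrite iterS adjP // IH -iterSr.
Qed.

(** By the Brown-Halmos relation [V^* X V = X] the approximants are
compressions of one another: for [n <= p] the value of the [n]-th one on the
range of [emb n] is the projection of the value of the [p]-th one. So the
values have orthogonal increments and bounded norms. *)
Lemma slim_toeplitz X : bounded_op X -> adj V \o X \o V = X -> exists Y, slim X Y.
Proof.
move=> bX tX.
have [|||x e e0|Y [_ XY _]] := @strong_limit _ _ _ (fun n => emb n \o X \o coemb n) (opnorm X).
- by move=> n; exact: (bounded_op_approx n bX).1.
- exact: opnorm_ge0.
- by move=> n x; exact: slim_approx_le.
- have [m [h hk]] := dense x e0; exists (emb m h) => //.
  apply: (@pythagoras_cauchy _ _ _ (opnorm X * hnorm (emb m h)) m) => [n|n p mn np].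
    exact: slim_approx_le.
  rewrite /= (emb_sub h mn); set h' := iter (n - m) V h.
  rewrite embK; set y := emb p _.
  have -> : emb n (X h') = emb n (adj (emb n) y).
    rewrite adj_emb /y coemb_sub // (emb_sub h' np) embK.
    by rewrite iter_toeplitz.
  by apply: hnorm_isometry_proj; exact: emb_isometry.
by exists Y.
Qed.

Lemma slim_rhoK X Y : bounded_op X -> adj V \o X \o V = X -> slim X Y -> rho Y = X.
Proof.
move=> bX tX XY; apply/funext => h; rewrite /rho /=.
apply: hcvg_unique (hcvg_bop (bounded_op_adj biota) (XY (iota h))) _.
apply: hcvg_ext (hcvg_cst (X h)) => n.
have -> : iota h = emb n (iter n V h) by rewrite -[iota h]/(emb 0 h) (emb_add 0 n).
by rewrite embK -[adj iota _]/(coemb 0 _) coemb_sub // subn0 iter_toeplitz.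
Qed.

(** On [iota h] the approximants are constant, as [X] commutes with [V]. *)
Lemma slim_comm_extend X Y h : X \o V = V \o X -> slim X Y -> Y (iota h) = iota (X h).
Proof.
move=> XV XY; apply: hcvg_unique (XY (iota h)) _.
apply: hcvg_ext (hcvg_cst (iota (X h))) => n.
have -> : iota h = emb n (iter n V h) by rewrite -[iota h]/(emb 0 h) (emb_add 0 n).
rewrite embK.
have /(congr1 (fun f => f h))/= <- := iter_commute n (esym XV).
by rewrite -[iota _]/(emb 0 _) (emb_add 0 n).
Qed.

Lemma dense_ext (L : hilbertType R) (A B : K -> L) : bounded_op A -> bounded_op B ->
  (forall n h, A (emb n h) = B (emb n h)) -> A = B.
Proof.
move=> bA bB AB; apply/funext => k.
apply: hcvg_unique (hcvg_bop bA (emb_coemb_cvg k)) _.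
by apply: hcvg_ext (hcvg_bop bB (emb_coemb_cvg k)) => n; rewrite AB.
Qed.

(** An [eps / 4] argument: the approximants depend contractively on [X]. *)
Lemma slim_norm_closed (X : H -> H) : bounded_op X ->
  (forall e : R, 0 < e -> exists X' Y', [/\ bounded_op X', slim X' Y' & opnorm (X - X') < e]) ->
  exists Y, slim X Y.
Proof.
move=> bX hX; suff /choice[Y hY] : forall k, exists y, hcvg (fun n => emb n (X (coemb n k))) y.
  by exists Y.
move=> k; apply: hcomplete => e e0.
have k1 : 0 < hnorm k + 1 by rewrite ltr_wpDl ?hnorm_ge0.
have [|X' [Y' [bX' XY' XX']]] := hX (e / 4 / (hnorm k + 1)); first by rewrite !divr_gt0.
have [N hN] := hcvg_cauchy (XY' k) (e := e / 4) ltac:(lra).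
exists N => n Nn.
have d m : hnorm (emb m (X (coemb m k)) - emb m (X' (coemb m k))) <= e / 4.
  rewrite -(bopB (bounded_op_emb m)) -[_ - _]/((X - X') _).
  apply: le_trans (slim_approx_le m k (bounded_opB bX bX')) _.
  rewrite ltr_pdivlMr // in XX'; have := opnorm_ge0 (bounded_opB bX bX'); lra.
have := hN n Nn; have := d n; have := d N.
have := hnorm_dist (emb n (X' (coemb n k))) (emb n (X (coemb n k))) (emb N (X (coemb N k))).
have := hnorm_dist (emb N (X' (coemb N k))) (emb n (X' (coemb n k))) (emb N (X (coemb N k))).
rewrite (hnormBC (emb N (X' _)) (emb N (X _))); lra.
Qed.

End Tower.

(** * Extension, uniqueness and Halmos dilation *)

Section GammaDilation.
Variables (R : realType) (d : nat) (H : hilbertType R).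
Variables (S : 'I_d.-1 -> H -> H) (V : H -> H).
Hypothesis d0 : (0 < d)%N.
Hypothesis bS : forall j, bounded_op (optuple S V j).

Lemma optuple_indices (G : hilbertType R) (N : 'I_d.-1 -> G -> G) (U : G -> G) (j : 'I_d) :
  (exists i, optuple N U j = N i /\ optuple S V j = S i) \/
  (optuple N U j = U /\ optuple S V j = V).
Proof. by rewrite /optuple; case: insubP => [i _ _|_] /=; [left; exists i|right]. Qed.

(** All that is used of a [Gamma_d]-unitary extension once its joint spectrum
has been turned into algebraic relations. *)
Record gamma_dilation (K : hilbertType R) (iota : H -> K) (N : 'I_d.-1 -> K -> K)
    (U : K -> K) : Prop := GammaDilation {
  gd_dil : unitary_dilation V iota U;
  gd_bounded : forall j, bounded_op (optuple N U j);
  gd_comm : commuting (optuple N U);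
  gd_rel : forall i, adj (N i) \o U = N (rev_ord i);
  gd_int : forall j h, optuple N U j (iota h) = iota (optuple S V j h) }.

Lemma gamma_dilation_of_extension (K : hilbertType R) (iota : H -> K) N (U : K -> K) :
  gamma_unitary_extension S V iota N U -> gamma_dilation iota N U.
Proof.
move=> [Ii gU int]; have [uu uu' rel] := gamma_unitary_relations d0 gU.
have [bT cT _ _] := gU.
have [k kd] := last_index d0.
split => //; split => //.
- by rewrite -(optuple_last N U kd).
- by rewrite -(optuple_last S V kd).
- by move=> h; have := int k h; rewrite !optuple_last.
Qed.

Section Fixed.
Variables (K : hilbertType R) (iota : H -> K) (N : 'I_d.-1 -> K -> K) (U : K -> K).
Hypothesis G : gamma_dilation iota N U.
Let D := gd_dil G.
Let Ii := dd_iso D.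
Let bi := isometry_bounded Ii.
Let bU := dd_bounded D.
Let bU' := bounded_op_adj bU.

Lemma gd_boundedN i : bounded_op (N i).
Proof. by have [j ji] := init_index i; rewrite -(optuple_init N U ji); exact: gd_bounded G _. Qed.

Lemma gd_boundedS i : bounded_op (S i).
Proof. by have [j ji] := init_index i; rewrite -(optuple_init S V ji). Qed.

Lemma gd_intN i h : N i (iota h) = iota (S i h).
Proof.
have [j ji] := init_index i.
by rewrite -(optuple_init N U ji) -(optuple_init S V ji); exact: gd_int G _ _.
Qed.

Lemma commutes_withP Y : commutes_with (optuple N U) Y <->
  Y \o U = U \o Y /\ forall i, Y \o N i = N i \o Y.
Proof.
split=> [h|[hU hN] j].
  split=> [|i].
    by have [k kd] := last_index d0; rewrite -(optuple_last N U kd).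
  by have [j ji] := init_index i; rewrite -(optuple_init N U ji).
by rewrite /optuple; case: insub => [i|] /=; [exact: hN|exact: hU].
Qed.

Lemma gd_commNU i : N i \o U = U \o N i.
Proof.
have [k kd] := last_index d0; have [j ji] := init_index i.
have := gd_comm G j k; rewrite (optuple_last N U kd) (optuple_init N U ji).
exact.
Qed.

Lemma commutes_with_optuple j : commutes_with (optuple N U) (optuple N U j).
Proof. by move=> k; exact: gd_comm G _ _. Qed.

(** Adjoints of the [N i] are in the algebra generated by [U^*] and the [N i],
so that commutants are automatically closed under adjoints. *)
Lemma gd_adjN i : adj (N i) = N (rev_ord i) \o adj U.
Proof.
apply/funext => k /=; have := congr1 (fun f => f (adj U k)) (gd_rel G i) => /= <-.
by rewrite (unitary_Kadj D).
Qed.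

Lemma commutes_with_adjN Y i : commutes_with (optuple N U) Y ->
  Y \o adj (N i) = adj (N i) \o Y.
Proof.
move=> /commutes_withP[YU YN]; rewrite gd_adjN; apply/funext => k /=.
have /(congr1 (fun f => f (adj U k)))/= -> := YN (rev_ord i).
by have /(congr1 (fun f => f k))/= -> := comm_adjU D YU.
Qed.

Lemma commutes_with_adj Y : bounded_op Y -> commutes_with (optuple N U) Y ->
  commutes_with (optuple N U) (adj Y).
Proof.
move=> bY cY; have [YU YN] := (commutes_withP Y).1 cY; apply/commutes_withP; split=> [|i].
  have := comm_adjU D YU => /(congr1 (@adj _ _ _)).
  by rewrite (adj_comp bY bU') (adj_comp bU' bY) (adjK bU).
have bN := gd_boundedN i; have bN' := bounded_op_adj bN.
have := commutes_with_adjN i cY => /(congr1 (@adj _ _ _)).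
by rewrite (adj_comp bY bN') (adj_comp bN' bY) (adjK bN).
Qed.

Lemma adjT_commutes j : commutes_with (optuple N U) (adj (optuple N U j)).
Proof. by apply: commutes_with_adj; [exact: gd_bounded G _|exact: commutes_with_optuple]. Qed.

Lemma rhoE Y h : rho iota Y h = adj iota (Y (iota h)). Proof. by []. Qed.

Lemma adj_iota_comp (A : K -> K) (B : H -> H) k : bounded_op A -> bounded_op B ->
  (forall h, A (iota h) = iota (B h)) -> adj B (adj iota k) = adj iota (adj A k).
Proof.
move=> bA bB AB; apply: dotp_extr => h.
by rewrite -!adjP // AB.
Qed.

Lemma rho_optuple j : rho iota (optuple N U j) = optuple S V j.
Proof. by apply/funext => h; rewrite rhoE (gd_int G) isometry_adjK. Qed.

(** The relations [N_i^* U = N_(d-i)] and [U^* U = 1], between operators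
commuting with [Y], compress to the Brown-Halmos relations. *)
Lemma rho_toeplitz Y : bounded_op Y -> commutes_with (optuple N U) Y ->
  toeplitz S V (rho iota Y).
Proof.
move=> bY cY; have [YU YN] := (commutes_withP Y).1 cY.
split; first exact: bounded_op_rho D _ bY.
- move=> i; apply/funext => h; rewrite /rho /=.
  rewrite (adj_iota_comp _ (gd_boundedN i) (gd_boundedS i) (gd_intN i)).
  rewrite -(dd_intertwine D) -gd_intN.
  have /(congr1 (fun f => f (U (iota h))))/= <- := commutes_with_adjN i cY.
  by have /(congr1 (fun f => f (iota h)))/= -> := gd_rel G i.
- apply/funext => h; rewrite /rho /=.
  rewrite (adj_iota_comp _ bU (dd_boundedV D) (dd_intertwine D)) -(dd_intertwine D).
  have /(congr1 (fun f => f (iota h)))/= -> := YU.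
  by rewrite (unitary_adjK D).
Qed.

Hypothesis dn : dense_orbit iota U.

(** The symbol [Y] commutes with [U] as a limit along the orbit. The operators
[N_(d-i)^* Y U] and [Y N_i] both commute with [U] and have the same
compression, by the Brown-Halmos relations; hence they are equal, and
[N_(d-i)^* U = N_i] shows that [Y] commutes with [N_i]. *)
Lemma toeplitz_lift X : toeplitz S V X ->
  exists Y, [/\ bounded_op Y, commutes_with (optuple N U) Y, slim iota U X Y & rho iota Y = X].
Proof.
move=> [bX tXi tX]; have [Y XY] := slim_toeplitz D dn bX tX.
have bY := slim_bounded D bX XY; have YU := slim_comm_U D XY.
have rY := slim_rhoK D bX tX XY.
exists Y; split => //; apply/commutes_withP; split => // i.
pose j := rev_ord i; have ij : rev_ord j = i by rewrite /j rev_ordK.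
have bNj' := bounded_op_adj (gd_boundedN j).
have e : adj (N j) \o Y \o U = Y \o N i.
  apply: (rho_inj D dn).
  - by apply: bounded_op_comp => //; exact: bounded_op_comp.
  - exact: bounded_op_comp bY (gd_boundedN i).
  - have cU : adj (N j) \o U = U \o adj (N j).
      rewrite gd_adjN ij; apply/funext => k /=; rewrite (unitary_adjK D).
      have /(congr1 (fun f => f (adj U k)))/= <- := gd_commNU i.
      by rewrite (unitary_Kadj D).
    apply/funext => k /=.
    have /(congr1 (fun f => f (U k)))/= -> := YU.
    by have /(congr1 (fun f => f (Y (U k))))/= -> := cU.
  - apply/funext => k /=.
    have /(congr1 (fun f => f k))/= -> := gd_commNU i.
    by have /(congr1 (fun f => f (N i k)))/= -> := YU.
  - apply/funext => h; rewrite [RHS]rhoE /= gd_intN -rhoE rY -[in RHS]ij.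
    have /(congr1 (fun f => f h))/= <- := tXi j.
    rewrite rhoE /= (dd_intertwine D) -rY rhoE.
    by rewrite (adj_iota_comp _ (gd_boundedN j) (gd_boundedS j) (gd_intN j)).
rewrite -e; apply/funext => k /=.
have /(congr1 (fun f => f k))/= -> := YU.
by have /(congr1 (fun f => f (Y k)))/= -> := gd_rel G j; rewrite ij.
Qed.

Lemma adjS_V i : adj (S i) \o V = S (rev_ord i).
Proof.
have [j ji] := init_index i; have [k kd] := last_index d0.
have [_ h _] := rho_toeplitz (bounded_op_id K) (fun j => erefl).
have e : rho iota idfun = idfun by apply/funext => x; rewrite rhoE isometry_adjK.
by have := h i; rewrite e.
Qed.

Lemma commutant_toeplitz X : bounded_op X -> commutes_with (optuple S V) X -> toeplitz S V X.
Proof.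
move=> bX cX; have [k kd] := last_index d0.
have XV : X \o V = V \o X by rewrite -(optuple_last S V kd).
have XVh h : X (V h) = V (X h) by exact: (congr1 (fun f => f h) XV).
split => // [i|]; apply/funext => h /=; rewrite XVh.
  have [j ji] := init_index (rev_ord i).
  have := congr1 (fun f => f h) (cX j); rewrite (optuple_init S V ji) /= => ->.
  by have /(congr1 (fun f => f (X h)))/= -> := adjS_V i.
exact: (congr1 (fun f => f (X h)) (adjV_V D)).
Qed.

Lemma iota_inj : injective iota.
Proof. by move=> x y e; rewrite -(isometry_adjK x Ii) e isometry_adjK. Qed.

(** An operator commuting with the isometry is Toeplitz, and its symbol
extends it by [slim_comm_extend]. *)
Lemma commutant_extension X : bounded_op X ->
  commutes_with (optuple S V) X <->
  exists! Y : K -> K, [/\ bounded_op Y, forall h, Y (iota h) = iota (X h),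
    opnorm Y = opnorm X & commutes_with (optuple N U) Y].
Proof.
move=> bX; split=> [cX|[Y [[bY YX _ cY] _]] j]; last first.
  apply/funext => h; apply: iota_inj => /=.
  rewrite -(gd_int G) -!YX -(gd_int G).
  exact: (congr1 (fun f => f (iota h)) (cY j)).
have [k kd] := last_index d0.
have XV : X \o V = V \o X by rewrite -(optuple_last S V kd).
have [Y [bY cY XY rY]] := toeplitz_lift (commutant_toeplitz bX cX).
have [YU _] := (commutes_withP Y).1 cY.
exists Y; split=> [|Z [bZ ZX _ cZ]].
  split => // [h|]; first exact: (slim_comm_extend D h XV XY).
  by rewrite -rY (opnorm_rho D dn).
have [ZU _] := (commutes_withP Z).1 cZ.
apply: (rho_inj D dn) => //; rewrite rY; apply/funext => h.
by rewrite rhoE ZX isometry_adjK.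
Qed.

Lemma toeplitz_dilation X : bounded_op X ->
  toeplitz S V X <->
  exists! Y : K -> K, [/\ bounded_op Y, commutes_with (optuple N U) Y,
    opnorm X = opnorm Y & forall h, iota (X h) = orthoproj (range iota) (Y (iota h))].
Proof.
move=> bX.
have rP (Y : K -> K) :
    (forall h, iota (X h) = orthoproj (range iota) (Y (iota h))) <-> rho iota Y = X.
  split=> [h|<- h]; last by rewrite orthoproj_isometry.
  by apply/funext => x; apply: iota_inj; rewrite h orthoproj_isometry.
split=> [tX|[Y [[bY cY _ /rP <-] _]]]; last exact: rho_toeplitz.
have [Y [bY cY XY rY]] := toeplitz_lift tX.
have [YU _] := (commutes_withP Y).1 cY.
exists Y; split=> [|Z [bZ cZ _ /rP rZ]].
  split => //; last exact/rP.
  by rewrite -rY (opnorm_rho D dn).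
have [ZU _] := (commutes_withP Z).1 cZ.
by apply: (rho_inj D dn) => //; rewrite rY rZ.
Qed.

Lemma opinv_unitary : opinv U = adj U.
Proof.
rewrite /opinv; case: xgetP => [W _ /= [WU UW]|/(_ (adj U))[]]; last first.
  by split; [exact: dd_adjl D|exact: dd_adjr D].
apply/funext => k.
have /(congr1 (fun f => f (adj U k)))/= := WU.
by rewrite (unitary_Kadj D).
Qed.

Lemma span_orbit_dense :
  closure (lspan [set zpow U m (iota h) | m in [set: int] & h in [set: H]]) = [set: K].
Proof.
apply/seteqP; split => // k _; apply/closure_hnormP => e e0.
have [n [h hk]] := dn k e0; exists (emb iota U n h) => //.
apply: sub_gen_smallest; case: n {hk} => [|n].
  by exists (Posz 0) => //; exists h => //.
by exists (Negz n) => //; exists h => //=; rewrite opinv_unitary.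
Qed.

Lemma dense_orbit_minimal (M : set K) : closed M -> range iota `<=` M ->
  (forall j, reduces M (optuple N U j)) -> M = setT.
Proof.
move=> cM iM rM; apply/seteqP; split => // k _.
have [j jd] := last_index d0; have [_ MU] := rM j; rewrite optuple_last // in MU.
have hM n h : M (emb iota U n h).
  by elim: n => [|n IH]; [apply: iM; exists h|exact: MU].
move/closed_hnormP: cM => cM; apply: cM => e /(dn k)[n [h hk]].
by exists (emb iota U n h).
Qed.

End Fixed.

Section OrbitClosure.
Variables (K : hilbertType R) (iota : H -> K) (N : 'I_d.-1 -> K -> K) (U : K -> K).
Hypothesis G : gamma_dilation iota N U.
Let D := gd_dil G.
Let e := emb iota U.

(** The space of the minimal extension inside an arbitrary one. *)
Definition orbit_closure := [set k | forall r : R, 0 < r -> exists n h, hnorm (k - e n h) < r].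

Lemma orbit_closure_emb n h : orbit_closure (e n h).
Proof. by move=> r r0; exists n, h; rewrite subrr hnorm0. Qed.

Lemma orbit_closure_approx k : (forall r : R, 0 < r ->
  exists2 y, orbit_closure y & hnorm (k - y) < r) -> orbit_closure k.
Proof.
move=> hk r r0; have r2 : 0 < r / 2 by lra.
have [y /(_ _ r2)[n [h yh]] ky] := hk _ r2.
exists n, h; have := hnorm_dist y k (e n h); lra.
Qed.

Lemma closed_orbit_closure : closed orbit_closure.
Proof. by apply/closed_hnormP => k; exact: orbit_closure_approx. Qed.

Lemma orbit_closure_ZD (a : R[i]) m h n h' : exists p h'', a *: e m h + e n h' = e p h''.
Proof.
pose p := maxn m n.
exists p, (a *: iter (p - m) V h + iter (p - n) V h').
rewrite /e (bopZD (bounded_op_emb D p)).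
by rewrite -!(emb_sub D) ?leq_maxl ?leq_maxr.
Qed.

Lemma subspace_orbit_closure : subspace orbit_closure.
Proof.
split.
  have -> : 0 = e 0%N 0 :> K by rewrite /e (bop0 (bounded_op_emb D 0)).
  exact: orbit_closure_emb.
move=> a x y hx hy r r0.
have r1 : 0 < r / 2 / (modc a + 1) by rewrite !divr_gt0 // ltr_wpDl ?modc_ge0.
have [m [h xh]] := hx _ r1; have [n [h' yh]] := hy (r / 2) ltac:(lra).
have [p [h'' E]] := orbit_closure_ZD a m h n h'.
exists p, h''; rewrite -E opprD addrACA -scalerBr.
have := hnormD (a *: (x - e m h)) (y - e n h'); rewrite hnormZ.
rewrite ltr_pdivlMr ?ltr_wpDl ?modc_ge0 // in xh.
have := hnorm_ge0 (x - e m h); have := modc_ge0 a; lra.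
Qed.

Lemma orbit_closure_stable (T : K -> K) : bounded_op T ->
  (forall n h, orbit_closure (T (e n h))) -> forall k, orbit_closure k -> orbit_closure (T k).
Proof.
move=> bT hT k hk; apply: orbit_closure_approx => r r0.
have [n [h kh]] := hk (r / (opnorm T + 1)) ltac:(by rewrite divr_gt0 // ltr_wpDl ?opnorm_ge0).
exists (T (e n h)) => //; rewrite -(bopB bT).
rewrite ltr_pdivlMr ?ltr_wpDl ?opnorm_ge0 // in kh.
have := le_opnorm (k - e n h) bT; have := hnorm_ge0 (k - e n h); lra.
Qed.

Lemma optuple_emb j n h : optuple N U j (e n h) = e n (optuple S V j h).
Proof.
rewrite /e /emb -(gd_int G); move: (iota h) => k; elim: n k => // n IH k.
have cT : optuple N U j \o adj U = adj U \o optuple N U j.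
  apply: (comm_adjU D); have [l ld] := last_index d0.
  by have := gd_comm G j l; rewrite (optuple_last N U ld).
by rewrite iterS; have /(congr1 (fun f => f (iter n (adj U) k)))/= -> := cT; rewrite IH.
Qed.

(** It is reducing because the adjoints of the [N i] are words in [U^*] and
the [N i]. *)
Lemma orbit_closure_reduces j : reduces orbit_closure (optuple N U j).
Proof.
have bT := gd_bounded G j.
split.
  apply: orbit_closure_stable => // n h; rewrite optuple_emb.
  exact: orbit_closure_emb.
apply: orbit_closure_stable => [|n h]; first exact: bounded_op_adj.
have [[i [-> _]]|[-> _]] := optuple_indices N U j; last first.
  exact: (orbit_closure_emb n.+1 h).
rewrite (gd_adjN G) -[X in orbit_closure X]/(N (rev_ord i) (e n.+1 h)).
have [k ki] := init_index (rev_ord i); rewrite -(optuple_init N U ki) optuple_emb.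
exact: orbit_closure_emb.
Qed.

Lemma orbit_closure_iota : range iota `<=` orbit_closure.
Proof. by move=> _ [h _ <-]; exact: (orbit_closure_emb 0 h). Qed.

End OrbitClosure.

(** The orbit closure is a closed reducing subspace containing [H], hence
everything by minimality. *)
Lemma minimal_extension_dense (K : hilbertType R) (iota : H -> K) N (U : K -> K) :
  minimal_extension S V iota N U -> gamma_dilation iota N U /\ dense_orbit iota U.
Proof.
move=> [ext hmin]; have G := gamma_dilation_of_extension ext; split => // k r r0.
have e : orbit_closure iota U = setT.
  apply: hmin; [exact: closed_orbit_closure|exact: subspace_orbit_closure G|
    exact: orbit_closure_iota|exact: orbit_closure_reduces G].
have : orbit_closure iota U k by rewrite e.
exact.
Qed.

Section Uniqueness.
Variables (K K' : hilbertType R) (iota : H -> K) (iota' : H -> K').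
Variables (N : 'I_d.-1 -> K -> K) (U : K -> K) (N' : 'I_d.-1 -> K' -> K') (U' : K' -> K').
Hypotheses (G : gamma_dilation iota N U) (G' : gamma_dilation iota' N' U').
Let D := gd_dil G.
Let D' := gd_dil G'.
Hypothesis dn : dense_orbit iota U.

(** The operators [U'^{-n} iota' iota^* U^n] are eventually constant on each
[emb m h]; their strong limit exchanges the two orbits, and its adjoint
exchanges them back. *)
Lemma intertwiner_exists : exists2 W : K -> K', isometric_embedding W &
  forall n h, W (emb iota U n h) = emb iota' U' n h.
Proof.
have evt n h m : (n <= m)%N ->
    emb iota' U' m (coemb iota U m (emb iota U n h)) = emb iota' U' n h.
  by move=> nm; rewrite (emb_sub D h nm) (embK D) (emb_sub D' h nm).
have [|||x e e0|W [bW W_lim _]] :=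
  @strong_limit _ _ _ (fun n => emb iota' U' n \o coemb iota U n) 1.
- move=> n a x y /=.
  by rewrite (bopZD (bounded_op_coemb D n)) (bopZD (bounded_op_emb D' n)).
- exact: ler01.
- by move=> n x /=; rewrite mul1r (hnorm_emb D'); exact: (coemb_le D n x).
- have [n [h xh]] := dn x e0; exists (emb iota U n h) => //.
  exact: hcauchy_evt_cst (evt n h).
have We n h : W (emb iota U n h) = emb iota' U' n h.
  apply: hcvg_unique (W_lim (emb iota U n h)) _.
  by apply: hcvg_near (hcvg_cst (emb iota' U' n h)); exists n => m nm /=; rewrite evt.
exists W; last exact: We.
split; first exact: bW.1.
have cW n : coemb iota' U' n \o W = coemb iota U n.
  apply: (dense_ext D dn).
  - exact: bounded_op_comp (bounded_op_coemb D' n) bW.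
  - exact: bounded_op_coemb D n.
  move=> m h /=; rewrite We; have [nm|/ltnW mn] := leqP n m.
    by rewrite (coemb_sub D h nm) (coemb_sub D' h nm).
  by rewrite (emb_sub D h mn) (emb_sub D' h mn) (embK D) (embK D').
have aW n h : adj W (emb iota' U' n h) = emb iota U n h.
  apply: dotp_ext => k.
  have /(congr1 (fun f => f k))/= e := cW n.
  by rewrite -adjPr // (dotp_emb D') (dotp_emb D) e.
have WW : adj W \o W = idfun.
  apply: (dense_ext D dn); last by move=> n h /=; rewrite We aW.
    by apply: bounded_op_comp => //; exact: bounded_op_adj.
  exact: bounded_op_id.
move=> x y; rewrite adjP //.
by have /(congr1 (fun f => f y))/= -> := WW.
Qed.

End Uniqueness.

Lemma minimal_extensions_equivalent (K K' : hilbertType R) (iota : H -> K) N (U : K -> K)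
    (iota' : H -> K') N' (U' : K' -> K') :
  minimal_extension S V iota N U -> minimal_extension S V iota' N' U' ->
  equivalent_extensions iota N U iota' N' U'.
Proof.
move=> /minimal_extension_dense[G dn] /minimal_extension_dense[G' dn'].
have D := gd_dil G; have D' := gd_dil G'.
have [W IW We] := intertwiner_exists G G' dn.
have [W' IW' We'] := intertwiner_exists G' G dn'.
have bW := isometry_bounded IW; have bW' := isometry_bounded IW'.
exists W; split => //.
- apply/seteqP; split => // k _; exists (W' k) => //.
  have : W \o W' = idfun.
    apply: (dense_ext D' dn'); [exact: bounded_op_comp|exact: bounded_op_id|].
    by move=> n h /=; rewrite We' We.
  exact: (congr1 (fun f => f k)).
- by apply/funext => h; exact: (We 0%N h).
- move=> j; apply: (dense_ext D dn).
  + exact: bounded_op_comp bW (gd_bounded G j).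
  + exact: bounded_op_comp (gd_bounded G' j) bW.
  by move=> n h /=; rewrite (optuple_emb G) !We (optuple_emb G').
Qed.

End GammaDilation.

(** * Existence of the minimal extension *)

Section KoszulIntertwining.
Variables (R : realType) (d : nat).

Lemma koszul_intertwine (H K : hilbertType R) (f : H -> K) (T : 'I_d -> K -> K)
    (T' : 'I_d -> H -> H) (x : {ffun {set 'I_d} -> H}) : bounded_op f ->
  (forall i h, T i (f h) = f (T' i h)) ->
  koszul T [ffun A => f (x A)] = [ffun A => f (koszul T' x A)].
Proof.
move=> bf Tf; apply/ffunP => A; rewrite !ffunE (bop_sum bf); apply: eq_bigr => i _.
by rewrite ffunE Tf (bopZ bf).
Qed.

(** A reducing subspace carries a direct summand of the Koszul complex, and a
summand of an exact complex is exact. *)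
Lemma koszul_exact_summand (H K : hilbertType R) (f : H -> K) (T : 'I_d -> K -> K)
    (T' : 'I_d -> H -> H) : isometric_embedding f ->
  (forall i h, T i (f h) = f (T' i h)) ->
  (forall i k, T' i (adj f k) = adj f (T i k)) ->
  koszul_exact T -> koszul_exact T'.
Proof.
move=> If Tf Tf' eT x x0; have bf := isometry_bounded If.
have [|y fxy] := eT [ffun A => f (x A)].
  by rewrite (koszul_intertwine x bf Tf) x0; apply/ffunP => A; rewrite !ffunE bop0.
exists [ffun A => adj f (y A)].
rewrite (koszul_intertwine y (bounded_op_adj bf) Tf') -fxy.
by apply/ffunP => A; rewrite !ffunE isometry_adjK.
Qed.

End KoszulIntertwining.

Section MinimalExistence.
Variables (R : realType) (d : nat) (H : hilbertType R).
Variables (S : 'I_d.-1 -> H -> H) (V : H -> H).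
Hypothesis d0 : (0 < d)%N.
Hypothesis bS : forall j, bounded_op (optuple S V j).

Lemma optuple_compress (K : hilbertType R) (M : closed_subspace K) (N : 'I_d.-1 -> K -> K) U j :
  optuple (fun i => compress M (N i)) (compress M U) j = compress M (optuple N U j).
Proof. by rewrite /optuple; case: insub. Qed.

(** Restrict the given extension to the closure of the backward orbit of [H].
The restriction stays normal because the subspace reduces, and its joint
spectrum does not grow by [koszul_exact_summand]. *)
Lemma minimal_extension_exists : gamma_isometry S V ->
  exists (K : hilbertType R) (iota : H -> K) (N : 'I_d.-1 -> K -> K) (U : K -> K),
    minimal_extension S V iota N U.
Proof.
move=> [_ _ [K0 [iota0 [N0 [U0 ext]]]]].
have G0 := gamma_dilation_of_extension d0 bS ext; have D0 := gd_dil G0.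
have [I0 [bT cT nT TG] int0] := ext.
pose M := ClosedSubspace (@closed_orbit_closure _ _ _ iota0 U0) (subspace_orbit_closure G0).
have rM := orbit_closure_reduces d0 G0.
pose f : subH M -> K0 := @subH_val R K0 M.
have If : isometric_embedding f := subH_isometry M.
have finj (x y : subH M) : f x = f y -> x = y by exact: subH_inj.
pose T0 := optuple N0 U0.
have fT j x : f (compress M (T0 j) x) = T0 j (f x).
  by apply: compressE; exact: (rM j).1.
have fTa j x : f (adj (compress M (T0 j)) x) = adj (T0 j) (f x).
  by rewrite adj_compress //; apply: compressE; exact: (rM j).2.
have iM h : cs_set M (iota0 h) by apply: orbit_closure_iota; exists h.
pose iota h : subH M := mkSub (iM h).
pose N i := compress M (N0 i); pose U := compress M U0.
have TE j : optuple N U j = compress M (T0 j) by exact: optuple_compress.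
have Ii : isometric_embedding iota.
  split; last by move=> x y; exact: I0.2.
  by move=> a x y; apply: finj; exact: I0.1.
have ext1 : gamma_unitary_extension S V iota N U.
  split => //.
    split.
    - by move=> j; rewrite TE; exact: bounded_op_compress.
    - move=> i j; apply/funext => x; apply: finj; rewrite !TE /= !fT.
      exact: (congr1 (fun g => g (f x)) (cT i j)).
    - move=> j; apply/funext => x; apply: finj; rewrite TE /= fT !fTa fT.
      exact: (congr1 (fun g => g (f x)) (nT j)).
    - apply: subset_trans TG => l /= nex ex; apply: nex.
      have Ez j (h : subH M) : (T0 j - l 0 j *: idfun) (f h) =
          f ((optuple N U j - l 0 j *: idfun) h).
        rewrite -[LHS]/(T0 j (f h) - l 0 j *: f h) TE -fT.
        by rewrite -(bopZ (isometry_bounded If)) -(bopB (isometry_bounded If)).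
      apply: (koszul_exact_summand If Ez _ ex) => j k.
      have bf' := bounded_op_adj (isometry_bounded If).
      rewrite -[RHS]/(adj f (T0 j k - l 0 j *: k)) (bopB bf') (bopZ bf').
      rewrite -[LHS]/(optuple N U j (adj f k) - l 0 j *: adj f k) TE.
      by rewrite adj_compressE //; exact: (rM j).2.
  move=> j h; apply: finj; rewrite TE fT; exact: int0.
exists (subH M), iota, N, U; split => // M' cM' _ iM' rM'.
apply: (dense_orbit_minimal d0 (iota := iota) _ cM' iM' rM') => k r r0.
have [n [h hk]] := (subHP k : orbit_closure iota0 U0 (f k)) r r0; exists n, h.
have fe : f (emb iota U n h) = emb iota0 U0 n h.
  elim: n {hk} => // n IH; rewrite /emb !iterS -/(emb iota U n h) -/(emb iota0 U0 n h) -IH.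
  by have [j jd] := last_index d0; have := fTa j; rewrite /T0 optuple_last.
rewrite -(isometry_hnorm _ If) (bopB (isometry_bounded If)) fe.
exact: hk.
Qed.

End MinimalExistence.

(** * Operator norms and C-star subalgebras *)

Section OperatorNormArithmetic.
Variables (R : realType).
Implicit Types (H K L : hilbertType R).

Lemma opnormD H K (A B : H -> K) : bounded_op A -> bounded_op B ->
  opnorm (A + B) <= opnorm A + opnorm B.
Proof.
move=> bA bB; apply: opnorm_le => [|x]; first by rewrite addr_ge0 ?opnorm_ge0.
rewrite -[(A + B) x]/(A x + B x) mulrDl.
by apply: le_trans (hnormD _ _) _; rewrite lerD ?le_opnorm.
Qed.

Lemma opnorm_comp H K L (A : K -> L) (B : H -> K) : bounded_op A -> bounded_op B ->
  opnorm (A \o B) <= opnorm A * opnorm B.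
Proof.
move=> bA bB; apply: opnorm_le => [|x]; first by rewrite mulr_ge0 ?opnorm_ge0.
apply: le_trans (le_opnorm _ bA) _.
by rewrite -mulrA ler_wpM2l ?opnorm_ge0 ?le_opnorm.
Qed.

Lemma opnormZ_le H K (a : R[i]) (A : H -> K) : bounded_op A ->
  opnorm (a *: A) <= modc a * opnorm A.
Proof.
move=> bA; apply: opnorm_le => [|x]; first by rewrite mulr_ge0 ?opnorm_ge0 ?modc_ge0.
by rewrite -[(a *: A) x]/(a *: A x) hnormZ -mulrA ler_wpM2l ?modc_ge0 ?le_opnorm.
Qed.

Lemma opnormBC H K (A B : H -> K) : opnorm (A - B) = opnorm (B - A).
Proof.
rewrite /opnorm; congr (sup _); apply/seteqP; split => _ [x /= x1 <-]; exists x => //;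
  exact: hnormBC.
Qed.

Lemma opnorm_eq0 H K (A : H -> K) : bounded_op A ->
  (forall e : R, 0 < e -> opnorm A <= e) -> A = 0.
Proof.
move=> bA h; have A0 : opnorm A = 0.
  apply/eqP; rewrite eq_le opnorm_ge0 // andbT; apply/ler_addgt0Pl => e e0.
  by rewrite addr0; exact: h.
apply/funext => x; apply: hnorm_eq0; apply/eqP; rewrite eq_le hnorm_ge0 andbT.
by have := le_opnorm x bA; rewrite A0 mul0r.
Qed.

Lemma opnorm_dist H K (B A C : H -> K) : bounded_op A -> bounded_op B -> bounded_op C ->
  opnorm (A - C) <= opnorm (A - B) + opnorm (B - C).
Proof.
move=> bA bB bC; have -> : A - C = (A - B) + (B - C) by rewrite addrA subrK.
by apply: opnormD; exact: bounded_opB.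
Qed.

End OperatorNormArithmetic.

Section CstarSubalgebras.
Variables (R : realType) (H : hilbertType R).
Implicit Types (M G P : set (H -> H)) (A B : H -> H).

Lemma unital_Cstar_bounded_op : unital_Cstar_subalgebra (@bounded_op R H H).
Proof.
split.
- by split => //; exact: bounded_op_id.
- by move=> A B bA bB; split; [exact: bounded_opD|exact: bounded_op_comp].
- by move=> a A; exact: bounded_opZ.
- by move=> A; exact: bounded_op_adj.
- by [].
Qed.

(** The conditions are stable under intersection, and the bounded operators
form one such algebra. *)
Lemma Cstar_unital G : G `<=` @bounded_op R H H -> unital_Cstar_subalgebra (Cstar G).
Proof.
move=> bG; split.
- split; first by apply: smallest_sub => //; exact: unital_Cstar_bounded_op.
  by move=> M [[[_ ?] _ _ _ _] _].
- move=> A B CA CB; split => M [uM GM].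
    by have [_ h _ _ _] := uM; exact: (h A B (CA _ (conj uM GM)) (CB _ (conj uM GM))).1.
  by have [_ h _ _ _] := uM; exact: (h A B (CA _ (conj uM GM)) (CB _ (conj uM GM))).2.
- move=> a A CA M [uM GM].
  by have [_ _ h _ _] := uM; exact: (h a A (CA _ (conj uM GM))).
- move=> A CA M [uM GM].
  by have [_ _ _ h _] := uM; exact: (h A (CA _ (conj uM GM))).
- move=> T bT hT M [uM GM]; have [_ _ _ _ h] := uM; apply: h => // e /hT[A CA TA].
  by exists A => //; exact: (CA _ (conj uM GM)).
Qed.

Lemma Cstar_gen G : G `<=` Cstar G.
Proof. exact: sub_gen_smallest. Qed.

Lemma Cstar_sub G M : unital_Cstar_subalgebra M -> G `<=` M -> Cstar G `<=` M.
Proof. by move=> uM GM; exact: smallest_sub. Qed.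

Lemma unital_CstarN M A : unital_Cstar_subalgebra M -> M A -> M (- A).
Proof.
move=> [_ _ MZ _ _] MA; rewrite (_ : - A = (-1 : R[i]) *: A); first exact: MZ.
by apply/funext => x; rewrite !fctE scaleN1r.
Qed.

Lemma unital_CstarB M A B : unital_Cstar_subalgebra M -> M A -> M B -> M (A - B).
Proof.
move=> uM MA MB; have [_ h _ _ _] := uM.
by apply: (h _ _ _ _).1 => //; exact: unital_CstarN.
Qed.

Lemma unital_Cstar_iter M A n : unital_Cstar_subalgebra M -> M A -> M (iter n A).
Proof.
move=> [[_ M1] MM _ _ _] MA; elim: n => [|n IH]; first exact: M1.
exact: (MM A (iter n A) MA IH).2.
Qed.

Definition norm_closure P : set (H -> H) := [set B | bounded_op B /\
  forall e : R, 0 < e -> exists2 A, P A & opnorm (B - A) < e].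

(** Operations are norm continuous on bounded sets; for products, approximate
both factors within a precision depending on their norms. *)
Lemma unital_Cstar_norm_closure P :
  P `<=` @bounded_op R H H -> P idfun ->
  (forall A B, P A -> P B -> P (A + B) /\ P (A \o B)) ->
  (forall (a : R[i]) A, P A -> P (a *: A)) -> (forall A, P A -> P (adj A)) ->
  unital_Cstar_subalgebra (norm_closure P).
Proof.
move=> bP P1 PDM PZ Pa; split.
- split; first by move=> A [].
  split; first exact: bounded_op_id.
  move=> e e0; exists idfun => //; rewrite subrr; apply: le_lt_trans e0.
  apply: opnorm_le => // x; rewrite mul0r -[X in hnorm X]/(0 : H).
  by rewrite hnorm0.
- move=> A B [bA hA] [bB hB]; split; split.
  + exact: bounded_opD.
  + move=> e e0; have e2 : 0 < e / 2 by lra.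
    have [A' PA' AA'] := hA _ e2; have [B' PB' BB'] := hB _ e2.
    exists (A' + B'); first exact: (PDM _ _ PA' PB').1.
    have bA' := bP _ PA'; have bB' := bP _ PB'.
    rewrite opprD addrACA; have := opnormD (bounded_opB bA bA') (bounded_opB bB bB'); lra.
  + exact: bounded_op_comp.
  + move=> e e0.
    have a0 := opnorm_ge0 bA; have b0 := opnorm_ge0 bB.
    have K0 : 0 < opnorm A + opnorm B + 1 by lra.
    pose r := Order.min 1 (e / 2 / (opnorm A + opnorm B + 1)).
    have r0 : 0 < r by rewrite lt_min ltr01 !divr_gt0.
    have r1 : r <= 1 by rewrite ge_min lexx.
    have rK : r * (opnorm A + opnorm B + 1) <= e / 2.
      by rewrite -ler_pdivlMr // ge_min lexx orbT.
    have [A' PA' AA'] := hA _ r0; have [B' PB' BB'] := hB _ r0.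
    exists (A' \o B'); first exact: (PDM _ _ PA' PB').2.
    have bA' := bP _ PA'; have bB' := bP _ PB'.
    have bAA := bounded_opB bA bA'; have bBB := bounded_opB bB bB'.
    have -> : (A \o B) - (A' \o B') = ((A - A') \o B') + (A \o (B - B')).
      apply/funext => x; rewrite -[LHS]/(A (B x) - A' (B' x)).
      rewrite -[RHS]/((A (B' x) - A' (B' x)) + A (B x - B' x)) (bopB bA).
      by rewrite [RHS]addrC addrA subrK.
    have := opnormD (bounded_op_comp bAA bB') (bounded_op_comp bA bBB).
    have := opnorm_comp bAA bB'; have := opnorm_comp bA bBB.
    have B'le : opnorm B' <= opnorm B + 1.
      have := opnormD bB (bounded_opB bB' bB).
      rewrite addrC subrK opnormBC; lra.
    have := opnorm_ge0 bAA; have := opnorm_ge0 bBB; have := opnorm_ge0 bB'.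
    move: AA' BB' a0 b0 rK B'le.
    move: (opnorm (A - A')) (opnorm (B - B')) (opnorm A) (opnorm B) (opnorm B').
    move=> p q a b b' pr qr a0 b0 rK b'b b'0 q0 p0 h1 h2 h3.
    have : a * q <= a * r by rewrite ler_wpM2l // ltW.
    have : p * b' <= r * (b + 1) by apply: ler_pM => //; exact: ltW.
    lra.
- move=> a A [bA hA]; split; first exact: bounded_opZ.
  move=> e e0; have a1 : 0 < modc a + 1 by rewrite ltr_wpDl ?modc_ge0.
  have [A' PA' AA'] := hA (e / (modc a + 1)) ltac:(by rewrite divr_gt0).
  exists (a *: A'); first exact: PZ.
  have bAA := bounded_opB bA (bP _ PA').
  rewrite -scalerBr; apply: le_lt_trans (opnormZ_le a bAA) _.
  rewrite ltr_pdivlMr // in AA'; have := opnorm_ge0 bAA; lra.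
- move=> A [bA hA]; split; first exact: bounded_op_adj.
  move=> e /hA[A' PA' AA']; exists (adj A'); first exact: Pa.
  have bA' := bP _ PA'.
  by rewrite -adjB // opnorm_adj //; exact: bounded_opB.
- move=> T bT hT; split => // e e0; have e2 : 0 < e / 2 by lra.
  have [A [bA hA] TA] := hT _ e2; have [A' PA' AA'] := hA _ e2.
  exists A' => //; have := opnorm_dist bT bA (bP _ PA'); lra.
Qed.

Lemma comm_norm_closed A : bounded_op A -> norm_closed [set B | bounded_op B /\ A \o B = B \o A].
Proof.
move=> bA T bT hT; split => //; apply/subr0_eq.
have a1 : 0 < 2 * opnorm A + 1 by have := opnorm_ge0 bA; lra.
apply: opnorm_eq0 => [|e e0]; first by apply: bounded_opB; exact: bounded_op_comp.
have [B [bB AB] TB] := hT (e / (2 * opnorm A + 1)) ltac:(by rewrite divr_gt0).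
have bTB := bounded_opB bT bB.
have -> : (A \o T) - (T \o A) = (A \o (T - B)) - ((T - B) \o A).
  apply/funext => x; rewrite -[LHS]/(A (T x) - T (A x)).
  rewrite -[RHS]/(A (T x - B x) - (T (A x) - B (A x))) (bopB bA).
  have /(congr1 (fun f => f x))/= -> := AB.
  by rewrite opprB addrA subrK.
have := opnormD (bounded_op_comp bA bTB) (bounded_opN (bounded_op_comp bTB bA)).
have -> : opnorm (- ((T - B) \o A)) = opnorm ((T - B) \o A).
  by rewrite -[- _]sub0r opnormBC subr0.
have := opnorm_comp bA bTB; have := opnorm_comp bTB bA.
rewrite ltr_pdivlMr // in TB; have := opnorm_ge0 bTB; lra.
Qed.

End CstarSubalgebras.

Section Ideals.
Variables (R : realType) (H : hilbertType R).
Implicit Types (M J G : set (H -> H)).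

Lemma generated_ideal_sub M J G : closed_ideal M J -> G `<=` J -> generated_ideal M G `<=` J.
Proof. by move=> cJ GJ; exact: smallest_sub. Qed.

End Ideals.

Section MatrixNorm.
Variables (R : realType) (n : nat).
Implicit Types (H K : hilbertType R).

Lemma l2norm_ge0 H (x : 'I_n -> H) : 0 <= l2norm x.
Proof. exact: sqrtr_ge0. Qed.

Lemma l2norm_sq H (x : 'I_n -> H) : l2norm x ^+ 2 = \sum_i hnorm (x i) ^+ 2.
Proof. by rewrite sqr_sqrtr // sumr_ge0 // => i _; exact: sqr_ge0. Qed.

Lemma l2norm_le H K (x : 'I_n -> H) (y : 'I_n -> K) :
  (forall i, hnorm (x i) <= hnorm (y i)) -> l2norm x <= l2norm y.
Proof.
move=> xy; apply: ler_wsqrtr; apply: ler_sum => i _.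
by rewrite ler_pXn2r ?nnegrE ?hnorm_ge0.
Qed.

Lemma hnorm_le_l2norm H (x : 'I_n -> H) i : hnorm (x i) <= l2norm x.
Proof.
rewrite -(ler_pXn2r (n := 2)) ?nnegrE ?hnorm_ge0 ?l2norm_ge0 // l2norm_sq.
by rewrite (bigD1 i) //= lerDl sumr_ge0 // => j _; exact: sqr_ge0.
Qed.

(** The action of a matrix of operators appearing in [mxopnorm]. *)
Definition mxop H (A : 'M[H -> H]_n) (x : 'I_n -> H) i : H := \sum_j A i j (x j).

Lemma mxopnorm_has_sup H (A : 'M[H -> H]_n) : (forall i j, bounded_op (A i j)) ->
  has_sup [set l2norm (mxop A x) | x in [set x : 'I_n -> H | l2norm x <= 1]].
Proof.
move=> bA; split.
  exists (l2norm (mxop A (fun=> 0))); exists (fun=> 0) => //=.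
  rewrite /l2norm big1 ?sqrtr0 // => i _; by rewrite hnorm0 expr0n.
exists (Num.sqrt (\sum_i (\sum_j opnorm (A i j)) ^+ 2)) => _ [x /= x1 <-].
apply: ler_wsqrtr; apply: ler_sum => i _.
have S0 : 0 <= \sum_j opnorm (A i j) by apply: sumr_ge0 => j _; exact: opnorm_ge0.
rewrite ler_pXn2r ?nnegrE ?hnorm_ge0 //.
apply: le_trans (hnorm_sum _ _ _) _; apply: ler_sum => j _.
apply: le_trans (le_opnorm _ (bA i j)) _.
by rewrite -[leRHS]mulr1 ler_wpM2l ?opnorm_ge0 // (le_trans (hnorm_le_l2norm x j)).
Qed.

Lemma le_mxopnorm H (A : 'M[H -> H]_n) x : (forall i j, bounded_op (A i j)) ->
  l2norm x <= 1 -> l2norm (mxop A x) <= mxopnorm A.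
Proof.
by move=> bA x1; apply: ub_le_sup; [exact: (mxopnorm_has_sup bA).2|exists x].
Qed.

Lemma mxopnorm_le H (A : 'M[H -> H]_n) C :
  (forall x, l2norm x <= 1 -> l2norm (mxop A x) <= C) -> mxopnorm A <= C.
Proof.
move=> hC; apply: sup_le_ub => [|_ [x /= x1 <-]]; last exact: hC.
exists (l2norm (mxop A (fun=> 0))); exists (fun=> 0) => //=.
rewrite /l2norm big1 ?sqrtr0 // => i _; by rewrite hnorm0 expr0n.
Qed.

(** Norm bounds on a finite direct sum pass to coordinatewise limits. *)
Lemma hcvg_l2norm_le H (u : nat -> 'I_n -> H) (l : 'I_n -> H) C : 0 <= C ->
  (forall i, hcvg (fun m => u m i) (l i)) -> (forall m, l2norm (u m) <= C) -> l2norm l <= C.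
Proof.
move=> C0 ul uC; rewrite -(ler_pXn2r (n := 2)) ?nnegrE ?l2norm_ge0 //.
apply/ler_addgt0Pl => e e0.
pose r := e / (n%:R + 1).
have n1 : 0 < n%:R + 1 :> R by rewrite ltr_wpDl.
have r0 : 0 < r by rewrite divr_gt0.
have /choice[N hN] : forall i, exists N, forall m, (N <= m)%N ->
    hnorm (l i) ^+ 2 <= hnorm (u m i) ^+ 2 + r.
  move=> i; have L0 := hnorm_ge0 (l i).
  have [|N hN] := ul i (r / (2 * hnorm (l i) + 1)).
    by rewrite divr_gt0 // ltr_wpDl // mulr_ge0.
  exists N => m /hN; rewrite ltr_pdivlMr; last by rewrite ltr_wpDl // mulr_ge0.
  have := hnormB (u m i) (u m i - l i); rewrite opprB addrC subrK.
  have := hnorm_ge0 (u m i); have := hnorm_ge0 (u m i - l i).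
  move: (hnorm (u m i)) (hnorm (u m i - l i)) (hnorm (l i)) L0 => a b c c0 b0 a0 cab bc.
  have [ca|ac] := leP c a.
    have : c ^+ 2 <= a ^+ 2 by rewrite ler_pXn2r.
    lra.
  have : (c - a) * (c + a) <= b * (2 * c) by apply: ler_pM; lra.
  lra.
pose m := \max_i N i.
rewrite l2norm_sq; apply: (@le_trans _ _ (\sum_i (hnorm (u m i) ^+ 2 + r))).
  by apply: ler_sum => i _; apply: hN; exact: leq_bigmax.
rewrite big_split /= -l2norm_sq sumr_const card_ord -mulr_natl addrC.
apply: lerD; last by rewrite ler_pXn2r ?nnegrE ?l2norm_ge0.
have : (n%:R + 1) * r = e by rewrite mulrC divfK ?gt_eqF.
lra.
Qed.

End MatrixNorm.

(** * The extension of C-star algebras *)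

Section CstarExtension.
Variables (R : realType) (d : nat) (H K : hilbertType R).
Variables (S : 'I_d.-1 -> H -> H) (V : H -> H) (iota : H -> K).
Variables (N : 'I_d.-1 -> K -> K) (U : K -> K).
Hypothesis d0 : (0 < d)%N.
Hypothesis bS : forall j, bounded_op (optuple S V j).
Hypothesis G : gamma_dilation S V iota N U.
Hypothesis dn : dense_orbit iota U.

Let D := gd_dil G.
Let Ii := dd_iso D.
Let bi := isometry_bounded Ii.
Let bU := dd_bounded D.
Let bU' := bounded_op_adj bU.
Let bV := dd_boundedV D.
Let T := optuple N U.
Let bT := gd_bounded G.
Let CS := Cstar (range (optuple S V)).
Let CR := Cstar (range T).
Let slm := slim iota U.
Let rh := rho iota.

Let commT_U B : commutes_with T B -> B \o U = U \o B.
Proof. by move=> /(commutes_withP d0 N U B).1[]. Qed.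

Let bCS : range (optuple S V) `<=` @bounded_op R H H.
Proof. by move=> _ [j _ <-]; exact: bS. Qed.

Let bCR : range T `<=` @bounded_op R K K.
Proof. by move=> _ [j _ <-]; exact: bT. Qed.

Let uCS : unital_Cstar_subalgebra CS := Cstar_unital bCS.
Let uCR : unital_Cstar_subalgebra CR := Cstar_unital bCR.

Let CS_bounded A : CS A -> bounded_op A.
Proof. by have [[h _] _ _ _ _] := uCS => /h. Qed.

Let CR_bounded A : CR A -> bounded_op A.
Proof. by have [[h _] _ _ _ _] := uCR => /h. Qed.

Let CS1 : CS idfun. Proof. by have [[]] := uCS. Qed.
Let CSD A B : CS A -> CS B -> CS (A + B).
Proof. by move=> a b; have [_ h _ _ _] := uCS; exact: (h A B a b).1. Qed.
Let CSM A B : CS A -> CS B -> CS (A \o B).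
Proof. by move=> a b; have [_ h _ _ _] := uCS; exact: (h A B a b).2. Qed.
Let CSZ (a : R[i]) A : CS A -> CS (a *: A).
Proof. by have [_ _ h _ _] := uCS; exact: h. Qed.
Let CSadj A : CS A -> CS (adj A).
Proof. by have [_ _ _ h _] := uCS; exact: h. Qed.
Let CRD A B : CR A -> CR B -> CR (A + B).
Proof. by move=> a b; have [_ h _ _ _] := uCR; exact: (h A B a b).1. Qed.
Let CRM A B : CR A -> CR B -> CR (A \o B).
Proof. by move=> a b; have [_ h _ _ _] := uCR; exact: (h A B a b).2. Qed.
Let CRZ (a : R[i]) A : CR A -> CR (a *: A).
Proof. by have [_ _ h _ _] := uCR; exact: h. Qed.
Let CRadj A : CR A -> CR (adj A).
Proof. by have [_ _ _ h _] := uCR; exact: h. Qed.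

Let CSV : CS V.
Proof.
have [k kd] := last_index d0; rewrite -(optuple_last S V kd).
by apply: Cstar_gen; exists k.
Qed.

Let CRU : CR U.
Proof.
have [k kd] := last_index d0; rewrite -(optuple_last N U kd).
by apply: Cstar_gen; exists k.
Qed.

(** Operators commuting with the commutant of the tuple form a C-star algebra
containing the tuple. In particular [CR] is commutative. *)
Lemma Cstar_bicommutant B : CR B -> forall A, bounded_op A -> commutes_with T A ->
  A \o B = B \o A.
Proof.
move=> CB A bA cA.
pose M := [set B : K -> K | bounded_op B /\ forall A, bounded_op A -> commutes_with T A ->
  A \o B = B \o A].
suff : CR `<=` M by move=> /(_ B CB)[_ h]; exact: h.
apply: Cstar_sub; last by move=> _ [j _ <-]; split; [exact: bT|move=> A' _ cA'; exact: cA'].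
split.
- by split=> [B' []//|]; split; first exact: bounded_op_id.
- move=> B1 B2 [b1 h1] [b2 h2]; split; split.
  + exact: bounded_opD.
  + move=> A' bA' cA'; apply/funext => x.
    rewrite -[LHS]/(A' (B1 x + B2 x)) -[RHS]/(B1 (A' x) + B2 (A' x)) (bopD bA').
    have /(congr1 (fun f => f x))/= -> := h1 A' bA' cA'.
    by have /(congr1 (fun f => f x))/= -> := h2 A' bA' cA'.
  + exact: bounded_op_comp.
  + move=> A' bA' cA'; apply/funext => x /=.
    have /(congr1 (fun f => f (B2 x)))/= -> := h1 A' bA' cA'.
    by have /(congr1 (fun f => f x))/= -> := h2 A' bA' cA'.
- move=> a B1 [b1 h1]; split; first exact: bounded_opZ.
  move=> A' bA' cA'; apply/funext => x.
  rewrite -[LHS]/(A' (a *: B1 x)) -[RHS]/(a *: B1 (A' x)) (bopZ bA').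
  by have /(congr1 (fun f => f x))/= -> := h1 A' bA' cA'.
- move=> B1 [b1 h1]; split; first exact: bounded_op_adj.
  move=> A' bA' cA'; have ba := bounded_op_adj bA'.
  have := h1 _ ba (commutes_with_adj d0 G bA' cA') => /(congr1 (@adj _ _ _)).
  by rewrite (adj_comp ba b1) (adj_comp b1 ba) (adjK bA') => ->.
- move=> B1 b1 h1; split => // A' bA' cA'.
  apply: (comm_norm_closed bA' b1 _).2 => e /h1[B2 [b2 h2]].
  by exists B2 => //; split => //; exact: h2.
Qed.

Let CR_commutes B : CR B -> commutes_with T B.
Proof.
move=> CB j.
exact: (esym (Cstar_bicommutant CB (bT j) (commutes_with_optuple G j))).
Qed.

Let CR_commU B : CR B -> B \o U = U \o B.
Proof. by move=> /CR_commutes/commT_U. Qed.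

(** Convergence is required of the adjoints too, because strong convergence is
not stable under adjunction. *)
Definition slimmable : set (H -> H) := [set X | [/\ bounded_op X,
  exists Y, slm X Y & exists Y, slm (adj X) Y]].

Lemma slimmable_gen j : slimmable (optuple S V j).
Proof.
split; first exact: bS.
  exists (T j); rewrite -(rho_optuple G); apply: (slim_rho D dn (bT j)).
  by apply: commT_U; exact: (commutes_with_optuple G j).
exists (adj (T j)); rewrite -(rho_optuple G) (adj_rho D) //.
apply: (slim_rho D dn); first exact: bounded_op_adj.
by apply: commT_U; exact: (adjT_commutes d0 G j).
Qed.

(** Strong limits of uniformly bounded sequences are compatible with products
and norm limits; this puts all of [CS] in the domain of the symbol map. *)
Lemma unital_Cstar_slimmable : unital_Cstar_subalgebra slimmable.
Proof.
split.
- split=> [A []//|]; split; first exact: bounded_op_id.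
    by exists idfun; exact: (slim_id D dn).
  by exists idfun; rewrite adj_id; exact: (slim_id D dn).
- move=> A B [bA [YA hA] [YA' hA']] [bB [YB hB] [YB' hB']].
  have bA' := bounded_op_adj bA; have bB' := bounded_op_adj bB; split; split.
  + exact: bounded_opD.
  + by exists (YA + YB); exact: (slimD D).
  + by exists (YA' + YB'); rewrite adjD //; exact: (slimD D).
  + exact: bounded_op_comp.
  + by exists (YA \o YB); exact: (slim_comp D).
  + by exists (YB' \o YA'); rewrite adj_comp //; exact: (slim_comp D).
- move=> a A [bA [Y hY] [Y' hY']]; split; first exact: bounded_opZ.
    by exists (a *: Y); exact: (slimZ D).
  by exists (Num.conj a *: Y'); rewrite adjZ //; exact: (slimZ D).
- move=> A [bA hY hY']; split; [exact: bounded_op_adj|exact: hY'|by rewrite adjK].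
- move=> X bX hX; split => //.
    apply: (slim_norm_closed D bX) => e /hX[A [bA [Y hY] _] XA]; by exists A, Y.
  apply: (slim_norm_closed D (bounded_op_adj bX)) => e /hX[A [bA _ [Y hY]] XA].
  exists (adj A), Y; split => //; first exact: bounded_op_adj.
  by rewrite -adjB // opnorm_adj //; exact: bounded_opB.
Qed.

Let CS_slimmable A : CS A -> slimmable A.
Proof.
move: A; apply: Cstar_sub; first exact: unital_Cstar_slimmable.
by move=> _ [j _ <-]; exact: slimmable_gen.
Qed.

Definition slimit (X : H -> H) : K -> K := xget 0 [set Y | slm X Y].

Lemma slimitE X Y : slm X Y -> slimit X = Y.
Proof.
move=> XY; rewrite /slimit; case: xgetP => [Z _ XZ|/(_ Y)/=]; last by case.
exact: slim_unique XZ XY.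
Qed.

Lemma slimitP X : slimmable X -> slm X (slimit X).
Proof. by move=> [_ [Y XY] _]; rewrite (slimitE XY). Qed.

Let CS_slim A : CS A -> slm A (slimit A).
Proof. by move=> /CS_slimmable/slimitP. Qed.

Let slimit_bounded A : CS A -> bounded_op (slimit A).
Proof. by move=> CA; exact: (slim_bounded D (CS_bounded CA) (CS_slim CA)). Qed.

Lemma slimit_gen j : slimit (optuple S V j) = T j.
Proof.
apply: slimitE; rewrite -(rho_optuple G); apply: (slim_rho D dn (bT j)).
by apply: commT_U; exact: (commutes_with_optuple G j).
Qed.

Lemma slimit_rho B : CR B -> slimit (rh B) = B.
Proof. by move=> CB; apply/slimitE/(slim_rho D dn (CR_bounded CB))/CR_commU. Qed.

Lemma slimitD A B : CS A -> CS B -> slimit (A + B) = slimit A + slimit B.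
Proof. by move=> a b; apply/slimitE/(slimD D) => //; (exact: CS_slim || exact: CS_bounded). Qed.

Lemma slimitM A B : CS A -> CS B -> slimit (A \o B) = slimit A \o slimit B.
Proof. by move=> a b; apply/slimitE/(slim_comp D) => //; (exact: CS_slim || exact: CS_bounded). Qed.

Lemma slimitZ (a : R[i]) A : CS A -> slimit (a *: A) = a *: slimit A.
Proof. by move=> /CS_slim h; apply/slimitE/(slimZ D). Qed.

Lemma slimit1 : slimit idfun = idfun.
Proof. by apply: slimitE; exact: (slim_id D dn). Qed.

Lemma slimit_adj A : CS A -> slimit (adj A) = adj (slimit A).
Proof.
move=> a; apply/esym.
exact: (slim_adj D (CS_bounded a) (CS_slim a) (CS_slim (CSadj a))).
Qed.

Lemma slimitB A B : CS A -> CS B -> slimit (A - B) = slimit A - slimit B.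
Proof.
move=> a b; have e (L : hilbertType R) (X : L -> L) : - X = (-1 : R[i]) *: X.
  by apply/funext => x; rewrite !fctE scaleN1r.
by rewrite !e slimitD ?slimitZ //; exact: CSZ.
Qed.

Lemma slimit_opnorm A : CS A -> opnorm (slimit A) <= opnorm A.
Proof. by move=> a; exact: (slim_opnorm D (CS_bounded a) (CS_slim a)). Qed.

(** The symbols of the generators are generators, and the symbol map is a
contractive star homomorphism. *)
Lemma slimit_CR A : CS A -> CR (slimit A).
Proof.
pose M := [set A | CS A /\ CR (slimit A)].
suff : CS `<=` M by move=> h /h[].
apply: Cstar_sub; last first.
  move=> _ [j _ <-]; split; first by apply: Cstar_gen; exists j.
  by rewrite slimit_gen; apply: Cstar_gen; exists j.
have [[_ CR1] _ _ _ CRc] := uCR; have [_ _ _ _ CSc] := uCS.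
split.
- split; first by move=> B [/CS_bounded].
  by split => //; rewrite slimit1.
- move=> B1 B2 [s1 r1] [s2 r2]; split; split.
  + exact: CSD.
  + by rewrite slimitD //; exact: CRD.
  + exact: CSM.
  + by rewrite slimitM //; exact: CRM.
- by move=> a B [s r]; split; [exact: CSZ|rewrite slimitZ //; exact: CRZ].
- by move=> B [s r]; split; [exact: CSadj|rewrite slimit_adj //; exact: CRadj].
- move=> B bB hB.
  have CB : CS B by apply: CSc => // e /hB[C [cC _] BC]; exists C.
  split => //; apply: CRc; first exact: slimit_bounded.
  move=> e /hB[C [cC rC] BC]; exists (slimit C) => //.
  rewrite -slimitB //; apply: le_lt_trans (slimit_opnorm _) BC.
  exact: unital_CstarB uCS CB cC.
Qed.

(** The operators [U^{-m} B'] with [B'] an extension of an element of [CS];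
their compressions [V^{*m} A] are again in [CS], whereas compression to [H] is
not multiplicative on the whole of [CR]. *)
Definition shifted_analytic : set (K -> K) := [set B | [/\ bounded_op B, B \o U = U \o B &
  exists m A, CS A /\ forall h, iter m U (B (iota h)) = iota (A h)]].

Let iterU_iota m h : iter m U (iota h) = iota (iter m V h).
Proof. by elim: m => // m IH; rewrite !iterS IH (dd_intertwine D). Qed.

Let iterU_comm B m k : B \o U = U \o B -> iter m U (B k) = B (iter m U k).
Proof. by move=> BU; exact: (congr1 (fun f => f k) (iter_commute m (esym BU))). Qed.

Lemma shifted_analytic1 : shifted_analytic idfun.
Proof. by split => //; [exact: bounded_op_id|exists 0%N, idfun]. Qed.

Lemma shifted_analyticD B1 B2 : shifted_analytic B1 -> shifted_analytic B2 ->
  shifted_analytic (B1 + B2).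
Proof.
move=> [b1 c1 [m1 [A1 [a1 h1]]]] [b2 c2 [m2 [A2 [a2 h2]]]]; split.
- exact: bounded_opD.
- apply/funext => k; rewrite -[LHS]/(B1 (U k) + B2 (U k)) -[RHS]/(U (B1 k + B2 k)) (bopD bU).
  have /(congr1 (fun f => f k))/= -> := c1.
  by have /(congr1 (fun f => f k))/= -> := c2.
exists (m1 + m2)%N, ((iter m2 V \o A1) + (iter m1 V \o A2)); split.
  by apply: CSD; apply: CSM => //; exact: unital_Cstar_iter uCS CSV.
move=> h; rewrite -[X in _ = iota X]/(iter m2 V (A1 h) + iter m1 V (A2 h)) (bopD bi).
rewrite -!iterU_iota -h1 -h2.
rewrite -!iterD (addnC m2) -(bopD (bounded_op_iter _ bU)).
by [].
Qed.

Lemma shifted_analyticM B1 B2 : shifted_analytic B1 -> shifted_analytic B2 ->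
  shifted_analytic (B1 \o B2).
Proof.
move=> [b1 c1 [m1 [A1 [a1 h1]]]] [b2 c2 [m2 [A2 [a2 h2]]]]; split.
- exact: bounded_op_comp.
- apply/funext => k /=; have /(congr1 (fun f => f k))/= -> := c2.
  by have /(congr1 (fun f => f (B2 k)))/= -> := c1.
exists (m1 + m2)%N, (A1 \o A2); split; first exact: CSM.
by move=> h /=; rewrite -h1 -h2 iterD (iterU_comm m2 _ c1).
Qed.

Lemma shifted_analyticZ (a : R[i]) B : shifted_analytic B -> shifted_analytic (a *: B).
Proof.
move=> [b c [m [A [ca h]]]]; split; first exact: bounded_opZ.
  apply/funext => k; rewrite -[LHS]/(a *: B (U k)) -[RHS]/(U (a *: B k)) (bopZ bU).
  by have /(congr1 (fun f => f k))/= -> := c.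
exists m, (a *: A); split; first exact: CSZ.
move=> x; rewrite -[X in iter m U X]/(a *: B (iota x)) (bopZ (bounded_op_iter m bU)) h.
by rewrite -(bopZ bi).
Qed.

Lemma shifted_analytic_gen j : shifted_analytic (T j).
Proof.
split; first exact: bT.
  by apply: commT_U; exact: (commutes_with_optuple G j).
exists 0%N, (optuple S V j); split; first by apply: Cstar_gen; exists j.
by move=> h; exact: gd_int G j h.
Qed.

(** From [U N_i^* = N_(d-i)]. *)
Lemma shifted_analytic_adj_gen j : shifted_analytic (adj (T j)).
Proof.
split; first exact: bounded_op_adj.
  by apply: commT_U; exact: (adjT_commutes d0 G j).
rewrite /T; have [[i [-> _]]|[-> _]] := optuple_indices S V N U j; last first.
  by exists 1%N, idfun; split => // h; exact: unitary_Kadj D _.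
have [k ki] := init_index (rev_ord i).
exists 1%N, (optuple S V k); split; first by apply: Cstar_gen; exists k.
move=> h; rewrite (optuple_init S V ki) -(gd_intN G) (gd_adjN G) /=.
have /(congr1 (fun f => f (adj U (iota h))))/= <- := gd_commNU d0 G (rev_ord i).
by rewrite (unitary_Kadj D).
Qed.

Definition star_analytic : set (K -> K) :=
  [set B | shifted_analytic B /\ shifted_analytic (adj B)].

(** Together with their adjoints these operators form a star algebra
containing the generators, so its closure contains [CR]. *)
Lemma Cstar_star_analytic : CR `<=` norm_closure star_analytic.
Proof.
apply: Cstar_sub; last first.
  move=> _ [j _ <-]; split; first exact: bT.
  move=> e e0; exists (T j).
    by split; [exact: shifted_analytic_gen|exact: shifted_analytic_adj_gen].
  rewrite subrr; apply: le_lt_trans e0; apply: opnorm_le => // x.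
  by rewrite mul0r -[X in hnorm X]/(0 : K) hnorm0.
apply: unital_Cstar_norm_closure.
- by move=> B [[]].
- by split; rewrite ?adj_id; exact: shifted_analytic1.
- move=> A B [a a'] [b b']; have [bA _ _] := a; have [bB _ _] := b; split; split.
  + exact: shifted_analyticD.
  + by rewrite adjD //; exact: shifted_analyticD.
  + exact: shifted_analyticM.
  + by rewrite adj_comp //; exact: shifted_analyticM.
- move=> c A [a a']; have [bA _ _] := a; split; first exact: shifted_analyticZ.
  by rewrite adjZ //; exact: shifted_analyticZ.
- by move=> A [a a']; have [bA _ _] := a; split => //; rewrite adjK.
Qed.

Let adjU_iota m k : adj iota (iter m (adj U) k) = iter m (adj V) (adj iota k).
Proof.
elim: m k => // m IH k; rewrite !iterS -IH.
apply: dotp_extr => h; rewrite -!adjP // -?(dd_intertwine D) //.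
Qed.

Let iterUK m k : iter m (adj U) (iter m U k) = k.
Proof. by elim: m k => // m IH k; rewrite iterSr iterS (unitary_adjK D) IH. Qed.

Let rho_shifted B m A : (forall h, iter m U (B (iota h)) = iota (A h)) ->
  rh B = iter m (adj V) \o A.
Proof.
move=> h; apply/funext => x; rewrite /rh (rhoE iota).
by rewrite -(iterUK m (B _)) h adjU_iota isometry_adjK.
Qed.

Let rhoB A B : rh (A - B) = rh A - rh B.
Proof.
apply/funext => x; rewrite -[RHS]/(rh A x - rh B x) /rh !rhoE.
by rewrite -(bopB (bounded_op_adj bi)).
Qed.

Let opnorm_rho_le B : bounded_op B -> opnorm (rh B) <= opnorm B.
Proof.
by move=> bB; apply: opnorm_le; [exact: opnorm_ge0|move=> x; exact: (rho_le D)].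
Qed.

Let CSadjV m : CS (iter m (adj V)).
Proof. by apply: unital_Cstar_iter uCS _; exact: CSadj. Qed.

(** Approximate by operators of the previous kind; compression is contractive.
*)
Lemma rho_CS B : CR B -> CS (rh B).
Proof.
move=> /Cstar_star_analytic[bB hB]; have [_ _ _ _ CSc] := uCS.
apply: CSc; first exact: (bounded_op_rho D).
move=> e /hB[B' [[bB' cB' [m [A [CA h]]]] _] BB']; exists (rh B').
  by rewrite (rho_shifted h); exact: CSM.
by rewrite -rhoB; apply: le_lt_trans (opnorm_rho_le _) BB'; exact: bounded_opB.
Qed.

Lemma rho_linear_on : linear_on CR CS rh.
Proof.
split; first exact: rho_CS.
move=> a A B _ _; apply/funext => x.
rewrite -[RHS]/(a *: rh A x + rh B x) /rh !rhoE.
by rewrite -(bopZD (bounded_op_adj bi)).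
Qed.

(** Compression is contractive on matrices. Conversely a matrix over [CR] is
the strong limit of the isometric translates of its compression, which does
not increase norms. *)
Lemma rho_completely_isometric : completely_isometric CR rh.
Proof.
move=> n A CA.
have bA i j : bounded_op (A i j) by exact: CR_bounded.
have brA i j : bounded_op (map_mx rh A i j) by rewrite mxE; exact: (bounded_op_rho D).
apply/eqP; rewrite eq_le; apply/andP; split.
  apply: mxopnorm_le => x x1.
  apply: le_trans (@le_mxopnorm _ _ _ _ (fun i => iota (x i)) bA _); last first.
    by apply: le_trans x1; apply: l2norm_le => i; rewrite isometry_hnorm.
  apply: l2norm_le => i.
  have -> : mxop (map_mx rh A) x i = adj iota (mxop A (fun i => iota (x i)) i).
    rewrite /mxop (bop_sum (bounded_op_adj bi)); apply: eq_bigr => j _.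
    by rewrite mxE.
  exact: adj_isometry_le.
apply: mxopnorm_le => x x1.
have M0 : 0 <= mxopnorm (map_mx rh A).
  apply: le_trans (l2norm_ge0 _) (le_mxopnorm (x := fun=> 0) brA _).
  by rewrite /l2norm big1 ?sqrtr0 // => i _; rewrite hnorm0 expr0n.
pose y m i := mxop (map_mx rh A) (fun j => coemb iota U m (x j)) i.
apply: (@hcvg_l2norm_le _ _ _ (fun m i => emb iota U m (y m i))) => // [i|m].
  rewrite /y /mxop.
  have key (r : seq 'I_n) : hcvg (fun m => emb iota U m
      (\sum_(j <- r) map_mx rh A i j (coemb iota U m (x j)))) (\sum_(j <- r) A i j (x j)).
    elim: r => [|j r IH].
      rewrite big_nil; apply: hcvg_ext (hcvg_cst (0 : K)) => m.
      by rewrite big_nil (bop0 (bounded_op_emb D m)).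
    have lim := slim_rho D dn (bA i j) (CR_commU (CA i j)) (x j).
    rewrite big_cons; apply: hcvg_ext (hcvgD lim IH) => m.
    by rewrite big_cons (bopD (bounded_op_emb D m)) mxE.
  exact: key.
apply: le_trans (_ : l2norm (y m) <= _).
  by apply: l2norm_le => i; rewrite (hnorm_emb D).
apply: le_mxopnorm => //; apply: le_trans x1; apply: l2norm_le => i.
exact: (coemb_le D).
Qed.

Section Kernel.
Variable J : set (H -> H).
Hypothesis cJ : closed_ideal CS J.
Hypothesis commJ : forall X Y, CS X -> toeplitz S V X -> CS Y -> toeplitz S V Y ->
  J ((X \o Y) - (Y \o X)).

Let J0 : J 0. Proof. by have [[]] := cJ. Qed.
Let JD A B : J A -> J B -> J (A + B). Proof. by have [_ h _ _] := cJ; exact: h. Qed.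
Let JMl A B : CS A -> J B -> J (A \o B).
Proof. by move=> a b; have [_ _ h _] := cJ; exact: (h A B a b).1. Qed.
Let JMr A B : CS A -> J B -> J (B \o A).
Proof. by move=> a b; have [_ _ h _] := cJ; exact: (h A B a b).2. Qed.

Let iter_adjV m : iter m (adj V) = rh (iter m (adj U)).
Proof.
by apply/funext => h; rewrite /rh rhoE adjU_iota isometry_adjK.
Qed.

Let CRadjU m : CR (iter m (adj U)).
Proof. by apply: unital_Cstar_iter uCR _; exact: (CRadj CRU). Qed.

(** If [U^m b] extends [A], then [rho b = V^{*m} A] and [rho (a b) = V^{*m}
(rho a) A], so the defect is the commutator of the Toeplitz operators [rho a]
and [V^{*m}], times [A]. *)
Lemma rho_mul_shifted a b : CR a -> shifted_analytic b ->
  J ((rh a \o rh b) - rh (a \o b)).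
Proof.
move=> Ca [bb cb [m [A [CA hA]]]]; have ba := CR_bounded Ca; have ca := CR_commU Ca.
have e1 := rho_shifted hA.
have ca' : a \o adj U = adj U \o a := comm_adjU D ca.
have e2 : rh (a \o b) = iter m (adj V) \o (rh a \o A).
  apply/funext => h; rewrite -[LHS]/(adj iota (a (b (iota h)))).
  rewrite -[RHS]/(iter m (adj V) (adj iota (a (iota (A h))))) -(adjU_iota m) -hA.
  have /(congr1 (fun f => f (iter m U (b (iota h)))))/= -> := iter_commute m (esym ca').
  by rewrite iterUK.
rewrite e1 e2; set W := iter m (adj V).
have -> : (rh a \o (W \o A)) - (W \o (rh a \o A)) = ((rh a \o W) - (W \o rh a)) \o A by [].
apply: JMr => //; rewrite /W iter_adjV; apply: commJ; try exact: rho_CS.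
  by apply: (rho_toeplitz d0 bS G ba); exact: CR_commutes.
apply: (rho_toeplitz d0 bS G); first exact: CR_bounded.
exact: CR_commutes.
Qed.

(** The cross section is multiplicative modulo the ideal, by density of the
operators treated before. *)
Lemma rho_mul a b : CR a -> CR b -> J ((rh a \o rh b) - rh (a \o b)).
Proof.
move=> Ca Cb; have ba := CR_bounded Ca; have bb := CR_bounded Cb.
have brho := bounded_op_rho D; have [_ _ _ Jc] := cJ.
have bdef b' : bounded_op b' -> bounded_op ((rh a \o rh b') - rh (a \o b')).
  move=> bb'; apply: bounded_opB; first by apply: bounded_op_comp; exact: brho.
  by apply: brho; exact: bounded_op_comp.
apply: Jc; first exact: bdef.
move=> e e0; have a0 := opnorm_ge0 ba.
have [_ hb] := Cstar_star_analytic Cb.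
have [|b' [sb' _] bb'] := hb (e / (2 * opnorm a + 1)); first by rewrite divr_gt0 //; lra.
exists ((rh a \o rh b') - rh (a \o b')); first exact: rho_mul_shifted.
have [b'b _ _] := sb'; have bd := bounded_opB bb b'b.
have -> : (rh a \o rh b) - rh (a \o b) - ((rh a \o rh b') - rh (a \o b')) =
    (rh a \o rh (b - b')) - rh (a \o (b - b')).
  apply/funext => x.
  rewrite -[LHS]/(rh a (rh b x) - rh (a \o b) x - (rh a (rh b' x) - rh (a \o b') x)).
  rewrite -[RHS]/(rh a (rh (b - b') x) - rh (a \o (b - b')) x).
  have -> : rh a (rh (b - b') x) = rh a (rh b x) - rh a (rh b' x).
    by rewrite rhoB -(bopB (brho _ ba)).
  have -> : rh (a \o (b - b')) x = rh (a \o b) x - rh (a \o b') x.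
    have -> : a \o (b - b') = (a \o b) - (a \o b').
      by apply/funext => k; rewrite -[LHS]/(a (b k - b' k)) (bopB ba).
    by rewrite rhoB.
  by rewrite !opprB addrACA [RHS]addrACA; congr (_ + _); exact: addrC.
have := opnorm_dist (bounded_op_comp (brho _ ba) (brho _ bd)) (bounded_op0 H H)
  (brho _ (bounded_op_comp ba bd)).
have -> : opnorm (0 - rh (a \o (b - b'))) = opnorm (rh (a \o (b - b'))) by rewrite opnormBC subr0.
rewrite subr0.
have := opnorm_comp (brho _ ba) (brho _ bd).
have := opnorm_rho_le (bounded_op_comp ba bd); have := opnorm_comp ba bd.
have h1 := opnorm_rho_le ba; have h2 := opnorm_rho_le bd.
have : opnorm (rh a) * opnorm (rh (b - b')) <= opnorm a * opnorm (b - b').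
  by apply: ler_pM => //; [exact: opnorm_ge0 (brho _ ba)|exact: opnorm_ge0 (brho _ bd)].
rewrite ltr_pdivlMr in bb'; last by lra.
have := opnorm_ge0 bd; lra.
Qed.

Let dft A := A - rh (slimit A).

Let dft_CS A : CS A -> CS (dft A).
Proof. by move=> CA; exact: unital_CstarB uCS CA (rho_CS (slimit_CR CA)). Qed.

Let dftB A B : CS A -> CS B -> dft (A - B) = dft A - dft B.
Proof.
move=> a b; rewrite /dft slimitB // rhoB !opprB addrACA [RHS]addrACA.
by congr (_ + _); exact: addrC.
Qed.

Let dft_le A : CS A -> opnorm (dft A) <= 2 * opnorm A.
Proof.
move=> CA; have bA := CS_bounded CA; have bs := slimit_bounded CA.
have := opnorm_dist bA (bounded_op0 H H) (bounded_op_rho D bs).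
have -> : opnorm (0 - rho iota (slimit A)) = opnorm (rh (slimit A)) by rewrite opnormBC subr0.
rewrite subr0.
have := opnorm_rho_le bs; have := slimit_opnorm CA; rewrite /dft; lra.
Qed.

Lemma defect_norm_closed X : CS X ->
  (forall e : R, 0 < e -> exists A, [/\ CS A, J (dft A) & opnorm (X - A) < e]) -> J (dft X).
Proof.
move=> CX hX; have [_ _ _ Jc] := cJ; apply: Jc; first exact: CS_bounded (dft_CS CX).
move=> e e0; have [|A [CA JA XA]] := hX (e / 2); first by lra.
exists (dft A) => //; rewrite -dftB //.
have := dft_le (unital_CstarB uCS CX CA); lra.
Qed.

(** Write [A B - rho (a b)] as [(A - rho a) B + (rho a) (B - rho b) + ((rho a)
(rho b) - rho (a b))], with [a] and [b] the symbols. *)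
Lemma defect_mul A B : CS A -> CS B -> J (dft A) -> J (dft B) -> J (dft (A \o B)).
Proof.
move=> CA CB JA JB; set a := slimit A; set b := slimit B.
have Ca : CR a := slimit_CR CA; have Cb : CR b := slimit_CR CB.
have -> : dft (A \o B) = (dft A \o B) + ((rh a \o dft B) + ((rh a \o rh b) - rh (a \o b))).
  rewrite /dft slimitM // -/a -/b; apply/funext => x.
  rewrite -[LHS]/(A (B x) - rh (a \o b) x).
  rewrite -[RHS]/((A (B x) - rh a (B x)) +
    (rh a (B x - rh b x) + (rh a (rh b x) - rh (a \o b) x))).
  rewrite /rh (bopB (bounded_op_rho D (CR_bounded Ca))).
  by rewrite [X in _ = _ + X]addrA subrK addrA subrK.
apply: JD; first exact: JMr.
by apply: JD; [apply: JMl => //; exact: rho_CS|exact: rho_mul].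
Qed.

(** The elements congruent, together with their adjoints, to a compression of
their symbol modulo the ideal form a C-star algebra. It contains the
generators, which are compressions. *)
Lemma defect_ideal A : CS A -> J (dft A).
Proof.
pose M := [set A | [/\ CS A, J (dft A) & J (dft (adj A))]].
suff : CS `<=` M by move=> h /h[].
have brho := bounded_op_rho D.
have dftZ (a : R[i]) B : CS B -> dft (a *: B) = (a *: idfun) \o dft B.
  move=> CB; rewrite /dft slimitZ //; apply/funext => x.
  have bs := slimit_bounded CB.
  rewrite -[LHS]/(a *: B x - adj iota (a *: slimit B (iota x))) (bopZ (bounded_op_adj bi)).
  by rewrite -[RHS]/(a *: (B x - rh (slimit B) x)) scalerBr.
have dft0 (B : K -> K) : CR B -> dft (rh B) = 0.
  by move=> CB; rewrite /dft slimit_rho // subrr.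
have dftD B C : CS B -> CS C -> dft (B + C) = dft B + dft C.
  move=> b c; rewrite /dft slimitD //.
  have -> : rh (slimit B + slimit C) = rh (slimit B) + rh (slimit C).
    apply/funext => x.
    rewrite -[LHS]/(adj iota (slimit B (iota x) + slimit C (iota x))).
    by rewrite (bopD (bounded_op_adj bi)).
  by rewrite opprD addrACA.
apply: Cstar_sub; last first.
  move=> _ [j _ <-]; have CT : CR (T j) by apply: Cstar_gen; exists j.
  have e : optuple S V j = rh (T j) by rewrite -(rho_optuple G).
  split; first by apply: Cstar_gen; exists j.
    by rewrite e dft0.
  by rewrite e (adj_rho D) // dft0 //; exact: CRadj.
have d1 : dft idfun = 0.
  rewrite /dft slimit1 (_ : rh idfun = idfun) ?subrr //.
  by apply/funext => x; rewrite /rh rhoE isometry_adjK.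
split.
- by split=> [B [/CS_bounded]//|]; split; rewrite ?adj_id ?d1.
- move=> B C [b1 b2 b3] [c1 c2 c3]; have bB := CS_bounded b1; have bC := CS_bounded c1.
  split; split.
  + exact: CSD.
  + by rewrite dftD //; exact: JD.
  + by rewrite adjD // dftD; [exact: JD|exact: CSadj|exact: CSadj].
  + exact: CSM.
  + exact: defect_mul.
  + by rewrite adj_comp //; apply: defect_mul => //; exact: CSadj.
- move=> a B [b1 b2 b3]; have bB := CS_bounded b1; split; first exact: CSZ.
    by rewrite dftZ //; apply: JMl => //; exact: CSZ.
  rewrite adjZ // dftZ; last exact: CSadj.
  by apply: JMl => //; exact: CSZ.
- by move=> B [b1 b2 b3]; split => //; [exact: CSadj|rewrite adjK //; exact: CS_bounded].
- move=> B bB hB; have [_ _ _ _ CSc] := uCS.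
  have CB : CS B by apply: CSc => // e /hB[C [cC _ _] BC]; exists C.
  split => //.
    by apply: defect_norm_closed => // e /hB[C [cC c2 _] BC]; exists C.
  apply: defect_norm_closed => [|e /hB[C [cC c2 c3] BC]]; first exact: CSadj.
  have bC := CS_bounded cC.
  exists (adj C); split => //; first exact: CSadj.
  by rewrite -adjB // opnorm_adj //; exact: bounded_opB.
Qed.

Lemma kernel_sub_ideal A : CS A -> slimit A = 0 -> J A.
Proof.
move=> CA A0; have := defect_ideal CA; rewrite /dft A0.
rewrite (_ : rh 0 = 0) ?subr0 //; apply/funext => x.
by rewrite /rh rhoE -[X in adj iota X]/(0 : K) (bop0 (bounded_op_adj bi)).
Qed.

End Kernel.

Lemma slimit_kernel_ideal : closed_ideal CS [set A | CS A /\ slimit A = 0].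
Proof.
have C0 : CS 0.
  by rewrite -(subrr (idfun : H -> H)); exact: unital_CstarB uCS CS1 CS1.
split.
- split; first by move=> A [].
  by split => //; rewrite -(subrr (idfun : H -> H)) slimitB // subrr.
- by move=> A B [a a0] [b b0]; split; [exact: CSD|rewrite slimitD // a0 b0 addr0].
- move=> A B a [b b0]; split; split; [exact: CSM| |exact: CSM|];
    rewrite slimitM // b0 //.
  by rewrite comp_zeror //; exact: slimit_bounded.
- move=> X bX hX; have [_ _ _ _ CSc] := uCS.
  have CX : CS X by apply: CSc => // e /hX[A [CA _] XA]; exists A.
  split => //; apply: opnorm_eq0; first exact: slimit_bounded.
  move=> e /hX[A [CA A0] XA]; apply: le_trans (ltW XA).
  by rewrite -[slimit X]subr0 -A0 -slimitB //; apply: slimit_opnorm; exact: unital_CstarB uCS CX CA.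
Qed.

(** Symbols commute, so commutators have symbol zero. Conversely an element
with zero symbol equals its own defect, which lies in every closed ideal
containing the commutators. *)
Lemma slimit_kernel : [set A | CS A /\ slimit A = 0] = commutator_ideal S V.
Proof.
apply/seteqP; split.
  move=> A [CA A0] J [cJ GJ]; apply: (kernel_sub_ideal cJ) => // X Y cX tX cY tY.
  by apply: GJ; exists X => //; exists Y.
apply: generated_ideal_sub; first exact: slimit_kernel_ideal.
move=> _ [X [CX _] [Y [CY _] <-]].
have CXY : CS (X \o Y) by exact: CSM.
have CYX : CS (Y \o X) by exact: CSM.
split; first exact: unital_CstarB uCS CXY CYX.
rewrite (slimitB CXY CYX) (slimitM CX CY) (slimitM CY CX).
have cY := slimit_CR CY; have cX := slimit_CR CX.
rewrite (Cstar_bicommutant cY (slimit_bounded CX) (CR_commutes cX)).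
exact: subrr.
Qed.

Lemma Cstar_extension : exists pi0 : (H -> H) -> (K -> K),
  [/\ unital_star_morphism CS CR pi0,
      forall j, pi0 (optuple S V j) = optuple N U j,
      pi0 @` CS = CR,
      [set A | CS A /\ pi0 A = 0] = commutator_ideal S V &
      exists rho0 : (K -> K) -> (H -> H),
        [/\ linear_on CR CS rho0, completely_isometric CR rho0 &
            forall B, CR B -> pi0 (rho0 B) = B]].
Proof.
exists slimit; split.
- split.
  + split; first exact: slimit_CR.
    move=> a A B CA CB; rewrite slimitD ?slimitZ //; exact: CSZ.
  + exact: slimit1.
  + by move=> A B; exact: slimitM.
  + by move=> A; exact: slimit_adj.
- exact: slimit_gen.
- apply/seteqP; split; first by move=> _ [A CA <-]; exact: slimit_CR.
  by move=> B CB; exists (rh B); [exact: rho_CS|exact: slimit_rho].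
- exact: slimit_kernel.
- exists rh; split; [exact: rho_linear_on|exact: rho_completely_isometric|exact: slimit_rho].
Qed.

End CstarExtension.

(** * The theorem *)

Theorem theorem5p6 (R : realType) (d : nat) (hd : (2 <= d)%N)
    (H : hilbertType R) (S : 'I_d.-1 -> H -> H) (V : H -> H)
    (hS : gamma_isometry S V) :
  exists (K : hilbertType R) (iota : H -> K)
         (N : 'I_d.-1 -> K -> K) (U : K -> K),
    (* (1) *)
    ([/\ minimal_extension S V iota N U,
         (forall (K' : hilbertType R) (iota' : H -> K')
                 (N' : 'I_d.-1 -> K' -> K') (U' : K' -> K'),
            minimal_extension S V iota' N' U' ->
            equivalent_extensions iota N U iota' N' U'),
         closure (lspan [set zpow U m (iota h) | m in [set: int] & h in [set: H]])
           = [set: K] &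
         forall X : H -> H, bounded_op X ->
           (commutes_with (optuple S V) X <->
            exists! Y : K -> K,
              [/\ bounded_op Y,
                  forall h, Y (iota h) = iota (X h),
                  opnorm Y = opnorm X &
                  commutes_with (optuple N U) Y])]) /\
    (* (2) *)
    (forall X : H -> H, bounded_op X ->
       (toeplitz S V X <->
        exists! Y : K -> K,
          [/\ bounded_op Y,
              commutes_with (optuple N U) Y,
              opnorm X = opnorm Y &
              forall h, iota (X h) = orthoproj (range iota) (Y (iota h))])) /\
    (* (3) *)
    (let CS := Cstar (range (optuple S V)) in
     let CR := Cstar (range (optuple N U)) in
     exists pi0 : (H -> H) -> (K -> K),
       [/\ unital_star_morphism CS CR pi0,
           forall j, pi0 (optuple S V j) = optuple N U j,
           pi0 @` CS = CR,
           [set A | CS A /\ pi0 A = 0] = commutator_ideal S V &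
           exists rho0 : (K -> K) -> (H -> H),
             [/\ linear_on CR CS rho0,
                 completely_isometric CR rho0 &
                 forall B, CR B -> pi0 (rho0 B) = B]]).
Proof.
have d0 : (0 < d)%N by exact: leq_trans hd.
have [bS _ _] := hS.
have [K [iota [N [U mext]]]] := minimal_extension_exists d0 bS hS.
have [G dn] := minimal_extension_dense d0 bS mext.
exists K, iota, N, U; split; first split=> [//|K' iota' N' U' mext'||X bX].
- exact: (minimal_extensions_equivalent d0 bS mext mext').
- exact: (span_orbit_dense G dn).
- exact: (commutant_extension d0 bS G dn bX).
split=> [X bX|]; first exact: (toeplitz_dilation d0 bS G dn bX).
exact: (Cstar_extension d0 bS G dn).
Qed.
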